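(* Let $\tau>0$ and let $c_1,c_2,d_1,d_2>0$ satisfy $$d_1^2\ge d_2(c_2+d_2),\qquad c_1^2\ge c_2(c_2+d_1+d_2),$$ $$\frac{2d_1c_p+(d_1+d_2)(c_2+d_2)}{d_1^2-d_2(c_2+d_2)}<\frac{2c_1d_1}{c_2(c_2+d_2)}-1-\frac{d_1^2(c_2+d_1+d_2)}{c_2(c_2+d_2)^2}$$ (in particular, the denominator on the left is nonzero), and $$\sqrt{\frac{c_p}{c_1}}<\frac{d_1}{c_2(c_2+d_2)}\left(2c_1-\frac{c_2d_1+d_1^2+d_1d_2}{c_2+d_2}-\frac{c_2(c_2+d_2)}{d_1}\right).$$ Let $V^0\in\mathscr{H}$, let $V=(y,\partial_t y,z,\partial_t z)^T$ be the mild solution of $\dot V=\mathscr{A}V$, $V(0)=V^0$, and let $\mathcal{E}(t)$ be its energy as defined in the context. Then there exist positive constants $\tilde\alpha$ and $C$ such that $$\mathcal{E}(t)\le Ce^{-2\tilde\alpha t}\mathcal{E}(0)\quad\text{for } t\ge0.$$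
   Context: $\Omega \subset \mathbb{R}^d$ is a bounded Lipschitz domain with boundary $\Gamma$; $\Gamma_0,\Gamma_1\subset\Gamma$ are relatively open with $\Gamma = \bar{\Gamma}_0 \cup \bar{\Gamma}_1$, $\bar{\Gamma}_0 \cap \bar{\Gamma}_1 = \emptyset$, $\Gamma_0 \neq \emptyset$. $H^1_{\Gamma_0}(\Omega) = \{u \in H^1(\Omega) : u|_{\Gamma_0} = 0\}$; $\|\cdot\|$ is the norm of $L^2(\Omega)$. $c_p>0$ denotes the Poincaré–Friedrichs constant, i.e. $\|u\|^2\le c_p\|\nabla u\|^2$ for every $u\in H^1_{\Gamma_0}(\Omega)$. $\mathscr{H} = H^1_{\Gamma_0}(\Omega) \times L^2(\Omega) \times L^2(0,1; H^1_{\Gamma_0}(\Omega)) \times L^2(0,1; H^1_{\Gamma_0}(\Omega))$ with (a Hilbert norm equivalent to) the product norm. For $V=(v_1,v_2,v_3,v_4)^T$ set $$\mathscr{A} V = \big(v_2,\ c_1 \triangle v_1 + c_2 \triangle v_3|_{s=1} + d_1 \triangle v_2 + d_2 \triangle v_4|_{s=1},\ -\tau^{-1} \partial_s v_3,\ -\tau^{-1}\partial_s v_4\big)^T,$$ with $D(\mathscr{A})$ consisting of all $V\in\mathscr{H}$ such that $\mathscr{A}V\in\mathscr{H}$, $v_3|_{s=0}=v_1$, $v_4|_{s=0}=v_2$ and $$\int_\Omega \big(c_1 \triangle v_1 + c_2 \triangle v_3|_{s=1} + d_1 \triangle v_2 + d_2 \triangle v_4|_{s=1}\big)\psi\,dx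 = -\int_\Omega \big(c_1 \nabla v_1 + c_2 \nabla v_3|_{s=1} + d_1 \nabla v_2 + d_2 \nabla v_4|_{s=1}\big)\cdot \nabla\psi\,dx$$ for every $\psi\in H^1_{\Gamma_0}(\Omega)$. $\mathscr{A}$ generates a $C_0$-semigroup on $\mathscr{H}$. The equation $\dot V=\mathscr{A}V$ is the abstract form of the delay equation $\partial_{tt}y-c_1\triangle y-c_2\triangle y(t-\tau,\cdot)-d_1\partial_t\triangle y-d_2\partial_t\triangle y(t-\tau,\cdot)=0$ with $y=0$ on $\Gamma_0$, $\partial y/\partial\nu=0$ on $\Gamma_1$; the components of the solution $V=(v_1,v_2,v_3,v_4)^T$ are denoted $y:=v_1$, $\partial_t y:=v_2$, $z:=v_3$ (history variable $z(t,s,x)=y(t-\tau s,x)$), $\partial_t z:=v_4$. The energy is $$\mathcal{E}(t)=\frac12\|\partial_t y\|^2+\frac{c_1}{2}\|\nabla y\|^2+\frac{\tau d_1}{2}\int_0^1\|\nabla z(s,\cdot)\|^2\,ds+\frac{\tau d_2}{2}\int_0^1\|\partial_t\nabla z(s,\cdot)\|^2\,ds$$ evaluated at time $t$. *)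

(* Defs.v *)
From HB Require Import structures.
From mathcomp Require Import all_boot all_order all_algebra.
From mathcomp Require Import all_classical all_reals all_analysis.

Set Implicit Arguments.
Unset Strict Implicit.
Unset Printing Implicit Defensive.

Import Order.TTheory GRing.Theory Num.Theory.
Import numFieldNormedType.Exports.

Local Open Scope classical_set_scope.
Local Open Scope ring_scope.

Definition cara_measure (R : realType) (T : pointedType)
    (mu : {outer_measure set T -> \bar R}) :
    {measure set (caratheodory_type mu) -> \bar R} :=
  (mu : set (caratheodory_type mu) -> \bar R).

(* Outer measure inf { sum_k g (B k) | A `<=` \bigcup_k B k } of a gauge [g]
   defined on all sets; [mu_ext] is instantiated on the space in which every
   set is measurable. *)
Definition gauge_ext (R : realType) (n : nat) (g : set 'rV[R]_n.+1 -> \bar R)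
    : set 'rV[R]_n.+1 -> \bar R :=
  mu_ext (g : set (g_sigma_algebraType [set: set 'rV[R]_n.+1]) -> \bar R).

Section gauge_ext.
Context (R : realType) (n : nat) (g : set 'rV[R]_n.+1 -> \bar R).
Hypotheses (g0 : g set0 = 0%E) (g_ge0 : forall A, (0 <= g A)%E).

Lemma gauge_ext0 : gauge_ext g set0 = 0%E.
Proof. exact: mu_ext0. Qed.

Lemma gauge_ext_ge0 A : (0 <= gauge_ext g A)%E.
Proof. exact: mu_ext_ge0. Qed.

Lemma le_gauge_ext :
  {homo gauge_ext g : A B / A `<=` B >-> (A <= B)%E}.
Proof.
move=> A B AB.
exact: (le_mu_ext
  (g : set (g_sigma_algebraType [set: set 'rV[R]_n.+1]) -> \bar R) AB).
Qed.

Lemma gauge_ext_sigma_subadditive : sigma_subadditive (gauge_ext g).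
Proof.
exact: (@mu_ext_sigma_subadditive _
  (g_sigma_algebraType [set: set 'rV[R]_n.+1]) R g g_ge0).
Qed.

End gauge_ext.

Definition box (R : realType) (n : nat) (a b : 'rV[R]_n.+1) : set 'rV[R]_n.+1 :=
  [set x | forall i, a ord0 i < x ord0 i <= b ord0 i].

(* Infimum of the volumes of the boxes that contain A (+oo if there is none). *)
Definition box_gauge (R : realType) (n : nat) (A : set 'rV[R]_n.+1) : \bar R :=
  ereal_inf [set v | exists a b : 'rV[R]_n.+1,
    [/\ forall i, a ord0 i <= b ord0 i, A `<=` box a b
      & v = (\prod_i (b ord0 i - a ord0 i))%:E]].

Definition lebesgue_outer (R : realType) (n : nat)
  : set 'rV[R]_n.+1 -> \bar R := gauge_ext (@box_gauge R n).

Section lebesgue_outer.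
Context (R : realType) (n : nat).

Let box_gauge_ge0 (A : set 'rV[R]_n.+1) : (0 <= box_gauge A)%E.
Proof.
apply: le_ereal_inf_tmp => _ [a [b [ab _ ->]]]; rewrite lee_fin.
by apply: prodr_ge0 => i _; rewrite subr_ge0.
Qed.

Let box_gauge0 : box_gauge (set0 : set 'rV[R]_n.+1) = 0%E.
Proof.
apply/eqP; rewrite eq_le box_gauge_ge0 andbT; apply: ereal_inf_lbound.
exists 0, 0; split=> //; congr EFin.
by rewrite big_ord_recl subrr mul0r.
Qed.

HB.instance Definition _ := isOuterMeasure.Build R 'rV[R]_n.+1
  (@lebesgue_outer R n)
  (gauge_ext0 box_gauge0 box_gauge_ge0)
  (gauge_ext_ge0 box_gauge_ge0)
  (@le_gauge_ext R n (@box_gauge R n))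
  (gauge_ext_sigma_subadditive box_gauge_ge0).

End lebesgue_outer.

(* Lebesgue measure on R^d, on the Caratheodory-measurable sets. *)
Definition leb (R : realType) (n : nat) :
    {measure set (caratheodory_type (@lebesgue_outer R n)) -> \bar R} :=
  cara_measure _.

Definition enorm (R : realType) (n : nat) (x : 'rV[R]_n.+1) : R :=
  Num.sqrt (\sum_i (x ord0 i) ^+ 2).

(* (diam A) ^ s for nonempty A of Euclidean diameter at most delta (so that
   nonempty sets have gauge 1 when s = 0); +oo if the diameter is larger. *)
Definition hausdorff_gauge (R : realType) (n s : nat) (delta : R)
    (A : set 'rV[R]_n.+1) : \bar R :=
  if `[< A = set0 >] then 0%E else
  ereal_inf [set (r ^+ s)%:E | r in [set r : R | 0 <= r <= delta /\
    forall x y, A x -> A y -> enorm (x - y) <= r]].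

(* Not normalized: the usual surface measure is a constant multiple of it. *)
Definition hausdorff_outer (R : realType) (n s : nat)
    (A : set 'rV[R]_n.+1) : \bar R :=
  ereal_sup [set gauge_ext (hausdorff_gauge s delta) A
            | delta in [set delta : R | 0 < delta]].

Section hausdorff_outer.
Context (R : realType) (n s : nat).

Let hg_ge0 (delta : R) (A : set 'rV[R]_n.+1) :
  (0 <= hausdorff_gauge s delta A)%E.
Proof.
rewrite /hausdorff_gauge; case: ifP => // _.
apply: le_ereal_inf_tmp => _ [r [/andP[r0 _] _] <-].
by rewrite lee_fin exprn_ge0.
Qed.

Let hg0 (delta : R) : hausdorff_gauge s delta (set0 : set 'rV[R]_n.+1) = 0%E.
Proof. by rewrite /hausdorff_gauge; case: ifPn => // /asboolP. Qed.

Let hausdorff_outer0 : hausdorff_outer s (set0 : set 'rV[R]_n.+1) = 0%E.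
Proof.
rewrite /hausdorff_outer.
apply/eqP; rewrite eq_le; apply/andP; split.
  apply: ge_ereal_sup => _ [delta _ <-].
  by rewrite (gauge_ext0 (hg0 delta) (hg_ge0 delta)).
apply: ereal_sup_ubound; exists 1; first exact: ltr01.
exact: (gauge_ext0 (hg0 1) (hg_ge0 1)).
Qed.

Let hausdorff_outer_ge0 (A : set 'rV[R]_n.+1) : (0 <= hausdorff_outer s A)%E.
Proof.
apply: (@le_trans _ _ (gauge_ext (hausdorff_gauge s 1) A)).
  exact: (gauge_ext_ge0 (hg_ge0 1)).
by apply: ereal_sup_ubound; exists 1; first exact: ltr01.
Qed.

Let le_hausdorff_outer :
  {homo @hausdorff_outer R n s : A B / A `<=` B >-> (A <= B)%E}.
Proof.
move=> A B AB; apply: ge_ereal_sup => _ [delta d0 <-].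
apply: le_trans (le_gauge_ext _ AB) _.
by apply: ereal_sup_ubound; exists delta.
Qed.

Let hausdorff_outer_sigma_subadditive :
  sigma_subadditive (@hausdorff_outer R n s).
Proof.
move=> A; apply: ge_ereal_sup => _ [delta d0 <-].
apply: le_trans (gauge_ext_sigma_subadditive (hg_ge0 delta) A) _.
apply: lee_nneseries => k *.
  exact: (gauge_ext_ge0 (hg_ge0 delta)).
by apply: ereal_sup_ubound; exists delta.
Qed.

HB.instance Definition _ := isOuterMeasure.Build R 'rV[R]_n.+1
  (@hausdorff_outer R n s)
  hausdorff_outer0 hausdorff_outer_ge0 le_hausdorff_outer
  hausdorff_outer_sigma_subadditive.

End hausdorff_outer.

Definition hausdorff (R : realType) (n s : nat) :
    {measure set (caratheodory_type (@hausdorff_outer R n s)) -> \bar R} :=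
  cara_measure _.

(* A normed space presented by representatives: the space meant is the quotient
   of the linear subspace [nmem] by { u | nnorm u = 0 }. Outside [nmem] the
   value of [nnorm] has no meaning. *)
Record nspace (R : realType) := NSpace {
  ncar :> lmodType R ;
  nmem : set ncar ;
  nnorm : ncar -> R }.

Arguments nmem {R} _ _.
Arguments nnorm {R} _ _.

Definition nprod (R : realType) (E F : nspace R) : nspace R :=
  @NSpace R (E * F)%type
    [set p | nmem E p.1 /\ nmem F p.2]
    (fun p => Num.sqrt (nnorm E p.1 ^+ 2 + nnorm F p.2 ^+ 2)).

Section bochner.
Context (R : realType) (E : nspace R).

(* [:: (A_1, u_1); ...; (A_m, u_m)] stands for \sum_k \1_(A_k) u_k. *)
Definition simple_wf (f : seq (set R * E)) : Prop :=
  forall p, p \in f -> measurable (p.1 : set (measurableTypeR R)) /\ nmem E p.2.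

Definition simple_fun (f : seq (set R * E)) (s : R) : E :=
  \sum_(p <- f) (\1_(p.1) s : R) *: p.2.

Definition simple_int (f : seq (set R * E)) : E :=
  \sum_(p <- f) fine (lebesgue_measure (p.1 `&` `]0, 1[%classic)) *: p.2.

(* Conditions that usually hold for almost every s are imposed for every s in
   ]0,1[: each class of almost everywhere equal functions contains such a
   representative. *)
Definition strongly_measurable (v : R -> E) : Prop :=
  exists f : nat -> seq (set R * E),
    (forall k, simple_wf (f k)) /\
    (forall s, 0 < s < 1 -> nnorm E (simple_fun (f k) s - v s) @[k --> \oo] --> 0).

Definition BochnerL2 : nspace R :=
  @NSpace R (R -> E)
    [set v | [/\ forall s, 0 < s < 1 -> nmem E (v s),
      strongly_measurable v
      & (\int[lebesgue_measure]_(s in `]0%R, 1%R[) (nnorm E (v s) ^+ 2)%:E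
           < +oo)%E]]
    (fun v => Num.sqrt
      (\int[lebesgue_measure]_(s in `]0%R, 1%R[) (nnorm E (v s) ^+ 2))).

Definition is_bochner_int (v : R -> E) (I : E) : Prop :=
  [/\ nmem E I, strongly_measurable v &
    exists f : nat -> seq (set R * E),
    [/\ forall k, simple_wf (f k),
      (\int[lebesgue_measure]_(s in `]0%R, 1%R[)
          (nnorm E (simple_fun (f k) s - v s))%:E)%E @[k --> \oo] --> 0%E
      & nnorm E (simple_int (f k) - I) @[k --> \oo] --> 0]].

(* C_c^oo(0,1); the closed support is compact since ]0,1[ is bounded. *)
Definition test01 (phi : R -> R) : Prop :=
  (forall k s, derivable (derive1n k phi) s 1) /\
  closure [set s | phi s != 0] `<=` `]0, 1[%classic.

(* \int_0^1 phi' v = - \int_0^1 phi w in E for all phi in C_c^oo(0,1). *)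
Definition is_sderiv (v w : R -> E) : Prop :=
  [/\ nmem BochnerL2 v, nmem BochnerL2 w &
    forall phi, test01 phi -> exists I : E,
      is_bochner_int (fun s => derive1 phi s *: v s) I /\
      is_bochner_int (fun s => phi s *: w s) (- I)].

(* v|_{s = s0} = a, for the representative of v in C([0,1];E). *)
Definition has_strace (v : R -> E) (s0 : R) (a : E) : Prop :=
  nmem E a /\ exists vc : R -> E,
  [/\ forall s, 0 <= s <= 1 -> nmem E (vc s),
      forall s, 0 <= s <= 1 ->
        nnorm E (vc r - vc s) @[r --> within `[0, 1]%classic (nbhs s)] --> 0,
      {ae lebesgue_measure, forall s, 0 < s < 1 -> nnorm E (v s - vc s) = 0}
    & nnorm E (vc s0 - a) = 0].

End bochner.

Record C0_semigroup (R : realType) (E : nspace R) (T : R -> E -> E) : Prop := {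
  semigroup_mem : forall t u, 0 <= t -> nmem E u -> nmem E (T t u) ;
  semigroup_linear : forall t (a : R) u w, 0 <= t -> nmem E u -> nmem E w ->
    nnorm E (T t (a *: u + w) - (a *: T t u + T t w)) = 0 ;
  semigroup_bounded : forall t, 0 <= t -> exists M : R, forall u, nmem E u ->
    nnorm E (T t u) <= M * nnorm E u ;
  semigroup_id : forall u, nmem E u -> nnorm E (T 0 u - u) = 0 ;
  semigroup_comp : forall t s u, 0 <= t -> 0 <= s -> nmem E u ->
    nnorm E (T (t + s) u - T t (T s u)) = 0 ;
  semigroup_cont : forall u, nmem E u ->
    nnorm E (T h u - u) @[h --> 0^'+] --> 0 }.

(* The operator is given by its graph: A u w means u \in D(A) and A u = w. *)
Definition is_generator (R : realType) (E : nspace R) (A : E -> E -> Prop)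
    (T : R -> E -> E) : Prop :=
  forall u w, nmem E u -> nmem E w ->
    (A u w <-> nnorm E (h^-1 *: (T h u - u) - w) @[h --> 0^'+] --> 0).

(* When A generates T, the mild solution of V' = A V, V(0) = V0 is the orbit
   t |-> T t V0; V is any choice of representatives of it. *)
Definition is_mild_solution (R : realType) (E : nspace R) (T : R -> E -> E)
    (V0 : E) (V : R -> E) : Prop :=
  forall t, 0 <= t -> nmem E (V t) /\ nnorm E (V t - T t V0) = 0.

Definition frontier (R : realType) (n : nat) (Omega : set 'rV[R]_n.+1) :=
  closure Omega `\` Omega°.

(* Near each boundary point Omega is, in suitable orthonormal coordinates, the
   strict epigraph of a Lipschitz function. *)
Definition lipschitz_boundary (R : realType) (n : nat)
    (Omega : set 'rV[R]_n.+1) : Prop :=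
  forall p, frontier Omega p ->
  exists (Q : 'M[R]_n.+1) (gamma : 'rV[R]_n -> R) (K : R),
    [/\ Q *m Q^T = 1%:M,
        forall y z, `|gamma y - gamma z| <= K * `|y - z|
      & \forall x \near p,
          Omega x <-> gamma (col' ord0 (x *m Q)) < (x *m Q) ord0 ord0].

Definition bounded_lipschitz_domain (R : realType) (n : nat)
    (Omega : set 'rV[R]_n.+1) : Prop :=
  [/\ open Omega, connected Omega, bounded_set Omega
    & lipschitz_boundary Omega].

Definition relatively_open (R : realType) (n : nat)
    (Gamma S : set 'rV[R]_n.+1) : Prop :=
  exists U : set 'rV[R]_n.+1, open U /\ S = Gamma `&` U.

Definition partial (R : realType) (n : nat) (i : 'I_n.+1)
    (phi : 'rV[R]_n.+1 -> R) : 'rV[R]_n.+1 -> R :=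
  fun x => 'D_(delta_mx ord0 i) phi x.

Fixpoint Ck (R : realType) (n k : nat) (phi : 'rV[R]_n.+1 -> R) : Prop :=
  continuous phi /\
  if k is k'.+1 then
    forall i, (forall x, derivable phi x (delta_mx ord0 i)) /\
              Ck k' (partial i phi)
  else True.

Definition smooth (R : realType) (n : nat) (phi : 'rV[R]_n.+1 -> R) : Prop :=
  forall k, Ck k phi.

(* C_c^oo(Omega) *)
Definition test_fun (R : realType) (n : nat) (Omega : set 'rV[R]_n.+1)
    (phi : 'rV[R]_n.+1 -> R) : Prop :=
  [/\ smooth phi, compact (closure [set x | phi x != 0])
    & closure [set x | phi x != 0] `<=` Omega].

Section sobolev.
Context (R : realType) (n : nat) (Omega : set 'rV[R]_n.+1).
Local Notation X := 'rV[R]_n.+1.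
Local Notation mX := (caratheodory_type (@lebesgue_outer R n)).
Local Notation mu := (@leb R n).
Local Notation fct := (X -> R^o).

Definition inL2 (u : fct) : Prop :=
  measurable_fun (Omega : set mX) (u : mX -> R) /\
  (\int[mu]_(x in Omega) ((u x : R) ^+ 2)%:E < +oo)%E.

Definition l2dot (u w : fct) : R :=
  \int[mu]_(x in Omega) ((u x : R) * (w x : R)).

Definition l2norm (u : fct) : R := Num.sqrt (l2dot u u).

Definition L2 : nspace R := @NSpace R fct inL2 l2norm.

Definition is_wgrad (u : fct) (g : 'I_n.+1 -> fct) : Prop :=
  forall i, inL2 (g i) /\
    forall phi, test_fun Omega phi -> l2dot u (partial i phi) = - l2dot (g i) phi.

Definition inH1 (u : fct) : Prop := inL2 u /\ exists g, is_wgrad u g.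

(* A representative of the weak gradient, which is unique up to equality almost
   everywhere in Omega. *)
Definition wgrad (u : fct) : 'I_n.+1 -> fct := xget (fun=> 0) (is_wgrad u).

Definition graddot (u w : fct) : R := \sum_i l2dot (wgrad u i) (wgrad w i).

Definition gradnorm (u : fct) : R := Num.sqrt (graddot u u).

Definition h1norm (u : fct) : R :=
  Num.sqrt (l2norm u ^+ 2 + gradnorm u ^+ 2).

(* u|_S = g for S in the boundary: the trace operator H^1(Omega) -> L^2(S) is
   the extension by continuity of the restriction of smooth functions to S. *)
Definition has_trace (S : set X) (u g : fct) : Prop :=
  exists phi : nat -> fct,
  [/\ forall k, smooth (phi k),
      h1norm (phi k - u) @[k --> \oo] --> 0
    & (\int[@hausdorff R n n]_(x in S) ((phi k x - g x : R) ^+ 2)%:E)%E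
        @[k --> \oo] --> 0%E].

(* H^1_S(Omega) *)
Definition H1z (S : set X) : nspace R :=
  @NSpace R fct [set u | inH1 u /\ has_trace S u 0] h1norm.

Definition dlap (u : fct) (phi : X -> R) : R :=
  l2dot u (fun x => \sum_i partial i (partial i phi) x).

End sobolev.

Section delay.
Context (R : realType) (n : nat) (Omega Gamma0 : set 'rV[R]_n.+1).
Local Notation H1 := (H1z Omega Gamma0).

Definition Hspace : nspace R :=
  nprod (nprod (nprod H1 (L2 Omega)) (BochnerL2 H1)) (BochnerL2 H1).

(* opA V W: V \in D(A) and A V = W, for V and W in Hspace (so that the condition
   A V \in Hspace is part of the statement that W is in Hspace). *)
Definition opA (tau c1 c2 d1 d2 : R) (V W : Hspace) : Prop :=
  let: (v1, v2, v3, v4) := V in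
  let: (w1, w2, w3, w4) := W in
  [/\ nmem Hspace V, nmem Hspace W,
      nmem H1 v2 /\ nnorm H1 (w1 - v2) = 0,
      (exists g3 : R -> H1, is_sderiv v3 g3 /\
         nnorm (BochnerL2 H1) (w3 - (- tau^-1) *: g3) = 0) /\
      (exists g4 : R -> H1, is_sderiv v4 g4 /\
         nnorm (BochnerL2 H1) (w4 - (- tau^-1) *: g4) = 0)
    & [/\ has_strace v3 0 v1, has_strace v4 0 v2
        & exists z3 z4 : H1,
          [/\ has_strace v3 1 z3, has_strace v4 1 z4,
              forall phi, test_fun Omega phi ->
                l2dot Omega w2 phi =
                c1 * dlap Omega v1 phi + c2 * dlap Omega z3 phi
                + d1 * dlap Omega v2 phi + d2 * dlap Omega z4 phi
            & forall psi, nmem H1 psi ->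
                l2dot Omega w2 psi =
                - (c1 * graddot Omega v1 psi + c2 * graddot Omega z3 psi
                   + d1 * graddot Omega v2 psi + d2 * graddot Omega z4 psi)]]].

Definition energy (tau c1 d1 d2 : R) (V : Hspace) : R :=
  let: (y, dy, z, dz) := V in
  1 / 2 * l2norm Omega dy ^+ 2 + c1 / 2 * gradnorm Omega y ^+ 2
  + tau * d1 / 2
    * \int[lebesgue_measure]_(s in `]0, 1[) (gradnorm Omega (z s) ^+ 2)
  + tau * d2 / 2
    * \int[lebesgue_measure]_(s in `]0, 1[) (gradnorm Omega (dz s) ^+ 2).

End delay.

(* Main.v *)
From HB Require Import structures.
Require Import Defs.
From mathcomp Require Import all_boot all_order all_algebra.
From mathcomp Require Import all_classical all_reals all_analysis.
From mathcomp Require Import measurable_realfun ring lra.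

Set Implicit Arguments.
Unset Strict Implicit.
Unset Printing Implicit Defensive.

Import Order.TTheory GRing.Theory Num.Theory.
Import numFieldNormedType.Exports.

Local Open Scope classical_set_scope.
Local Open Scope ring_scope.

(* With D = c2 + d2 and suitable N, K3, K4, delta > 0, consider the functional
     L(V) = N (1/2 ||v2||^2 + c1/2 ||grad v1||^2) + (v1, v2)
            + tau int_0^1 (K3 + delta (1 - s)) ||grad v3(s)||^2 ds
            + tau int_0^1 (K4 + delta (1 - s)) ||grad v4(s)||^2 ds,
   which is comparable to the energy as soon as N > sqrt(cp / c1). On D(A) the
   weak form of the second equation is tested with v2 and with v1, the history
   equations are integrated against the weights, and every cross term is split
   by Young's inequality with the weights D / (2 d1) and d1 / (2 D). The traces
   at s = 1 are absorbed by K3 and K4, and the coefficients of ||grad v1||^2 and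
   ||grad v2||^2 are negative exactly when N lies strictly between the two sides
   of the third assumption; hence L decays exponentially along the orbits that
   start in D(A), and along all orbits because D(A) is dense and each T(t) is
   bounded. Nothing uses completeness of the state space: the only place where
   one expects it, left continuity of orbits, follows from the existence of one
   point of continuity of a right-continuous function. *)

(** * Smooth functions of one variable *)

Section smooth1.
Context (R : realType).
Implicit Types (f g : R -> R) (x : R).

(** Elements are representatives, and the norms vanish on some nonzero ones. Hilbert-space arguments
    are therefore run with positive semidefinite forms constrained only on the subspace of members
    ([semi_inner]), and equality becomes vanishing of a seminorm. The obstacle in the history terms
    is the chain rule for $a(v(s),v(s))$ when $v$ has only a weak derivative with values in such a
    space. Pairing with a fixed vector [h] gives the increments of the scalar function $a(v(s),h)$;
    the choice $h=v(x)+v(y)$ gives those of the square, up to local errors. The constants $K_3$ and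
    $K_4$ are the total coefficients that Young's inequality puts on the traces at $s=1$: the test
    with $v_2$ carries the weight $N$, the test with $v_1$ the weight $1$. Density of
    $D(\mathscr{A})$ needs no elliptic regularity: the norm does not see the end values of the
    histories at $s=1$, so these can be chosen to cancel the total stress. The generator yields
    derivatives from the right only; monotonicity is then a Dini argument, which also asks for
    control from the left. *)

Fixpoint Dk (k : nat) (f : R -> R) : Prop :=
  if k is k'.+1 then (forall x, derivable f x 1) /\ Dk k' (derive1 f) else True.

Definition smooth1 f := forall k, Dk k f.

Lemma is_derive_fun f g : (forall x, is_derive x 1 f (g x)) -> derive1 f = g.
Proof. by move=> h; apply/funext => x; rewrite derive1E; exact: derive_val. Qed.

Lemma derivable_is_derive1 f x : derivable f x 1 -> is_derive x 1 f (derive1 f x).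
Proof. by move=> h; rewrite derive1E; exact: derivableP. Qed.

Lemma DkS_intro k f g : (forall x, is_derive x 1 f (g x)) -> Dk k g -> Dk k.+1 f.
Proof.
move=> h hg; split; first by move=> x; have [] := h x.
by rewrite (is_derive_fun h).
Qed.

Lemma DkW k f : Dk k.+1 f -> Dk k f.
Proof. by elim: k f => //= k IH f [h1 h2]; split=> //; exact: IH. Qed.

Lemma Dk_cst k (c : R) : Dk k (fun=> c).
Proof.
elim: k c => // k IH c.
by apply: (@DkS_intro _ _ (fun=> 0)) => // x; exact: is_derive_cst.
Qed.

Lemma DkD k f g : Dk k f -> Dk k g -> Dk k (fun x => f x + g x).
Proof.
elim: k f g => // k IH f g [df hf] [dg hg].
apply: (@DkS_intro _ _ (fun x => derive1 f x + derive1 g x)); last exact: IH.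
by move=> x; apply: is_deriveD; apply: derivable_is_derive1.
Qed.

Lemma DkM k f g : Dk k f -> Dk k g -> Dk k (fun x => f x * g x).
Proof.
elim: k f g => // k IH f g Hf Hg.
have [df hf] := Hf; have [dg hg] := Hg.
apply: (@DkS_intro _ _ (fun x => f x * derive1 g x + g x * derive1 f x)).
  by move=> x; apply: is_deriveM; apply: derivable_is_derive1.
by apply: DkD; apply: IH => //; exact: DkW.
Qed.

Lemma DkV k f : (forall x, f x != 0) -> Dk k f -> Dk k (fun x => (f x)^-1).
Proof.
move=> f0; elim: k f f0 => // k IH f f0 Hf; have [df hf] := Hf.
apply: (@DkS_intro _ _ (fun x => -1 * ((f x)^-1 * (f x)^-1) * derive1 f x)).
  move=> x.
  have H := is_deriveV (f0 x) (derivable_is_derive1 (df x)).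
  apply: (is_derive_eq H).
  by rewrite /GRing.scale /= mulN1r expr2 invfM.
apply: DkM => //; apply: DkM; first exact: Dk_cst.
by apply: DkM; apply: IH => //; exact: DkW.
Qed.

Lemma is_derive_affine (a b : R) x : is_derive x 1 (fun x => a * x + b) a.
Proof.
have H1 : is_derive x 1 (fun x : R => a * x) a.
  have H := is_deriveZ a (is_derive_id x 1).
  by apply: (is_derive_eq H); rewrite /GRing.scale /= mulr1.
have H := is_deriveD H1 (is_derive_cst b x 1).
by apply: (is_derive_eq H); rewrite addr0.
Qed.

Lemma is_derive_comp_affine f (a b : R) x : derivable f (a * x + b) 1 ->
  is_derive x 1 (fun x => f (a * x + b)) (a * derive1 f (a * x + b)).
Proof.
move=> h; have H := @is_derive1_comp R f (fun x => a * x + b) x _ _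
  (derivable_is_derive1 h) (is_derive_affine a b x).
by apply: (is_derive_eq H); rewrite mulrC.
Qed.

Lemma Dk_comp_affine k f (a b : R) : Dk k f -> Dk k (fun x => f (a * x + b)).
Proof.
elim: k f => // k IH f [df hf].
apply: (@DkS_intro _ _ (fun x => a * derive1 f (a * x + b))).
  by move=> x; exact: is_derive_comp_affine.
by apply: DkM; [exact: Dk_cst|exact: IH].
Qed.

Lemma smooth1_derivable f x : smooth1 f -> derivable f x 1.
Proof. by move=> /(_ 1%N)[]. Qed.

Lemma smooth1_derive f : smooth1 f -> smooth1 (derive1 f).
Proof. by move=> h k; have [] := h k.+1. Qed.

Lemma smooth1_continuous f : smooth1 f -> continuous f.
Proof.
move=> h x; apply: differentiable_continuous.
by apply/derivable1_diffP; exact: smooth1_derivable.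
Qed.

Lemma smooth1_derive1n f : smooth1 f -> forall k s, derivable (derive1n k f) s 1.
Proof.
move=> h k; elim: k f h => [|k IH] f h s; first by rewrite derive1n0; exact: smooth1_derivable.
by rewrite derive1Sn; apply: IH; exact: smooth1_derive.
Qed.

(** Horner's scheme drives the induction: multiplying the polynomial by $y$ raises the exponent by
    one, so [n] stays quantified. The constant coefficient is controlled by
    $e^y=(e^{y/n})^n\ge(y/n)^n$. *)
Lemma poly_expR_bounded (q : {poly R}) (n : nat) :
  exists2 C : R, 0 <= C & forall y : R, 0 < y -> `|q.[y]| * y ^+ n * expR (- y) <= C.
Proof.
elim/poly_ind: q n => [|q c IH] n.
  by exists 0 => // y y0; rewrite horner0 normr0 !mul0r.
have [C C0 hC] := IH n.+1.
have hn : exists2 K : R, 0 <= K & forall y : R, 0 < y -> y ^+ n * expR (- y) <= K.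
  case: n {IH hC} => [|n].
    by exists 1 => // y y0; rewrite expr0 mul1r -expR0 ler_expR; lra.
  exists (n.+1%:R ^+ n.+1); first exact: exprn_ge0.
  move=> y y0; rewrite expRN ler_pdivrMr ?expR_gt0//.
  have -> : expR y = expR (y / n.+1%:R) ^+ n.+1.
    by rewrite -expRM_natl -mulr_natl mulrC divfK.
  rewrite -exprMn; apply: lerXn2r; rewrite ?nnegrE ?(ltW y0)//.
  have := expR_ge1Dx (y / n.+1%:R) => h.
  apply: (@le_trans _ _ (n.+1%:R * (y / n.+1%:R))).
    by rewrite mulrC divfK.
  by rewrite ler_wpM2l//; apply: le_trans h; rewrite lerDr.
have [K K0 hK] := hn.
exists (C + `|c| * K); first by rewrite addr_ge0// mulr_ge0.
move=> y y0; rewrite hornerMXaddC.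
have e0 := expR_gt0 (- y).
have yn : 0 <= y ^+ n by rewrite exprn_ge0// ltW.
apply: (@le_trans _ _ ((`|q.[y]| * y + `|c|) * y ^+ n * expR (- y))).
  apply: ler_wpM2r; first exact: ltW.
  apply: ler_wpM2r => //.
  by apply: (le_trans (ler_normD _ _)); rewrite normrM (gtr0_norm y0).
rewrite !mulrDl; apply: lerD.
  by have := hC _ y0; rewrite exprS !mulrA.
by rewrite -mulrA ler_wpM2l// hK.
Qed.

(** The family $p(1/x)e^{-1/x}$, extended by $0$ to $x\le 0$, is closed under differentiation, so
    that smoothness of all its members follows from one induction. The bump functions need only
    $p=1$. *)
Definition flat (p : {poly R}) x : R :=
  if 0 < x then p.[x^-1] * expR (- x^-1) else 0.

(* derivative of [flat p]: with y = 1/x, d/dx = - y^2 d/dy *)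
Definition flat_deriv (p : {poly R}) : {poly R} := 'X^2 * (p - p^`()).

Lemma is_derive_flat p x : is_derive x 1 (flat p) (flat (flat_deriv p) x).
Proof.
case: (ltgtP 0 x) => [x0|x0|<-].
- have nx : x != 0 by rewrite gt_eqF.
  have H : is_derive x 1 (fun x : R => p.[x^-1] * expR (- x^-1))
     (flat (flat_deriv p) x).
    have HV : is_derive x 1 (fun x : R => x^-1) (- x ^- 2).
      have := is_deriveV nx (is_derive_id x 1).
      by move/is_derive_eq; apply; rewrite /GRing.scale /= mulr1.
    have Hp : is_derive (x^-1) 1 (horner p) (p^`()).[x^-1].
      have := derivable_is_derive1 (@derivable_horner _ p x^-1).
      by rewrite derivE.
    have H1 := is_derive1_comp Hp HV.
    have HN := is_deriveN HV.
    have H2 := @is_derive1_comp R expR (fun x => - x^-1) x _ _ (is_derive_expR (- x^-1)) HN.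
    apply: (is_derive_eq (is_deriveM H1 H2)).
    rewrite /flat x0 /flat_deriv !hornerE /= /GRing.scale /=.
    by rewrite opprK exprVn; ring.
  apply: (near_eq_is_derive _ H).
  by near=> z; rewrite /flat ifT//; near: z; exact: lt_nbhsr.
- rewrite /flat [X in is_derive _ _ _ X]ifF; last by apply/negbTE; rewrite -leNgt ltW.
  apply: (near_eq_is_derive _ (is_derive_cst 0 x 1)).
  near=> z; rewrite ifF//; apply/negbTE; rewrite -leNgt ltW//; near: z.
  exact: lt_nbhsl.
(* At the origin the right difference quotient is $h$ times $h^{-2}p(1/h)e^{-1/h}$, hence at most
   $Ch$ in modulus; this is why the exponent is $2$. *)
have [C C0 hC] := poly_expR_bounded p 2.
have E0 q : flat q 0 = 0 by rewrite /flat ltxx.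
have L : h^-1 *: (flat p (h *: 1 + 0) - flat p 0) @[h --> (0:R)^'] --> (0:R).
  apply/cvgr0Pnorm_lt => e e0; near=> h.
  rewrite E0 subr0 addr0 /GRing.scale /= mulr1 /flat.
  case: ifPn => h0; last by rewrite mulr0 normr0.
  have hi : 0 < h^-1 by rewrite invr_gt0.
  rewrite !normrM (gtr0_norm hi) (gtr0_norm (expR_gt0 _)).
  have := hC _ hi => B.
  have : h^-1 * (`|p.[h^-1]| * expR (- h^-1)) <= h * C.
    have -> : h^-1 * (`|p.[h^-1]| * expR (- h^-1)) =
       h * (`|p.[h^-1]| * h^-1 ^+ 2 * expR (- h^-1)).
      by field; rewrite gt_eqF.
    by rewrite ler_wpM2l// ltW.
  move=> /le_lt_trans; apply.
  have hs : `|h| < e / (C + 1).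
    near: h; apply: dnbhs0_lt; rewrite divr_gt0//; lra.
  rewrite (gtr0_norm h0) in hs.
  move: hs; rewrite ltr_pdivlMr; last lra.
  by nra.
have D : derivable (flat p) 0 1 by apply/cvg_ex; exists 0.
apply: (is_derive_eq (derivableP D)).
by rewrite E0; apply: cvg_lim; [exact: norm_hausdorff|exact: L].
Unshelve. all: by end_near. Qed.

Lemma flat_smooth p : smooth1 (flat p).
Proof.
move=> k; elim: k p => // k IH p; apply: DkS_intro (IH (flat_deriv p)).
exact: is_derive_flat.
Qed.

Definition bump0 : R -> R := flat 1.

Lemma bump0_smooth : smooth1 bump0. Proof. exact: flat_smooth. Qed.

Lemma bump0_gt0 x : 0 < x -> 0 < bump0 x.
Proof. by move=> x0; rewrite /bump0 /flat x0 hornerE mul1r expR_gt0. Qed.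

Lemma bump0_eq0 x : x <= 0 -> bump0 x = 0.
Proof. by move=> x0; rewrite /bump0 /flat ifF// ltNge x0. Qed.

Lemma bump0_ge0 x : 0 <= bump0 x.
Proof. by have [/bump0_eq0->//|/bump0_gt0/ltW] := leP x 0. Qed.

Lemma bump0_le1 x : bump0 x <= 1.
Proof.
rewrite /bump0 /flat; case: ifPn => // x0.
by rewrite hornerE mul1r -expR0 ler_expR oppr_le0 invr_ge0 ltW.
Qed.

Definition bump (a b x : R) : R := bump0 (x - a) * bump0 (b - x).

Lemma bump_smooth a b : smooth1 (bump a b).
Proof.
move=> k; apply: DkM.
  have := @Dk_comp_affine k _ 1 (- a) (bump0_smooth k).
  by congr Dk; apply/funext => x; rewrite mul1r.
have := @Dk_comp_affine k _ (-1) b (bump0_smooth k).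
by congr Dk; apply/funext => x; rewrite mulN1r addrC.
Qed.

Lemma bump_ge0 a b x : 0 <= bump a b x.
Proof. by rewrite mulr_ge0// bump0_ge0. Qed.

Lemma bump_le1 a b x : bump a b x <= 1.
Proof. by rewrite mulr_ile1// ?bump0_ge0// bump0_le1. Qed.

Lemma bump_gt0 a b x : a < x < b -> 0 < bump a b x.
Proof. by move=> /andP[ax xb]; rewrite mulr_gt0// bump0_gt0// subr_gt0. Qed.

Lemma bump_neq0 a b x : (bump a b x != 0) = (a < x < b).
Proof.
apply/idP/idP; last by move/bump_gt0; rewrite lt0r => /andP[].
apply: contraR; rewrite negb_and -!leNgt => /orP[h|h].
  by rewrite /bump bump0_eq0 ?mul0r// subr_le0.
by rewrite /bump [X in _ * X]bump0_eq0 ?mulr0// subr_le0.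
Qed.

Definition step x : R := bump0 x / (bump0 x + bump0 (1 - x)).

Lemma step_den_gt0 x : 0 < bump0 x + bump0 (1 - x).
Proof.
have [x0|x0] := leP x 0.
  by rewrite ltr_wpDl ?bump0_ge0// bump0_gt0//; lra.
by rewrite ltr_pwDl ?bump0_gt0// bump0_ge0.
Qed.

Lemma step_smooth : smooth1 step.
Proof.
move=> k; apply: DkM; first exact: bump0_smooth.
apply: DkV; first by move=> x; rewrite gt_eqF// step_den_gt0.
apply: DkD; first exact: bump0_smooth.
have := @Dk_comp_affine k _ (-1) 1 (bump0_smooth k).
by congr Dk; apply/funext => x; rewrite mulN1r addrC.
Qed.

Lemma step_le0 x : x <= 0 -> step x = 0.
Proof. by move=> x0; rewrite /step bump0_eq0// mul0r. Qed.

Lemma step_ge1 x : 1 <= x -> step x = 1.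
Proof.
move=> x1; rewrite /step (@bump0_eq0 (1 - x)) ?subr_le0// addr0 divff//.
by rewrite gt_eqF// bump0_gt0// (lt_le_trans ltr01).
Qed.

Lemma step_ge0 x : 0 <= step x.
Proof. by rewrite divr_ge0// ?bump0_ge0// ltW// step_den_gt0. Qed.

Lemma step_le1 x : step x <= 1.
Proof. by rewrite ler_pdivrMr ?step_den_gt0// mul1r lerDl bump0_ge0. Qed.

Lemma derive_step_out x : x < 0 \/ 1 < x -> derive1 step x = 0.
Proof.
move=> h.
have {h} : is_derive x 1 step 0.
  case: h => h.
    apply: (near_eq_is_derive _ (is_derive_cst 0 x 1)); near=> z.
    by rewrite step_le0// ltW//; near: z; exact: lt_nbhsl.
  apply: (near_eq_is_derive _ (is_derive_cst (1 : R) x 1)); near=> z.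
  by rewrite step_ge1// ltW//; near: z; exact: lt_nbhsr.
by move=> h; rewrite derive1E; exact: derive_val.
Unshelve. all: by end_near. Qed.

End smooth1.

(** * Smooth functions on R^n *)

Section lines.
Context (R : realType) (V : normedModType R).

(** The base point is [x + t *: v] rather than [x], so that the derivative along the whole line is
    available, as the mean value theorem requires. *)
Lemma is_derive_line (f : V -> R) (x v : V) (t d : R) :
  is_derive (x + t *: v) v f d <-> is_derive t 1 (fun h : R => f (x + h *: v)) d.
Proof.
have E : (fun h : R => h^-1 *: (f (h *: v + (x + t *: v)) - f (x + t *: v))) =
  (fun h : R => h^-1 *: (f (x + (h *: (1 : R) + t) *: v) - f (x + t *: v))).
  by apply/funext => h; rewrite scaler1 scalerDl addrCA.
split=> -[h1 h2]; split; move: h1 h2; rewrite /derivable /derive /comp /shift/=.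
- by rewrite E.
- by rewrite E.
- by rewrite -E.
- by rewrite -E.
Qed.

End lines.

Section smooth.
Context (R : realType) (n : nat).
Local Notation X := 'rV[R]_n.+1.
Implicit Types (f g : X -> R) (x : X).
Local Notation e_ i := (delta_mx ord0 i : X).

Lemma Ck_intro k f (g : 'I_n.+1 -> X -> R) : continuous f ->
  (forall i x, is_derive x (e_ i) f (g i x)) -> (forall i, Ck k (g i)) ->
  Ck k.+1 f.
Proof.
move=> cf df cg; split=> // i; split; first by move=> x; have [] := df i x.
rewrite (_ : partial i f = g i)//; apply/funext => x.
by rewrite /partial; exact: derive_val.
Qed.

Lemma Ck_continuous k f : Ck k f -> continuous f.
Proof. by case: k => [|k] []. Qed.

Lemma CkW k f : Ck k.+1 f -> Ck k f.
Proof.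
elim: k f => [|k IH] f [h1 h2]; first by [].
by split=> // i; have [h3 h4] := h2 i; split=> //; exact: IH.
Qed.

Lemma Ck_is_derive k f i x : Ck k.+1 f -> is_derive x (e_ i) f (partial i f x).
Proof. by move=> [_ /(_ i)[h _]]; exact: derivableP. Qed.

Lemma Ck_partial k f i : Ck k.+1 f -> Ck k (partial i f).
Proof. by move=> [_ /(_ i)[]]. Qed.

Lemma Ck_cst k (c : R) : Ck k (fun _ : X => c).
Proof.
elim: k c => [|k IH] c; first by split=> //; exact: cst_continuous.
apply: (@Ck_intro _ _ (fun _ _ => 0)) => //; exact: cst_continuous.
Qed.

Lemma CkD k f g : Ck k f -> Ck k g -> Ck k (fun x => f x + g x).
Proof.
elim: k f g => [|k IH] f g Hf Hg.
  by split=> // x; apply: continuousD; apply: Ck_continuous; eassumption.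
apply: (@Ck_intro _ _ (fun i x => partial i f x + partial i g x)).
- by move=> x; apply: continuousD; apply: Ck_continuous; eassumption.
- by move=> i x; apply: is_deriveD; apply: Ck_is_derive; eassumption.
- by move=> i; apply: IH; apply: Ck_partial.
Qed.

Lemma CkM k f g : Ck k f -> Ck k g -> Ck k (fun x => f x * g x).
Proof.
elim: k f g => [|k IH] f g Hf Hg.
  by split=> // x; apply: continuousM; apply: Ck_continuous; eassumption.
apply: (@Ck_intro _ _ (fun i x => f x * partial i g x + g x * partial i f x)).
- by move=> x; apply: continuousM; apply: Ck_continuous; eassumption.
- by move=> i x; apply: is_deriveM; apply: Ck_is_derive; eassumption.
- by move=> i; apply: CkD; apply: IH; [exact: CkW|exact: Ck_partial|exact: CkW|exact: Ck_partial].
Qed.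

Lemma is_derive_coord (F : R -> R) i j x : derivable F (x ord0 j) 1 ->
  is_derive x (e_ i) (fun x : X => F (x ord0 j)) ((i == j)%:R * derive1 F (x ord0 j)).
Proof.
move=> dF; have E : x = x + 0 *: (e_ i) by rewrite scale0r addr0.
rewrite {1}E; apply/is_derive_line.
have := @is_derive_comp_affine R F (i == j)%:R (x ord0 j) 0.
rewrite mulr0 add0r => /(_ dF).
congr is_derive; apply/funext => h.
by rewrite !mxE eqxx /= eq_sym addrC mulrC.
Qed.

Lemma Ck_coord k (F : R -> R) j : smooth1 F -> Ck k (fun x : X => F (x ord0 j)).
Proof.
have ctn (G : R -> R) : smooth1 G -> continuous (fun x : X => G (x ord0 j)).
  move=> sG x; apply: (@continuous_comp _ _ _ (fun x : X => x ord0 j) G).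
    exact: coord_continuous.
  exact: smooth1_continuous.
elim: k F => [|k IH] F sF; first by split=> //; exact: ctn.
apply: (@Ck_intro _ _ (fun i x => (i == j)%:R * derive1 F (x ord0 j))).
- exact: ctn.
- by move=> i x; apply: is_derive_coord; exact: smooth1_derivable.
- by move=> i; apply: CkM; [exact: Ck_cst|apply: IH; exact: smooth1_derive].
Qed.

Lemma smooth_continuous f : smooth f -> continuous f.
Proof. by move=> /(_ 0%N)[]. Qed.

Lemma smooth_derivable f i x : smooth f -> is_derive x (e_ i) f (partial i f x).
Proof. by move=> h; exact: (Ck_is_derive _ _ (h 1%N)). Qed.

Lemma smooth_partial f i : smooth f -> smooth (partial i f).
Proof. by move=> h k; exact: Ck_partial (h k.+1). Qed.

Lemma smooth_cst (c : R) : smooth (fun _ : X => c).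
Proof. by move=> k; exact: Ck_cst. Qed.

Lemma smoothD f g : smooth f -> smooth g -> smooth (fun x => f x + g x).
Proof. by move=> hf hg k; exact: CkD. Qed.

Lemma smoothM f g : smooth f -> smooth g -> smooth (fun x => f x * g x).
Proof. by move=> hf hg k; exact: CkM. Qed.

Lemma smooth_prod (I : Type) (s : seq I) (F : I -> X -> R) :
  (forall i, smooth (F i)) -> smooth (fun x => \prod_(i <- s) F i x).
Proof.
move=> hF; elim: s => [|i s IH].
  have -> : (fun x : X => \prod_(i <- [::]) F i x) = (fun=> 1).
    by apply/funext => x; rewrite big_nil.
  exact: smooth_cst.
have -> : (fun x : X => \prod_(i <- i :: s) F i x) =
   (fun x => F i x * \prod_(i <- s) F i x).
  by apply/funext => x; rewrite big_cons.
exact: smoothM.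
Qed.

Lemma smooth_sum (I : Type) (s : seq I) (F : I -> X -> R) :
  (forall i, smooth (F i)) -> smooth (fun x => \sum_(i <- s) F i x).
Proof.
move=> hF; elim: s => [|i s IH].
  have -> : (fun x : X => \sum_(i <- [::]) F i x) = (fun=> 0).
    by apply/funext => x; rewrite big_nil.
  exact: smooth_cst.
have -> : (fun x : X => \sum_(i <- i :: s) F i x) =
   (fun x => F i x + \sum_(i <- s) F i x).
  by apply/funext => x; rewrite big_cons.
exact: smoothD.
Qed.

Lemma smooth_exp f k : smooth f -> smooth (fun x => f x ^+ k).
Proof.
move=> hf; elim: k => [|k IH].
  by under eq_fun do rewrite expr0; exact: smooth_cst.
by under eq_fun do rewrite exprS; exact: smoothM.
Qed.

Lemma partialM f g i x : smooth f -> smooth g ->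
  partial i (fun x => f x * g x) x = f x * partial i g x + g x * partial i f x.
Proof.
move=> hf hg; have := is_deriveM (smooth_derivable i x hf) (smooth_derivable i x hg).
by move=> h; exact: (derive_val (is_derive := h)).
Qed.

Definition cbox (q : X) (r : R) : set X := [set x | forall i, `|x ord0 i - q ord0 i| <= r].

Lemma cbox_compact q r : compact (cbox q r).
Proof.
have := @rV_compact R n.+1 (fun i => `[q ord0 i - r, q ord0 i + r]%classic)
  (fun i => @segment_compact _ _ _).
congr compact; apply/seteqP; split=> x /= h i.
  by have := h i; rewrite in_itv /= ler_norml => /andP[? ?]; apply/andP; split; lra.
by have := h i; rewrite in_itv /= ler_norml => /andP[? ?]; apply/andP; split; lra.
Qed.

Lemma test_funI (Omega K : set X) f : smooth f -> compact K -> K `<=` Omega ->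
  (forall x, ~ K x -> f x = 0) -> test_fun Omega f.
Proof.
move=> sf cK KO f0.
have cl : closed K by apply: compact_closed => //; exact: norm_hausdorff.
have sub : closure [set x | f x != 0] `<=` K.
  rewrite [X in _ `<=` X]((closure_id K).1 cl); apply: closure_subset => x /= fx.
  by apply: contrapT => /f0 E; rewrite E eqxx in fx.
split=> //; first by apply: (subclosed_compact _ cK sub); exact: closed_closure.
exact: subset_trans KO.
Qed.

Lemma test_fun0 (Omega : set X) f x : test_fun Omega f -> ~ Omega x -> f x = 0.
Proof.
move=> [_ _ h] nx; apply: contrapT => /eqP fx; apply: nx; apply: h.
exact: subset_closure.
Qed.

Definition box_bump (q : X) (r : R) x : R :=
  \prod_i bump (q ord0 i - r) (q ord0 i + r) (x ord0 i).

Lemma box_bump_smooth q r : smooth (box_bump q r).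
Proof. by apply: smooth_prod => i k; apply: Ck_coord; exact: bump_smooth. Qed.

Lemma box_bump01 q r x : 0 <= box_bump q r x <= 1.
Proof.
apply/andP; split; first by apply: prodr_ge0 => i _; exact: bump_ge0.
by apply: prodr_ile1 => i _; rewrite bump_ge0 bump_le1.
Qed.

Lemma box_bump_eq0 q r x : ~ cbox q r x -> box_bump q r x = 0.
Proof.
move=> h; apply/eqP; apply: contrapT => /negP/prodf_neq0 H; apply: h => i.
by have := H i isT; rewrite bump_neq0 ler_norml => /andP[h1 h2]; apply/andP; split; lra.
Qed.

Lemma box_bump_gt0 (q : X) (r : R) x : (forall i, `|x ord0 i - q ord0 i| < r) -> 0 < box_bump q r x.
Proof.
move=> h; apply: prodr_gt0 => i _; apply: bump_gt0.
by have := h i; rewrite ltr_norml => /andP[h1 h2]; apply/andP; split; lra.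
Qed.

(** A code [k] that denotes a cube with rational centre and radius $1/(m+1)$ inside [U] gives the
    bump on that cube; all other codes give $0$. Countably many smooth functions thus detect the
    points of an open set. *)
Definition open_bump (U : set X) (k : nat) : X -> R :=
  if (unpickle k : option ('rV[rat]_n.+1 * nat)) is Some (q, m) then
    if `[< cbox (map_mx ratr q) m.+1%:R^-1 `<=` U >]
    then box_bump (map_mx ratr q) m.+1%:R^-1 else fun=> 0
  else fun=> 0.

Lemma open_bumpP U k : open_bump U k = (fun=> 0) \/
  exists q r, cbox q r `<=` U /\ open_bump U k = box_bump q r.
Proof.
rewrite /open_bump; case: unpickle => [[q m]|]; last by left.
case: asboolP => h; last by left.
by right; exists (map_mx ratr q), m.+1%:R^-1.
Qed.

Lemma open_bump_smooth U k : smooth (open_bump U k).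
Proof.
have [->|[q [r [_ ->]]]] := open_bumpP U k; first exact: smooth_cst.
exact: box_bump_smooth.
Qed.

Lemma open_bump01 U k x : 0 <= open_bump U k x <= 1.
Proof.
have [->|[q [r [_ ->]]]] := open_bumpP U k; first by rewrite lexx ler01.
exact: box_bump01.
Qed.

Lemma open_bump_supp U k : exists2 K, compact K /\ K `<=` U &
  forall x, ~ K x -> open_bump U k x = 0.
Proof.
have [->|[q [r [qU ->]]]] := open_bumpP U k.
  by exists set0 => //; split=> //; exact: compact0.
exists (cbox q r); first by split=> //; exact: cbox_compact.
exact: box_bump_eq0.
Qed.

Lemma open_bump_gt0 U x : open U -> U x -> exists k, 0 < open_bump U k x.
Proof.
rewrite openE => oU Ux.
have /nbhs_ballP[e /= e0 he] := oU _ Ux.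
have [m hm] : exists m : nat, m.+1%:R^-1 < e / 2.
  have e2 : 0 < e / 2 by lra.
  have [N _ hN] := near_infty_natSinv_lt (PosNum e2).
  by exists N; exact: hN (leqnn N).
set r : R := m.+1%:R^-1 in hm.
have r0 : 0 < r by rewrite invr_gt0.
have hq i : exists q : rat, `|x ord0 i - ratr q| < r.
  have : x ord0 i - r < x ord0 i + r by lra.
  move=> /rat_in_itvoo[q]; rewrite in_itv /= => /andP[h1 h2].
  by exists q; rewrite ltr_norml; apply/andP; split; lra.
have [q hq'] := choice hq.
pose Q : 'rV[rat]_n.+1 := \row_i q i.
exists (pickle (Q, m)); rewrite /open_bump pickleK.
have hQ i : `|x ord0 i - (map_mx ratr Q : X) ord0 i| < r by rewrite !mxE; exact: hq'.
case: asboolP => [_|]; first exact: box_bump_gt0.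
case=> y hy; apply: he; split=> // i j; rewrite (ord1 i) /ball/=.
have h1 := hQ j; have h2 := hy j; rewrite distrC in h2.
rewrite -(subrK ((map_mx ratr Q : X) ord0 j) (x ord0 j)) -addrA.
apply: (le_lt_trans (ler_normD _ _)); rewrite -/r in h2; lra.
Qed.

(* tends to the indicator function of [U] when [U] is open *)
Definition open_approx (U : set X) (k : nat) x : R :=
  1 - (\prod_(j <- iota 0 k) (1 - open_bump U j x)) ^+ k.

Lemma open_approx_smooth U k : smooth (open_approx U k).
Proof.
have sB (f : X -> R) : smooth f -> smooth (fun x => 1 - f x).
  move=> sf; have -> : (fun x => 1 - f x) = (fun x => 1 + (-1) * f x).
    by apply/funext => x; rewrite mulN1r.
  by apply: smoothD; [exact: smooth_cst|apply: smoothM => //; exact: smooth_cst].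
apply: (sB (fun x => _ ^+ k)); apply: smooth_exp.
by apply: smooth_prod => j; apply: sB; exact: open_bump_smooth.
Qed.

Let prod01 U k x : 0 <= \prod_(j <- iota 0 k) (1 - open_bump U j x) <= 1.
Proof.
have h j : 0 <= 1 - open_bump U j x <= 1.
  by have := open_bump01 U j x; move=> /andP[? ?]; apply/andP; split; lra.
apply/andP; split; first by apply: prodr_ge0 => j _; have /andP[] := h j.
by apply: prodr_ile1 => j _; exact: h.
Qed.

Lemma open_approx01 U k x : 0 <= open_approx U k x <= 1.
Proof.
have /andP[h1 h2] := prod01 U k x; rewrite /open_approx.
by rewrite subr_ge0 exprn_ile1//= gerBl exprn_ge0.
Qed.

Lemma open_approx_test U k : test_fun U (open_approx U k).
Proof.
have [K hK] := choice (fun j => let: ex_intro2 K h1 h2 := open_bump_supp U j in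
  ex_intro (fun K => (compact K /\ K `<=` U) /\ forall x, ~ K x -> open_bump U j x = 0)
    K (conj h1 h2)).
apply: (@test_funI U (\big[setU/set0]_(j <- iota 0 k) K j)).
- exact: open_approx_smooth.
- by apply: bigsetU_compact => j _; have [[]] := hK j.
- by rewrite -bigcup_seq => x [j _ Kx]; have [[_ h] _] := hK j; exact: h.
move=> x; rewrite -bigcup_seq => nx; rewrite /open_approx big1_seq ?expr1n ?subrr// => j /=.
rewrite mem_iota add0n => /= jk; have [_ ->] := hK j; first by rewrite subr0.
by move=> Kx; apply: nx; exists j => //=; rewrite mem_iota add0n.
Qed.

(** At a point of [U] the product contains, for large $k$, a fixed factor $1-b<1$, so its $k$-th
    power is at most $(1-b)^k$; one factor below $1$ would not by itself send the product to $0$,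
    which explains the exponent. Outside [U] all bumps vanish. *)
Lemma open_approx_cvg U x : open U -> open_approx U k x @[k --> \oo] --> (\1_U x : R).
Proof.
move=> oU; rewrite indicE; have [/set_mem Ux|/negP nUx] := boolP (x \in U); last first.
  apply: cvg_near_cst; apply: nearW => k; apply: (test_fun0 (open_approx_test U k)).
  by move=> Ux; apply: nUx; exact: mem_set.
have [j hj] := open_bump_gt0 oU Ux.
set b := open_bump U j x in hj.
have b1 : b <= 1 by have /andP[] := open_bump01 U j x.
have L : 1 - (1 - b) ^+ k @[k --> \oo] --> (1 : R).
  rewrite -[X in _ --> X](subr0 1); apply: cvgB; first exact: cvg_cst.
  by apply: cvg_expr; rewrite ger0_norm; lra.
apply: (@squeeze_cvgr _ _ _ _ (fun k => 1 - (1 - b) ^+ k) (fun=> 1)).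
- near=> k; have /andP[_ ->] := open_approx01 U k x; rewrite andbT.
  rewrite lerB//; apply: lerXn2r; rewrite ?nnegrE.
  + by have /andP[] := prod01 U k x.
  + by rewrite subr_ge0.
  + have jk : j \in iota 0 k.
      by rewrite mem_iota add0n /=; near: k; exact: nbhs_infty_gt.
    rewrite (big_rem _ jk) /= -/b ler_piMr ?subr_ge0//.
    apply: prodr_ile1 => i _.
    by have := open_bump01 U i x; move=> /andP[? ?]; apply/andP; split; lra.
- exact: L.
- exact: cvg_cst.
Unshelve. all: by end_near. Qed.

End smooth.

(** * Lebesgue measure on R^n *)

Section gauge_ext_theory.
Local Open Scope ereal_scope.
Context (R : realType) (n : nat) (g : set 'rV[R]_n.+1 -> \bar R).
Hypotheses (g0 : g set0 = 0) (g_ge0 : forall A, 0 <= g A).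

Lemma gauge_ext_le_cover (A : set 'rV[R]_n.+1) (F : nat -> set 'rV[R]_n.+1) :
  A `<=` \bigcup_k F k -> gauge_ext g A <= \sum_(k <oo) g (F k).
Proof.
move=> AF; apply: ereal_inf_lbound; exists F => //; split=> // k.
by apply: sub_gen_smallest.
Qed.

Lemma gauge_ext_le (A : set 'rV[R]_n.+1) : gauge_ext g A <= g A.
Proof.
apply: le_trans (@gauge_ext_le_cover A (fun k => if k is 0%N then A else set0) _) _.
  by move=> x Ax; exists 0%N.
rewrite (nneseriesD1 (n := 0%N))//=.
rewrite eseries0 ?adde0// => k _ /=; case: k => //.
Qed.

Lemma gauge_ext_ge (A : set 'rV[R]_n.+1) (M : \bar R) :
  (forall F : nat -> set 'rV[R]_n.+1, A `<=` \bigcup_k F k -> M <= \sum_(k <oo) g (F k)) ->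
  M <= gauge_ext g A.
Proof.
by move=> h; apply: le_ereal_inf_tmp => _ [F [_ AF] <-]; exact: h.
Qed.

(** Cutting every member of a cover of [A] along [P] and [Q] yields covers of the two pieces.
    Carathéodory's condition is thereby reduced to an inequality for the gauge alone. *)
Lemma gauge_ext_split (A P Q : set 'rV[R]_n.+1) :
  (forall F, g (F `&` P) + g (F `&` Q) <= g F) ->
  gauge_ext g (A `&` P) + gauge_ext g (A `&` Q) <= gauge_ext g A.
Proof.
move=> h; apply: gauge_ext_ge => F AF.
apply: (@le_trans _ _ (\sum_(k <oo) (g (F k `&` P) + g (F k `&` Q)))); last first.
  by apply: lee_nneseries => [k _ _|k _]; [exact: adde_ge0|exact: h].
rewrite nneseriesD//; apply: leeD; apply: gauge_ext_le_cover;
  by move=> x [/AF[k _ Fx] ?]; exists k.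
Qed.

Lemma gauge_ext_mono (h : set 'rV[R]_n.+1 -> \bar R) (A : set 'rV[R]_n.+1) :
  (forall F, g F <= h F) -> gauge_ext g A <= gauge_ext h A.
Proof.
move=> gh; apply: le_ereal_inf_tmp => _ [F [_ AF] <-].
by apply: le_trans (gauge_ext_le_cover AF) _; exact: lee_nneseries.
Qed.

Lemma gauge_ext_preimage (f : 'rV[R]_n.+1 -> 'rV[R]_n.+1) (A : set 'rV[R]_n.+1) :
  (forall F, g (f @^-1` F) <= g F) -> gauge_ext g (f @^-1` A) <= gauge_ext g A.
Proof.
move=> h; apply: gauge_ext_ge => F AF.
apply: (@le_trans _ _ (\sum_(k <oo) g (f @^-1` F k))); last exact: lee_nneseries.
by apply: gauge_ext_le_cover => x /AF[k _ Fx]; exists k.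
Qed.

End gauge_ext_theory.

Definition half_space (R : realType) (n : nat) (i : 'I_n.+1) (c : R) : set 'rV[R]_n.+1 :=
  [set x | x ord0 i <= c].

(** * Borel sets are measurable as soon as half-spaces are *)

Section borel_caratheodory.
Context (R : realType) (n : nat) (mu : {outer_measure set 'rV[R]_n.+1 -> \bar R}).
Hypothesis half_space_cara : forall i c, mu.-caratheodory (half_space i c).
Local Notation X := 'rV[R]_n.+1.
Local Notation mX := (caratheodory_type mu).

Lemma coord_measurable i : measurable_fun [set: mX] (fun x : mX => (x : X) ord0 i : R).
Proof.
apply: (measurability (@RGenOInfty.G R) (RGenOInfty.measurableE R)).
move=> /= _ [_ [c ->] <-]; rewrite setTI.
rewrite (_ : _ @^-1` _ = ~` (half_space i c : set mX)).
  by apply: measurableC; exact: half_space_cara.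
apply/seteqP; split=> x; rewrite /half_space /= in_itv /= andbT.
  by rewrite ltNge => /negP.
by move/negP; rewrite -ltNge.
Qed.

(** The indicator of an open set is the pointwise limit of [open_approx], which is built by products
    and differences from continuous functions of a single coordinate; coordinates are measurable
    because half-spaces are. *)
Lemma open_cara_measurable (U : set X) : open U -> measurable (U : set mX).
Proof.
move=> oU; apply/measurable_indicP.
apply: (@measurable_fun_cvg _ _ _ _ (fun k => open_approx U k : mX -> R)).
  move=> k; apply: measurable_funB; first exact: measurable_cst.
  apply: measurable_funX; apply: measurable_prod => j _.
  apply: measurable_funB; first exact: measurable_cst.
  have [->|[q [r [_ ->]]]] := open_bumpP U j; first exact: measurable_cst.
  apply: measurable_prod => i _.
  apply: (measurableT_comp (f := bump (q ord0 i - r) (q ord0 i + r))).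
    by apply: continuous_measurable_fun; apply: smooth1_continuous; exact: bump_smooth.
  exact: coord_measurable.
by move=> x _; exact: open_approx_cvg.
Qed.

Lemma closed_cara_measurable (U : set X) : closed U -> measurable (U : set mX).
Proof.
move=> cU; rewrite -[U]setCK; apply: measurableC; apply: open_cara_measurable.
exact: closed_openC.
Qed.

Lemma continuous_cara_measurable (f : X -> R) (D : set mX) : measurable D -> continuous f ->
  measurable_fun D (f : mX -> R).
Proof.
move=> mD /continuousP cf.
apply: (measurability (@RGenOpens.G R) (RGenOpens.measurableE R)).
move=> /= _ [_ [a [b ->]] <-]; apply: measurableI => //.
by apply: open_cara_measurable; exact: cf.
Qed.

End borel_caratheodory.

(** * Lebesgue measure of bounded sets, translation invariance *)

Section leb_theory.
Context (R : realType) (n : nat).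
Local Notation X := 'rV[R]_n.+1.
Local Notation mX := (caratheodory_type (@lebesgue_outer R n)).
Local Notation mu := (@leb R n).

Lemma box_gauge_ge0 (A : set X) : (0 <= box_gauge A)%E.
Proof.
apply: le_ereal_inf_tmp => _ [a [b [ab _ ->]]]; rewrite lee_fin.
by apply: prodr_ge0 => i _; rewrite subr_ge0.
Qed.

Lemma box_gauge0 : box_gauge (set0 : set X) = 0%E.
Proof.
apply/eqP; rewrite eq_le box_gauge_ge0 andbT; apply: ereal_inf_lbound.
by exists 0, 0; split=> //; rewrite big_ord_recl subrr mul0r.
Qed.

Lemma box_gauge_split i c (F : set X) :
  (box_gauge (F `&` half_space i c) + box_gauge (F `&` ~` half_space i c) <= box_gauge F)%E.
Proof.
apply: le_ereal_inf_tmp => _ [a [b [ab Fab ->]]].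
(* The threshold is clamped to the side of the box, so that both pieces are boxes with ordered
   corners even when the hyperplane misses the box; their volumes then add up exactly. *)
pose c' := Num.max (a ord0 i) (Num.min (b ord0 i) c).
pose b' : X := \row_j (if j == i then c' else b ord0 j).
pose a' : X := \row_j (if j == i then c' else a ord0 j).
have ac : a ord0 i <= c' by rewrite le_max lexx.
have cb : c' <= b ord0 i by rewrite ge_max ab ge_min lexx.
have h1 : (box_gauge (F `&` half_space i c) <= (\prod_j (b' ord0 j - a ord0 j))%:E)%E.
  apply: ereal_inf_lbound; exists a, b'; split=> //.
    by move=> j; rewrite mxE; case: eqP => [->|_].
  move=> x [/Fab Fx xc] j; rewrite mxE; have /andP[h1 h2] := Fx j.
  rewrite h1 /=; case: eqP => [->|//].
  by rewrite le_max le_min xc; have /andP[_ ->] := Fx i; rewrite orbT.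
have h2 : (box_gauge (F `&` ~` half_space i c) <= (\prod_j (b ord0 j - a' ord0 j))%:E)%E.
  apply: ereal_inf_lbound; exists a', b; split=> //.
    by move=> j; rewrite mxE; case: eqP => [->|_].
  move=> x [/Fab Fx /negP]; rewrite -ltNge => xc j; rewrite mxE; have /andP[h1' h2] := Fx j.
  rewrite h2 andbT; case: eqP => [->|//].
  by rewrite gt_max gt_min xc orbT andbT; have /andP[->] := Fx i.
apply: (le_trans (leeD h1 h2)); rewrite -EFinD lee_fin.
rewrite (bigD1 i)//= [X in _ + X](bigD1 i)//= [leRHS](bigD1 i)//=.
rewrite !mxE eqxx.
have -> : \prod_(j < n.+1 | j != i) (b' ord0 j - a ord0 j) =
   \prod_(j < n.+1 | j != i) (b ord0 j - a ord0 j).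
  by apply: eq_bigr => j /negbTE ji; rewrite mxE ji.
have -> : \prod_(j < n.+1 | j != i) (b ord0 j - a' ord0 j) =
   \prod_(j < n.+1 | j != i) (b ord0 j - a ord0 j).
  by apply: eq_bigr => j /negbTE ji; rewrite mxE ji.
by rewrite -mulrDl addrC addrA subrK.
Qed.

Lemma half_space_leb i c : (@lebesgue_outer R n).-caratheodory (half_space i c).
Proof.
apply: le_caratheodory_measurable => A.
have := gauge_ext_split (@box_gauge_ge0) A (@box_gauge_split i c).
exact.
Qed.

Lemma leb_open (U : set X) : open U -> measurable (U : set mX).
Proof. by apply: open_cara_measurable; exact: half_space_leb. Qed.

Lemma leb_closed (U : set X) : closed U -> measurable (U : set mX).
Proof. by apply: closed_cara_measurable; exact: half_space_leb. Qed.

Lemma leb_continuous (f : X -> R) (D : set mX) : measurable D -> continuous f ->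
  measurable_fun D (f : mX -> R).
Proof. by apply: continuous_cara_measurable; exact: half_space_leb. Qed.

Lemma leb_cbox_lty (q : X) (r : R) : 0 < r -> (mu (cbox q r : set mX) < +oo)%E.
Proof.
move=> r0; apply: (@le_lt_trans _ _ (box_gauge (cbox q r))).
  exact: (gauge_ext_le box_gauge0 box_gauge_ge0).
(* Boxes are open on the left: the lower corner $q-2r$, not $q-r$, makes the box contain the closed
   cube. *)
apply: (@le_lt_trans _ _ (\prod_(i < n.+1) ((q + const_mx r) ord0 i -
   (q - const_mx (2 * r)) ord0 i))%:E); last exact: ltry.
apply: ereal_inf_lbound; exists (q - const_mx (2 * r)), (q + const_mx r); split=> //.
  by move=> i; rewrite !mxE; lra.
move=> x hx i; have := hx i; rewrite !mxE ler_norml => /andP[h1 h2].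
by apply/andP; split; lra.
Qed.

Lemma leb_bounded_lty (A : set X) : bounded_set A -> measurable (A : set mX) ->
  (mu (A : set mX) < +oo)%E.
Proof.
move=> [M [_ hM]] mA.
have M1 : M < `|M| + 1 by have := ler_norm M; lra.
have := hM _ M1 => h.
apply: le_lt_trans (@leb_cbox_lty 0 (`|M| + 1) _); last by rewrite ltr_wpDl.
apply: le_measure; rewrite ?inE//.
  by apply: leb_closed; apply: compact_closed; [exact: norm_hausdorff|exact: cbox_compact].
move=> x /h; rewrite /Num.norm/= mx_normrE => hx i; rewrite mxE subr0.
by apply: le_trans hx; rewrite (le_bigmax _ _ (ord0, i)).
Qed.

Lemma leb_shift_outer (v : X) (A : set X) :
  lebesgue_outer ((fun x => x + v) @^-1` A) = lebesgue_outer A.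
Proof.
(* One inequality for all shifts suffices, since the reverse one is the same inequality for the
   shift by $-v$. *)
have le (w : X) (B : set X) : (lebesgue_outer ((fun x : X => x + w)%R @^-1` B) <= lebesgue_outer B)%E.
  apply: (gauge_ext_preimage box_gauge_ge0) => F.
  apply: le_ereal_inf_tmp => _ [a [b [ab Fab ->]]].
  apply: ereal_inf_lbound; exists (a - w), (b - w); split.
  - by move=> i; rewrite !mxE lerD2r.
  - by move=> x /Fab hx i; have := hx i; rewrite !mxE ltrBlDr lerBrDr.
  - by congr EFin; apply: eq_bigr => i _; rewrite !mxE; ring.
apply/eqP; rewrite eq_le le /=.
have := le (- v) ((fun x => x + v) @^-1` A).
rewrite -comp_preimage (_ : _ \o _ = id)//.
by apply/funext => x /=; rewrite subrK.
Qed.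

Lemma leb_shift_measurable (v : X) (A : set mX) : measurable A ->
  measurable ((fun x : mX => (x : X) + v : mX) @^-1` A).
Proof.
move=> mA.
have {}mA : (@lebesgue_outer R n).-caratheodory A := mA.
suff : (@lebesgue_outer R n).-caratheodory ((fun x : mX => (x : X) + v : mX) @^-1` A) by [].
move=> B; rewrite /=.
have E (C : set X) : lebesgue_outer C = lebesgue_outer ((fun x => x - v) @^-1` C).
  by rewrite leb_shift_outer.
have S (C : set X) : (fun x => x - v) @^-1` ((fun x => x + v) @^-1` C) = C.
  by rewrite /preimage; apply/seteqP; split=> x /=; rewrite subrK.
rewrite (E B) (E (B `&` _)) (E (B `&` ~` _)) !preimage_setI -preimage_setC !S.
exact: mA.
Qed.

Lemma leb_integral_shift (v : X) (f : mX -> R) : measurable_fun setT f ->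
  mu.-integrable setT (EFin \o f) ->
  mu.-integrable setT (EFin \o (fun x : mX => f ((x : X) + v))) /\
  (\int[mu]_x (f ((x : X) + v)%R)%:E = \int[mu]_x (f x)%:E)%E.
Proof.
move=> mf intf.
have mphi (w : X) : measurable_fun setT ((fun x : mX => (x : X) + w : mX)).
  by move=> _ A mA; rewrite setTI; exact: leb_shift_measurable.
have int_shift (h : mX -> R) (w : X) : mu.-integrable setT (EFin \o h) ->
   mu.-integrable setT (EFin \o (fun x : mX => h ((x : X) + w))).
  move=> /integrableP[mh ih]; apply/integrableP; split.
    by apply: (measurableT_comp mh); exact: mphi.
  have mh' : measurable_fun setT (fun x => `|(h x)%:E|)%E by apply: measurableT_comp.
  have := @ge0_integral_pushforward _ _ _ _ R _ (mphi w) mu setT _ measurableT mh'.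
  rewrite preimage_setT => <-; last by move=> y _; exact: abse_ge0.
  rewrite (eq_measure_integral mu)// => A mA _.
  exact: leb_shift_outer.
split; first exact: int_shift.
have := @integral_pushforward _ _ _ _ R _ (mphi v) mu setT (EFin \o f).
rewrite preimage_setT => <-; last 3 first.
- exact/measurable_EFinP.
- exact: (int_shift f v).
- exact: measurableT.
apply: eq_measure_integral => A mA _; exact: leb_shift_outer.
Qed.

End leb_theory.

(** * Hausdorff measure of Borel sets *)

Section hausdorff_half_space.
Local Open Scope ereal_scope.
Context (R : realType) (n s : nat).
Local Notation X := 'rV[R]_n.+1.
Local Notation nu := (@hausdorff_outer R n s).

Lemma hausdorff_gauge_ge0 (delta : R) (A : set X) : 0 <= hausdorff_gauge s delta A.
Proof.
rewrite /hausdorff_gauge; case: ifP => // _.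
apply: le_ereal_inf_tmp => _ [r [/andP[r0 _] _] <-].
by rewrite lee_fin exprn_ge0.
Qed.

Lemma hausdorff_gauge0 (delta : R) : hausdorff_gauge s delta (set0 : set X) = 0.
Proof. by rewrite /hausdorff_gauge; case: ifPn => // /asboolP. Qed.

Lemma le_hausdorff_gauge (delta : R) (A B : set X) : A `<=` B ->
  hausdorff_gauge s delta A <= hausdorff_gauge s delta B.
Proof.
move=> AB; rewrite {1}/hausdorff_gauge; case: asboolP => [_|A0].
  exact: hausdorff_gauge_ge0.
rewrite /hausdorff_gauge; case: asboolP => [B0|_].
  by exfalso; apply: A0; apply/seteqP; split => // x /AB; rewrite B0.
apply: ereal_inf_le_tmp => _ [r [rd hr] <-]; exists r => //; split=> //.
by move=> x y /AB Bx /AB By; exact: hr.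
Qed.

Lemma hausdorff_gauge_delta (d1 d2 : R) (A : set X) : (d1 <= d2)%R ->
  hausdorff_gauge s d2 A <= hausdorff_gauge s d1 A.
Proof.
move=> d12; rewrite /hausdorff_gauge; case: asboolP => [//|_].
apply: ereal_inf_le_tmp => _ [r [/andP[r0 rd] hr] <-]; exists r => //; split=> //.
by rewrite r0 (le_trans rd).
Qed.

Lemma coord_le_enorm (x : X) i : (`|x ord0 i| <= enorm x)%R.
Proof.
rewrite /enorm -sqrtr_sqr ler_wsqrtr// (bigD1 i)//= lerDl.
by apply: sumr_ge0 => j _; exact: sqr_ge0.
Qed.

(** A set that meets both half-spaces has diameter larger than [delta], so its gauge is an infimum
    over the empty set; otherwise one of the two terms vanishes. *)
Lemma hausdorff_gauge_sep (delta a b : R) i (F : set X) : (delta < b - a)%R ->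
  hausdorff_gauge s delta (F `&` [set x | x ord0 i <= a]%R) +
  hausdorff_gauge s delta (F `&` [set x | b <= x ord0 i]%R) <= hausdorff_gauge s delta F.
Proof.
move=> dab.
have [->|/set0P[x [Fx /= xa]]] := eqVneq (F `&` [set x | x ord0 i <= a]%R) set0.
  by rewrite hausdorff_gauge0 add0e; apply: le_hausdorff_gauge => x [].
have [->|/set0P[y [Fy /= yb]]] := eqVneq (F `&` [set x | b <= x ord0 i]%R) set0.
  by rewrite hausdorff_gauge0 adde0; apply: le_hausdorff_gauge => z [].
rewrite [leRHS](_ : _ = +oo) ?leey// /hausdorff_gauge.
case: asboolP => [F0|_]; first by rewrite F0 in Fx.
rewrite (_ : [set _ | r in _] = set0) ?ereal_inf0//.
apply/seteqP; split=> [z [r [/andP[r0 rd] hr] _]|//].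
have := le_trans (coord_le_enorm (y - x) i) (hr _ _ Fy Fx).
rewrite !mxE => h; have := le_trans (ler_norm _) h; lra.
Qed.

(** The metric property of Hausdorff measure, for sets separated in one coordinate: covers finer
    than the gap split. The suprema over [delta] for [A] and for [B] are taken one after the other,
    hence two independent scales [d1] and [d2], refined to a common one below the gap. *)
Lemma hausdorff_sep (a b : R) i (A B : set X) : (a < b)%R ->
  (forall x, A x -> x ord0 i <= a)%R -> (forall x, B x -> b <= x ord0 i)%R ->
  nu A + nu B <= nu (A `|` B).
Proof.
move=> ab hA hB; set M := nu (A `|` B).
have nge0 C : 0 <= nu C := outer_measure_ge0 nu C.
have leA : nu A <= M by apply: (le_outer_measure nu) => x; left.
have leB : nu B <= M by apply: (le_outer_measure nu) => x; right.
have [->|Moo] := eqVneq M +oo; first by rewrite leey.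
have finM C : nu C <= M -> nu C \is a fin_num.
  move=> h; rewrite ge0_fin_numE//; apply: (le_lt_trans h).
  by rewrite ltey.
have key (d1 d2 : R) : (0 < d1)%R -> (0 < d2)%R ->
    gauge_ext (hausdorff_gauge s d1) A + gauge_ext (hausdorff_gauge s d2) B <= M.
  move=> d10 d20; pose d : R := Num.min d1 (Num.min d2 ((b - a) / 2))%R.
  have d0 : (0 < d)%R by rewrite !lt_min d10 d20 /=; lra.
  have dle1 : (d <= d1)%R by rewrite ge_min lexx.
  have dle2 : (d <= d2)%R by rewrite !ge_min lexx orbT.
  have dab : (d < b - a)%R.
    have : (d <= (b - a) / 2)%R by rewrite !ge_min lexx !orbT.
    lra.
  apply: (@le_trans _ _ (gauge_ext (hausdorff_gauge s d) (A `|` B))); last first.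
    by apply: ereal_sup_ubound; exists d.
  have := gauge_ext_split (@hausdorff_gauge_ge0 d) (A `|` B)
    (fun F => @hausdorff_gauge_sep d a b i F dab).
  apply: le_trans; apply: leeD.
    apply: (@le_trans _ _ (gauge_ext (hausdorff_gauge s d) A)).
      apply: gauge_ext_mono => // F; [exact: hausdorff_gauge_ge0|exact: hausdorff_gauge_delta].
    apply: le_gauge_ext => x Ax; split; [by left|exact: hA].
  apply: (@le_trans _ _ (gauge_ext (hausdorff_gauge s d) B)).
    apply: gauge_ext_mono => // F; [exact: hausdorff_gauge_ge0|exact: hausdorff_gauge_delta].
  apply: le_gauge_ext => x Bx; split; [by right|exact: hB].
rewrite -leeBrDr ?finM//; apply: ge_ereal_sup => _ [d1 d10 <-].
have finA : gauge_ext (hausdorff_gauge s d1) A \is a fin_num.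
  rewrite ge0_fin_numE; last exact/gauge_ext_ge0/hausdorff_gauge_ge0.
  apply: (@le_lt_trans _ _ (nu A)); first by apply: ereal_sup_ubound; exists d1.
  by have := finM _ leA; rewrite ge0_fin_numE.
rewrite leeBrDr ?finM// addeC -leeBrDr//; apply: ge_ereal_sup => _ [d2 d20 <-].
by rewrite leeBrDr// addeC; exact: key.
Qed.

(** Carathéodory's criterion for metric outer measures. The part of [A] beyond the hyperplane is
    exhausted by the sets [Ak k], which lie at distance $1/(k+1)$ from it. The missing layer is
    covered by rings whose measures form a convergent series, so that it is bounded by a tail
    tending to $0$. *)
Lemma half_space_hausdorff i c : nu.-caratheodory (half_space i c).
Proof.
have nge0 C : 0 <= nu C := outer_measure_ge0 nu C.
apply: le_caratheodory_measurable => A.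
suff : nu (A `&` half_space i c) + nu (A `&` ~` half_space i c) <= nu A by [].
have [->|Aoo] := eqVneq (nu A) +oo; first by rewrite leey.
have e_lt j k : (j < k)%N -> (k.+1%:R^-1 < j.+1%:R^-1 :> R)%R.
  by move=> jk; rewrite ltf_pV2 ?posrE ?ltr0n// ltr_nat.
pose e (k : nat) : R := k.+1%:R^-1%R.
pose Ak k : set X := A `&` [set x | c + e k <= x ord0 i]%R.
pose Rg j : set X := A `&` [set x | c + e j.+1 <= x ord0 i < c + e j]%R.
(* rings of the same parity are pairwise separated *)
have parity (p N : nat) : \sum_(0 <= j < N) nu (Rg (j.*2 + p)%N) <= nu A.
  case: N => [|N]; first by rewrite big_nil.
  apply: (@le_trans _ _ (nu (Ak (N.*2 + p).+1))); last first.
    by apply: (le_outer_measure nu) => x [].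
  elim: N => [|N IH].
    by rewrite big_nat1; apply: (le_outer_measure nu) => x [Ax /= /andP[]].
  rewrite big_nat_recr//= addeC.
  apply: (le_trans (leeD (lexx _) IH)).
  apply: (@le_trans _ _ (nu (Rg (N.+1.*2 + p)%N `|` Ak (N.*2 + p).+1))).
    apply: (@hausdorff_sep (c + e (N.+1.*2 + p)%N)%R (c + e (N.*2 + p).+1)%R i).
    - by rewrite ltrD2l; apply: e_lt; rewrite doubleS !addSn.
    - by move=> x [_ /= /andP[_ /ltW]].
    - by move=> x [].
  apply: (le_outer_measure nu) => x [[Ax /= /andP[h1 h2]]|[Ax /= h1]]; split=> //=.
  apply: le_trans h1; rewrite lerD2l ltW//; apply: e_lt.
  by rewrite doubleS !addSn.
have partial_sum N : \sum_(0 <= j < N) nu (Rg j) <= nu A + nu A.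
  apply: (@le_trans _ _ (\sum_(0 <= j < N.*2) nu (Rg j))).
    rewrite [leRHS](@big_cat_nat _ _ _ N)//=; last by rewrite -addnn leq_addr.
    by rewrite leeDl// sume_ge0.
  rewrite (_ : \sum_(0 <= j < N.*2) nu (Rg j) =
    \sum_(0 <= j < N) nu (Rg (j.*2 + 0)%N) + \sum_(0 <= j < N) nu (Rg (j.*2 + 1)%N)).
    by apply: leeD; exact: parity.
  rewrite -big_split/=; elim: N => [|N IH]; first by rewrite !big_nil.
  by rewrite doubleS big_nat_recr//= big_nat_recr//= IH [in RHS]big_nat_recr//= addn0 addn1 addeA.
have fin_sum : \sum_(0 <= j <oo) nu (Rg j) < +oo.
  apply: (@le_lt_trans _ _ (nu A + nu A)).
    apply: lime_le; first by apply: is_cvg_nneseries.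
    by apply: nearW => N; exact: partial_sum.
  by rewrite lte_add_pinfty// ltey.
have tail0 := nneseries_tail_cvg fin_sum (fun k _ => nge0 (Rg k)).
have key k : nu (A `&` half_space i c) + nu (A `&` ~` half_space i c) <=
    nu A + \sum_(k <= j <oo) nu (Rg j).
  have h1 : nu (A `&` half_space i c) + nu (Ak k) <= nu A.
    apply: (@le_trans _ _ (nu ((A `&` half_space i c) `|` Ak k))).
      apply: (@hausdorff_sep c (c + e k)%R i) => [|x []//|x []//].
      by rewrite ltrDl invr_gt0 ltr0n.
    by apply: (le_outer_measure nu) => x [[]|[]].
  apply: le_trans (leeD h1 (lexx _)); rewrite -addeA leeD2l//.
  pose F j := if (j < k)%N then set0 else Rg j.
  apply: (@le_trans _ _ (nu (Ak k `|` \bigcup_j F j))).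
    apply: (le_outer_measure nu) => x [Ax /negP]; rewrite -ltNge => cx.
    have [hk|hk] := leP (c + e k)%R (x ord0 i); first by left.
    right; have x0 : (0 < x ord0 i - c)%R by rewrite subr_gt0.
    have [m0 _ hm0] := near_infty_natSinv_lt (PosNum x0).
    have ex : exists m, (c + e m <= x ord0 i)%R.
      by exists m0; have := hm0 m0 (leqnn _); rewrite /= -/(e m0); lra.
    (* The least [m] with $c+1/(m+1)\le x_i$ exceeds [k], and by minimality the point lies in the
       ring of index $m-1$. *)
    case: (ex_minnP ex) => m hm hmin.
    have km : (k < m)%N.
      rewrite ltnNge; apply/negP => mk; move: hk; rewrite ltNge => /negP; apply.
      apply: le_trans hm; rewrite lerD2l; move: mk; rewrite leq_eqVlt => /orP[/eqP->//|].
      by move=> /e_lt/ltW.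
    case: m hm hmin km => // m hm hmin km.
    exists m => //; rewrite /F ltnNge -ltnS km /=; split=> //=.
    rewrite hm /= ltNge; apply/negP => /hmin; by rewrite ltnn.
  apply: (le_trans (outer_measureU2 nu _ _)); rewrite leeD2l//.
  apply: (le_trans (outer_measure_sigma_subadditive nu F)).
  rewrite (@nneseries_split _ (nu \o F) 0 k)//= add0n big1_seq ?add0e; last first.
    by move=> j /=; rewrite mem_index_iota /F => /andP[_ ->]; rewrite outer_measure0.
  apply: lee_nneseries => // j _ /=.
  by rewrite /F; case: ifP => // _; rewrite outer_measure0.
have L : nu A + \sum_(k <= j <oo) nu (Rg j) @[k --> \oo] --> nu A + 0.
  apply: cvgeD => //; last exact: cvg_cst.
  by rewrite ge0_adde_def ?inE.
rewrite -[leRHS]adde0 -(cvg_lim _ L)//; apply: lime_ge; first exact: (cvgP _ L).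
by apply: nearW.
Qed.

Lemma hausdorff_continuous (f : X -> R) (D : set (caratheodory_type nu)) :
  measurable D -> continuous f ->
  measurable_fun D (f : caratheodory_type nu -> R).
Proof. by apply: continuous_cara_measurable; exact: half_space_hausdorff. Qed.

End hausdorff_half_space.

(** * Integrals of compactly supported derivatives *)

Section integral_partial.
Context (R : realType) (n : nat).
Local Notation X := 'rV[R]_n.+1.
Local Notation mX := (caratheodory_type (@lebesgue_outer R n)).
Local Notation mu := (@leb R n).

Lemma compact_sub_cbox (K : set X) : compact K -> exists2 r : R, 0 < r & K `<=` cbox 0 r.
Proof.
move=> /compact_bounded[M [_ hM]]; exists (`|M| + 1); first by rewrite ltr_wpDl.
have M1 : M < `|M| + 1 by have := ler_norm M; lra.
move=> x /(hM _ M1); rewrite /Num.norm/= mx_normrE => hx i; rewrite mxE subr0.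
by apply: le_trans hx; rewrite (le_bigmax _ _ (ord0, i)).
Qed.

Lemma continuous_cbox_bounded (f : X -> R) (r : R) : continuous f ->
  exists2 M : R, 0 <= M & forall x, cbox 0 r x -> `|f x| <= M.
Proof.
move=> cf.
have : compact (f @` cbox 0 r).
  apply: continuous_compact; last exact: cbox_compact.
  exact: continuous_subspaceT.
move=> /compact_bounded[M [_ hM]]; exists (`|M| + 1); first by rewrite addr_ge0.
have M1 : M < `|M| + 1 by have := ler_norm M; lra.
by move=> x hx; apply: (hM _ M1); exists x.
Qed.

Lemma cbox_measurable (q : X) (r : R) : measurable (cbox q r : set mX).
Proof.
by apply: leb_closed; apply: compact_closed; [exact: norm_hausdorff|exact: cbox_compact].
Qed.

Lemma integrable_cbox_cst (r M : R) : 0 < r ->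
  mu.-integrable setT (EFin \o (fun x : mX => M * \1_(cbox 0 r : set mX) x)).
Proof.
move=> r0.
have : mu.-integrable setT (EFin \o (\1_(cbox 0 r : set mX) : mX -> R)).
  apply/integrableP; split.
    by apply/measurable_EFinP; apply: measurable_indic; exact: cbox_measurable.
  rewrite (eq_integral (fun x => (\1_(cbox 0 r : set mX) x)%:E)); last first.
    by move=> x _ /=; rewrite ger0_norm.
  rewrite integral_indic// ?setIT; last exact: cbox_measurable.
  exact: leb_cbox_lty.
by move=> /(integrableZl measurableT M).
Qed.

Lemma integrable_compact_supp (f : X -> R) (K : set X) : continuous f -> compact K ->
  (forall x, ~ K x -> f x = 0) -> mu.-integrable setT (EFin \o (f : mX -> R)).
Proof.
move=> cf cK f0; have [r r0 Kr] := compact_sub_cbox cK.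
have [M M0 hM] := continuous_cbox_bounded r cf.
apply: (le_integrable measurableT _ _ (integrable_cbox_cst M r0)).
  by apply/measurable_EFinP; exact: leb_continuous.
move=> x _ /=; rewrite lee_fin indicE.
have [/set_mem xB|/negP nB] := boolP (_ \in _).
  by rewrite mulr1 (ger0_norm M0); exact: hM.
rewrite f0 ?normr0//; move=> /Kr xB; apply: nB; exact: mem_set.
Qed.

Lemma cvg_harmonic_dnbhs : (fun k : nat => k.+1%:R^-1 : R) @ \oo --> (0 : R)^'.
Proof.
move=> A [e /= e0 hA]; have [N _ hN] := near_infty_natSinv_lt (PosNum e0).
exists N => // k Nk; apply: hA => /=.
  by rewrite sub0r normrN gtr0_norm ?invr_gt0//; exact: hN.
by rewrite gt_eqF ?invr_gt0.
Qed.

(** By translation invariance every difference quotient of [F] has integral $0$. The mean value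
    theorem bounds these quotients by a constant on a cube enlarged by the largest step, $1$, and
    dominated convergence passes to the derivative. *)
Lemma integral_partial0 (F : X -> R) (K : set X) i : smooth F -> compact K ->
  (forall x, ~ K x -> F x = 0) -> (\int[mu]_x (partial i F x)%:E = 0)%E.
Proof.
move=> sF cK F0; have [r r0 Kr] := compact_sub_cbox cK.
have clK : closed K by apply: compact_closed => //; exact: norm_hausdorff.
have cdF := smooth_continuous (smooth_partial i sF).
have cF := smooth_continuous sF.
have dF0 x : ~ K x -> partial i F x = 0.
  move=> nK; have H : is_derive x (delta_mx ord0 i : X) F 0.
    apply: (near_eq_is_derive _ (is_derive_cst (0 : R) x _)).
    have : nbhs x (~` K) by apply: open_nbhs_nbhs; split=> //; exact: closed_openC.
    by apply: filterS => y /F0.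
  by rewrite /partial; exact: derive_val.
have [M M0 hM] := continuous_cbox_bounded (r + 1) cdF.
have hM' x : `|partial i F x| <= M.
  have [xB|nB] := pselect (cbox 0 (r + 1) x); first exact: hM.
  by rewrite dF0 ?normr0// => /Kr h; apply: nB => j; apply: le_trans (h j) _; lra.
pose e : X := delta_mx ord0 i.
pose h (k : nat) : R := k.+1%:R^-1.
have h_gt0 k : 0 < h k by rewrite invr_gt0.
have h_le1 k : h k <= 1 by rewrite invf_le1 ?ler1n ?ltr0n.
pose f (k : nat) (x : mX) : R := (h k)^-1 * (F ((x : X) + h k *: e) - F x).
have iF : mu.-integrable setT (EFin \o (F : mX -> R)) by exact: integrable_compact_supp cK F0.
have mF : measurable_fun setT (F : mX -> R) by exact: leb_continuous.
have shiftF k := leb_integral_shift (h k *: e) mF iF.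
have mf k : measurable_fun setT (f k).
  apply: measurable_funM; first exact: measurable_cst.
  apply: measurable_funB; last exact: mF.
  by have [/integrableP[/measurable_EFinP]] := shiftF k.
have intf0 k : (\int[mu]_x (f k x)%:E = 0)%E.
  have [i1 e1] := shiftF k.
  under eq_integral do rewrite /f EFinM.
  rewrite integralZl//; last exact: (integrableB measurableT i1 iF).
  under eq_integral do rewrite EFinB.
  rewrite integralB//= e1 subee ?mule0//.
  exact: (integrable_fin_num measurableT iF).
have lip k x : `|F (x + h k *: e) - F x| <= h k * M.
  pose g (t : R) := F (x + t *: e).
  have dg (t : R) : is_derive t 1 g (partial i F (x + t *: e)).
    exact: (is_derive_line F x e t (partial i F (x + t *: e))).1 (smooth_derivable i _ sF).
  have cg : {within `[0, h k], continuous g}.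
    apply: continuous_subspaceT => t; apply: differentiable_continuous.
    by apply/derivable1_diffP; have [] := dg t.
  have [t _] := MVT_segment (ltW (h_gt0 k)) (fun t _ => dg t) cg.
  rewrite /g scale0r addr0 subr0 => ->.
  by rewrite normrM (gtr0_norm (h_gt0 k)) mulrC ler_wpM2l// ltW.
have dom k x : `|f k x| <= M * \1_(cbox 0 (r + 1) : set mX) x.
  rewrite indicE; have [/set_mem xB|/negP nB] := boolP (_ \in _).
    rewrite mulr1 /f normrM gtr0_norm ?invr_gt0// ler_pdivrMl//; exact: lip.
  have nK y : cbox 0 r y -> (forall j, `|(x : X) ord0 j - y ord0 j| <= 1) -> False.
    move=> hy hxy; apply: nB; apply: mem_set => j; have := hy j; have := hxy j.
    rewrite !mxE !subr0 => h1 h2; rewrite -(subrK (y ord0 j) ((x : X) ord0 j)).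
    by apply: (le_trans (ler_normD _ _)); rewrite addrC lerD.
  rewrite /f F0; last first.
    move=> /Kr hy; apply: (nK _ hy) => j; rewrite !mxE opprD addNKr normrN.
    rewrite eqxx /=; case: (j == i) => /=; rewrite ?mulr1 ?mulr0 ?normr0 ?ler01//.
    by rewrite gtr0_norm.
  rewrite F0; last by move=> /Kr hy; apply: (nK _ hy) => j; rewrite subrr normr0.
  by rewrite subrr mulr0 normr0 mulr0.
have r1 : 0 < r + 1 by lra.
have := @dominated_convergence _ _ _ mu setT measurableT (fun k => EFin \o f k)
  (EFin \o (partial i F : mX -> R)) _ _ _ _ (integrable_cbox_cst M r1) _.
case.
- by move=> k; apply/measurable_EFinP.
- by apply/measurable_EFinP; exact: leb_continuous.
- apply: aeW => x _; apply: cvg_EFin; first exact: nearW.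
  rewrite /comp /=.
  have [D1 D2] := smooth_derivable i x sF.
  have D : y^-1 *: ((F \o shift x) (y *: e) - F x) @[y --> (0 : R)^'] --> partial i F x.
    by rewrite -D2.
  have := cvg_comp _ _ cvg_harmonic_dnbhs D.
  apply: cvg_trans; apply: near_eq_cvg; apply: nearW => k /=.
  by rewrite /f /GRing.scale /= (addrC x).
- by apply: aeW => x k _; rewrite lee_fin; exact: dom.
move=> _ _ L.
have {}L : (fun=> 0%E) @ \oo --> (\int[mu]_x (partial i F x)%:E)%E.
  apply: cvg_trans L; apply: near_eq_cvg; apply: nearW => k /=.
  by rewrite intf0.
by rewrite -(cvg_lim _ L)// lim_cst.
Qed.

End integral_partial.

(** * Semi-inner products and square-integrable functions *)

Section forms.
Context (R : realType) (V : lmodType R).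

(** All conditions are restricted to the subspace [S]: [V] is typically a space of arbitrary
    functions, and outside [S] the integrals behind [b] have no meaning. The form is only
    semidefinite because it vanishes on representatives of zero. *)
Record semi_inner (S : set V) (b : V -> V -> R) : Prop := SemiInner {
  si_lin : forall a u v, S u -> S v -> S (a *: u + v) ;
  si_mem0 : S 0 ;
  si_sym : forall u v, S u -> S v -> b u v = b v u ;
  si_linl : forall a u v w, S u -> S v -> S w -> b (a *: u + v) w = a * b u w + b v w ;
  si_ge0 : forall u, S u -> 0 <= b u u }.

Context (S : set V) (b : V -> V -> R) (hb : semi_inner S b).

Lemma si_memZ a u : S u -> S (a *: u).
Proof. by move=> Su; rewrite -[a *: u]addr0; apply: (si_lin hb) => //; exact: (si_mem0 hb). Qed.

Lemma si_memD u v : S u -> S v -> S (u + v).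
Proof. by move=> Su Sv; rewrite -[u]scale1r; exact: (si_lin hb). Qed.

Lemma si_memN u : S u -> S (- u).
Proof. by move=> Su; rewrite -scaleN1r; exact: si_memZ. Qed.

Lemma si_memB u v : S u -> S v -> S (u - v).
Proof. by move=> Su Sv; apply: si_memD => //; exact: si_memN. Qed.

Lemma si_Dl u v w : S u -> S v -> S w -> b (u + v) w = b u w + b v w.
Proof. by move=> Su Sv Sw; rewrite -{1}[u]scale1r (si_linl hb)// mul1r. Qed.

Lemma si_0l w : S w -> b 0 w = 0.
Proof.
move=> Sw; have S0 := si_mem0 hb; have := si_Dl S0 S0 Sw.
by rewrite addr0 -[X in X = _]addr0 => /addrI.
Qed.

Lemma si_Zl a u w : S u -> S w -> b (a *: u) w = a * b u w.
Proof.
by move=> Su Sw; rewrite -[a *: u]addr0 (si_linl hb) ?si_0l ?addr0//; exact: (si_mem0 hb).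
Qed.

Lemma si_Nl u w : S u -> S w -> b (- u) w = - b u w.
Proof. by move=> Su Sw; rewrite -scaleN1r si_Zl// mulN1r. Qed.

Lemma si_Bl u v w : S u -> S v -> S w -> b (u - v) w = b u w - b v w.
Proof. by move=> Su Sv Sw; rewrite si_Dl ?si_Nl//; exact: si_memN. Qed.

Lemma si_Dr u v w : S u -> S v -> S w -> b w (u + v) = b w u + b w v.
Proof.
by move=> Su Sv Sw; rewrite (si_sym hb) ?si_Dl ?(si_sym hb _ Sw)//; exact: si_memD.
Qed.

Lemma si_Zr a u w : S u -> S w -> b w (a *: u) = a * b w u.
Proof.
by move=> Su Sw; rewrite (si_sym hb) ?si_Zl ?(si_sym hb _ Sw)//; exact: si_memZ.
Qed.

Lemma si_Nr u w : S u -> S w -> b w (- u) = - b w u.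
Proof. by move=> Su Sw; rewrite -scaleN1r si_Zr// mulN1r. Qed.

Lemma si_Br u v w : S u -> S v -> S w -> b w (u - v) = b w u - b w v.
Proof. by move=> Su Sv Sw; rewrite si_Dr ?si_Nr//; exact: si_memN. Qed.

Lemma si_0r w : S w -> b w 0 = 0.
Proof. by move=> Sw; rewrite (si_sym hb) ?si_0l//; exact: (si_mem0 hb). Qed.

Lemma si_polar (t : R) u v : S u -> S v ->
  b (u + t *: v) (u + t *: v) = b u u + 2 * t * b u v + t ^+ 2 * b v v.
Proof.
move=> Su Sv; have Stv := si_memZ t Sv.
rewrite si_Dl ?si_Dr//; try exact: si_memD.
by rewrite !si_Zl// !si_Zr// (si_sym hb Sv Su); ring.
Qed.

Lemma cauchy_schwarz u v : S u -> S v -> b u v ^+ 2 <= b u u * b v v.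
Proof.
move=> Su Sv.
have pos t : 0 <= b u u + 2 * t * b u v + t ^+ 2 * b v v.
  by rewrite -si_polar//; apply: (si_ge0 hb); apply: si_memD => //; exact: si_memZ.
have uu := si_ge0 hb Su; have vv := si_ge0 hb Sv.
have [v0|vn0] := eqVneq (b v v) 0.
  rewrite v0 mulr0; have [->|uv] := eqVneq (b u v) 0; first by rewrite expr0n.
  (* When $b(v,v)=0$ the square of $u+tv$ is affine in $t$, and this $t$ would make it equal to
     $-1$. *)
  have := pos (- (b u u + 1) / (2 * b u v)); rewrite v0 mulr0 addr0.
  have -> : 2 * (- (b u u + 1) / (2 * b u v)) * b u v = - (b u u + 1) by field.
  by lra.
have vgt : 0 < b v v by rewrite lt0r vn0.
have := pos (- b u v / b v v).
have -> : b u u + 2 * (- b u v / b v v) * b u v + (- b u v / b v v) ^+ 2 * b v v =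
  (b u u * b v v - b u v ^+ 2) / b v v by field.
by rewrite pmulr_lge0 ?invr_gt0// subr_ge0.
Qed.

Definition si_norm u := Num.sqrt (b u u).

Lemma si_norm_ge0 u : 0 <= si_norm u.
Proof. exact: sqrtr_ge0. Qed.

Lemma si_norm_sqr u : S u -> si_norm u ^+ 2 = b u u.
Proof. by move=> Su; rewrite sqr_sqrtr//; exact: (si_ge0 hb). Qed.

Lemma si_cs u v : S u -> S v -> `|b u v| <= si_norm u * si_norm v.
Proof.
move=> Su Sv; rewrite -ler_sqr ?nnegrE ?mulr_ge0 ?si_norm_ge0//.
by rewrite real_normK ?num_real// exprMn !si_norm_sqr// cauchy_schwarz.
Qed.

Lemma si_normD u v : S u -> S v -> si_norm (u + v) <= si_norm u + si_norm v.
Proof.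
move=> Su Sv; rewrite -ler_sqr ?nnegrE ?addr_ge0 ?si_norm_ge0//.
rewrite si_norm_sqr; last exact: si_memD.
have := si_polar 1 Su Sv; rewrite scale1r => ->.
have := le_trans (ler_norm _) (si_cs Su Sv).
by rewrite sqrrD !si_norm_sqr//; lra.
Qed.

Lemma si_normZ a u : S u -> si_norm (a *: u) = `|a| * si_norm u.
Proof.
move=> Su; rewrite /si_norm si_Zl ?si_Zr//; last exact: si_memZ.
by rewrite mulrA -expr2 sqrtrM ?sqr_ge0// sqrtr_sqr.
Qed.

Lemma si_normN u : S u -> si_norm (- u) = si_norm u.
Proof. by move=> Su; rewrite -scaleN1r si_normZ// normrN1 mul1r. Qed.

Lemma si_normB u v : S u -> S v -> si_norm (u - v) <= si_norm u + si_norm v.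
Proof. by move=> Su Sv; rewrite -[si_norm v]si_normN ?si_normD//; exact: si_memN. Qed.

Lemma si_normBC u v : S u -> S v -> si_norm (u - v) = si_norm (v - u).
Proof. by move=> Su Sv; rewrite -si_normN ?opprB//; exact: si_memB. Qed.

Lemma si_norm_dist u v : S u -> S v -> `|si_norm u - si_norm v| <= si_norm (u - v).
Proof.
move=> Su Sv; have h1 := si_normD (si_memB Su Sv) Sv.
have h2 := si_normD (si_memB Sv Su) Su.
rewrite !subrK in h1 h2; rewrite (si_normBC Sv Su) in h2.
by rewrite ler_norml; apply/andP; split; lra.
Qed.

Lemma si_norm0_l u v : S u -> S v -> si_norm u = 0 -> b u v = 0.
Proof.
move=> Su Sv u0; apply/eqP; rewrite -normr_le0.
by apply: (le_trans (si_cs Su Sv)); rewrite u0 mul0r.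
Qed.

Lemma si_norm_eq u v : S u -> S v -> si_norm (u - v) = 0 -> si_norm u = si_norm v.
Proof.
move=> Su Sv h; apply/eqP; rewrite -subr_eq0 -normr_le0.
by apply: (le_trans (si_norm_dist Su Sv)); rewrite h.
Qed.

Lemma si_norm0 : si_norm 0 = 0.
Proof. by rewrite /si_norm si_0l ?sqrtr0//; exact: (si_mem0 hb). Qed.

Lemma si_sqrD_le u v : S u -> S v -> b (u + v) (u + v) <= 2 * b u u + 2 * b v v.
Proof.
move=> Su Sv; have := si_polar 1 Su Sv; rewrite scale1r => ->.
have := si_ge0 hb (si_memB Su Sv).
have := si_polar (-1) Su Sv; rewrite scaleN1r => ->; lra.
Qed.

End forms.

Section square_integrable.
Context d (T : measurableType d) (R : realType) (mu : {measure set T -> \bar R}).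
Context (D : set T) (mD : measurable D).
Implicit Types (f g h : T -> R).

Definition sqint f := measurable_fun D f /\
  (\int[mu]_(x in D) ((f x) ^+ 2)%:E < +oo)%E.

Definition Rdot f g : R := \int[mu]_(x in D) (f x * g x).

Lemma sqint_integrable f : sqint f -> mu.-integrable D (EFin \o (fun x => f x ^+ 2)).
Proof.
move=> [mf lf]; apply/integrableP; split.
  by apply/measurable_EFinP; exact: measurable_funX.
by under eq_integral do rewrite /= ger0_norm ?sqr_ge0//.
Qed.

Lemma sqintP f : measurable_fun D f -> mu.-integrable D (EFin \o (fun x => f x ^+ 2)) -> sqint f.
Proof.
move=> mf /integrableP[_ h]; split=> //; apply: le_lt_trans h.
by under [leRHS]eq_integral do rewrite /= ger0_norm ?sqr_ge0//.
Qed.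

Lemma sqint_le f g : measurable_fun D f -> sqint g -> (forall x, D x -> `|f x| <= `|g x|) ->
  sqint f.
Proof.
move=> mf sg fg; apply: sqintP => //; apply: le_integrable (sqint_integrable sg) => //.
  by apply/measurable_EFinP; exact: measurable_funX.
move=> x Dx /=; rewrite lee_fin !ger0_norm ?sqr_ge0//.
by rewrite -(real_normK (num_real (f x))) -(real_normK (num_real (g x))) lerXn2r ?nnegrE// fg.
Qed.

Lemma sqintM f g : sqint f -> sqint g -> mu.-integrable D (EFin \o (fun x => f x * g x)).
Proof.
move=> sf sg.
apply: (le_integrable mD _ _ (integrableD mD (sqint_integrable sf) (sqint_integrable sg))).
  by apply/measurable_EFinP; apply: measurable_funM; [case: sf|case: sg].
move=> x Dx /=; rewrite lee_fin normrM [leRHS]ger0_norm ?addr_ge0 ?sqr_ge0//.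
have := sqr_ge0 (`|f x| - `|g x|); rewrite sqrrB !real_normK ?num_real//.
by have := sqr_ge0 (f x); have := sqr_ge0 (g x); lra.
Qed.

Lemma sqint_lin (a : R) f g : sqint f -> sqint g -> sqint (fun x => a * f x + g x).
Proof.
move=> sf sg; apply: sqintP.
  apply: measurable_funD; last by case: sg.
  by apply: measurable_funM; [exact: measurable_cst|case: sf].
have := integrableD mD (integrableD mD (integrableZl mD (a ^+ 2) (sqint_integrable sf))
  (integrableZl mD (2 * a) (sqintM sf sg))) (sqint_integrable sg).
apply: eq_integrable => // x _ /=; rewrite -!EFinM -!EFinD; congr EFin; ring.
Qed.

Lemma sqint0 : sqint (fun=> 0).
Proof. by split=> //; rewrite expr0n /= integral0 ltry. Qed.

Lemma Rdot_semi_inner :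
  @semi_inner R (T -> R^o) sqint Rdot.
Proof.
split.
- by move=> a u v su sv; have := sqint_lin a su sv.
- exact: sqint0.
- by move=> u v _ _; apply: eq_Rintegral => x _; rewrite mulrC.
- move=> a u v w su sv sw; rewrite /Rdot -RintegralZl//; last exact: sqintM.
  rewrite -RintegralD//; last 2 first.
  + exact: (integrableZl mD a (sqintM su sw)).
  + exact: sqintM.
  apply: eq_Rintegral => x _.
  by rewrite -[(a *: u + v) x]/(a * u x + v x); ring.
- move=> u su; apply: Rintegral_ge0 => x _; rewrite -expr2; exact: sqr_ge0.
Qed.

Lemma sqint_dct (f_ : nat -> T -> R) f h :
  (forall k, measurable_fun D (f_ k)) -> (forall x, D x -> f_ k x @[k --> \oo] --> f x) ->
  (forall k x, D x -> `|f_ k x| <= h x) -> sqint h ->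
  [/\ forall k, sqint (f_ k), sqint f &
    Rdot (fun x => f_ k x - f x) (fun x => f_ k x - f x) @[k --> \oo] --> 0].
Proof.
move=> mf cf bf sh.
have mff : measurable_fun D f by exact: measurable_fun_cvg cf.
have bff x : D x -> `|f x| <= h x.
  move=> Dx; have c : `|f_ k x| @[k --> \oo] --> `|f x| by apply: cvg_norm; exact: cf.
  rewrite -(cvg_lim _ c)//; apply: limr_le; first exact: (cvgP _ c).
  by apply: nearW => k; exact: bf.
have hh x : D x -> `|h x| = h x by move=> Dx; rewrite ger0_norm//; exact: le_trans (bff _ Dx).
have s1 k : sqint (f_ k) by apply: (sqint_le (mf k) sh) => x Dx; rewrite hh//; exact: bf.
have s2 : sqint f by apply: (sqint_le mff sh) => x Dx; rewrite hh//; exact: bff.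
split=> //.
have := @dominated_convergence _ _ _ mu D mD
  (fun k => EFin \o (fun x => (f_ k x - f x) * (f_ k x - f x))) (cst 0%E)
  (EFin \o (fun x => 4 * h x ^+ 2)) _ _ _ _ _.
case.
- move=> k; apply/measurable_EFinP; apply: measurable_funM; exact: measurable_funB.
- exact: measurable_cst.
- apply: aeW => x Dx; apply: cvg_EFin; first exact: nearW.
  rewrite /comp /=.
  have c0 : f_ k x - f x @[k --> \oo] --> (0 : R).
    by rewrite -(subrr (f x)); apply: cvgB; [exact: cf|exact: cvg_cst].
  by rewrite -(mulr0 (0 : R)); apply: cvgM.
- exact: (integrableZl mD 4 (sqint_integrable sh)).
- apply: aeW => x k Dx; rewrite /= lee_fin normrM -expr2.
  have : `|f_ k x - f x| <= 2 * h x.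
    apply: (le_trans (ler_normB _ _)).
    by have := bf k _ Dx; have := bff _ Dx; lra.
  by have := normr_ge0 (f_ k x - f x); nra.
move=> _ _; rewrite integral0 => L.
apply: fine_cvg; apply: cvg_trans L; apply: near_eq_cvg; exact: nearW.
Qed.

End square_integrable.

(** * Approximation in L2 *)

Section density.
Import HBNNSimple.
Context d (T : measurableType d) (R : realType) (mu : {measure set T -> \bar R}).
Context (D : set T) (mD : measurable D) (Dfin : (mu D < +oo)%E).
Context (C : set (T -> R)).
Hypotheses (Clin : forall a f g, C f -> C g -> C (fun x => a * f x + g x))
  (C0 : C (fun=> 0)) (Csq : forall f, C f -> sqint mu D f).
Local Notation dot := (Rdot mu D).
Local Notation sq f := (dot f f).
Implicit Types (f g h : T -> R) (A B : set T).

Definition approximable f := forall e : R, 0 < e ->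
  exists2 g, C g & sq (fun x => f x - g x) < e.

Let hR : @semi_inner R (T -> R^o) (sqint mu D) dot := Rdot_semi_inner mu mD.

Let sqD f g : sqint mu D f -> sqint mu D g ->
  sq (fun x => f x + g x) <= 2 * sq f + 2 * sq g.
Proof. by move=> sf sg; exact: (si_sqrD_le hR sf sg). Qed.

Let sqB f g : sqint mu D f -> sqint mu D g -> sqint mu D (fun x => f x - g x).
Proof.
move=> sf sg; have := sqint_lin mD (-1) sg sf.
by congr (sqint _ _ _); apply/funext => x; rewrite mulN1r addrC.
Qed.

Lemma approximable_lin a f g : sqint mu D f -> sqint mu D g ->
  approximable f -> approximable g -> approximable (fun x => a * f x + g x).
Proof.
move=> sf sg Af Ag e e0.
have e1 : 0 < e / (4 * (a ^+ 2 + 1)).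
  by rewrite divr_gt0// mulr_gt0// ltr_wpDl ?sqr_ge0.
have e2 : 0 < e / 4 by lra.
have [f' Cf' hf] := Af _ e1; have [g' Cg' hg] := Ag _ e2.
exists (fun x => a * f' x + g' x); first exact: Clin.
have sf' := sqB sf (Csq Cf'); have sg' := sqB sg (Csq Cg').
have -> : (fun x => a * f x + g x - (a * f' x + g' x)) =
  (fun x => a * (f x - f' x) + (g x - g' x)) by apply/funext => x; ring.
have saf : sqint mu D (fun x => a * (f x - f' x)).
  have := sqint_lin mD a sf' (sqint0 mu D).
  by congr (sqint _ _ _); apply/funext => x; rewrite addr0.
apply: (le_lt_trans (sqD saf sg')).
have -> : sq (fun x => a * (f x - f' x)) = a ^+ 2 * sq (fun x => f x - f' x).
  have := si_Zl hR a sf' saf; rewrite -[LHS]/(sq (fun x => a * (f x - f' x))) => ->.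
  by rewrite [X in _ * X](si_Zr hR a sf' sf') expr2 mulrA.
move: hf; rewrite ltr_pdivlMr; last by rewrite mulr_gt0// ltr_wpDl ?sqr_ge0.
have := si_ge0 hR sf'; have := si_ge0 hR sg'.
rewrite -[X in 0 <= X -> _]/(sq _) -[X in _ -> 0 <= X -> _]/(sq _).
set p := sq _ in hg *; set q := sq (fun x => f x - f' x).
have := sqr_ge0 a; nra.
Qed.

Lemma approximable_C f : C f -> approximable f.
Proof.
move=> Cf e e0; exists f => //; rewrite (_ : (fun x => f x - f x) = (fun=> 0)).
  by rewrite (si_0l hR (sqint0 mu D)).
by apply/funext => x; rewrite subrr.
Qed.

Lemma approximable_close f : sqint mu D f ->
  (forall e : R, 0 < e -> exists g, [/\ sqint mu D g, approximable g &
     sq (fun x => f x - g x) < e]) -> approximable f.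
Proof.
move=> sf h e e0; have e4 : 0 < e / 4 by lra.
have [g [sg Ag fg]] := h _ e4; have [g' Cg' gg'] := Ag _ e4.
exists g' => //.
have -> : (fun x => f x - g' x) = (fun x => (f x - g x) + (g x - g' x)).
  by apply/funext => x; rewrite addrA subrK.
have := sqD (sqB sf sg) (sqB sg (Csq Cg')); lra.
Qed.

Lemma approximable_dct (f_ : nat -> T -> R) f h :
  (forall k, measurable_fun D (f_ k)) -> (forall x, D x -> f_ k x @[k --> \oo] --> f x) ->
  (forall k x, D x -> `|f_ k x| <= h x) -> sqint mu D h ->
  (forall k, approximable (f_ k)) -> approximable f.
Proof.
move=> mf cf bf sh Af; have [s1 s2 L] := sqint_dct mD mf cf bf sh.
apply: approximable_close => // e e0.
move/cvgrPdist_lt : L => /(_ _ e0)[N _ hN]; exists (f_ N); split=> //.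
have := hN N (leqnn N); rewrite sub0r normrN; apply: le_lt_trans.
apply: le_trans (ler_norm _).
rewrite le_eqVlt; apply/orP; left; apply/eqP; apply: eq_Rintegral => x _; ring.
Qed.

Let sqint_cst (c : R) : sqint mu D (fun=> c).
Proof.
split; first exact: measurable_cst.
by rewrite integral_cst// lte_mul_pinfty ?lee_fin ?sqr_ge0.
Qed.

Let sqint_indic A : measurable A -> sqint mu D (\1_A).
Proof.
move=> mA; apply: (sqint_le mD _ (sqint_cst 1)); first exact: measurable_indic.
by move=> x _; rewrite indicE normr1; case: (_ \in _); rewrite ?normr1 ?normr0.
Qed.

Context (G : set (set T)).
Hypotheses (GI : setI_closed G) (GT : G setT) (Gm : forall A, G A -> measurable A)
  (Gapprox : forall A, G A -> approximable (\1_A)).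

Let good A := measurable A /\ approximable (\1_A).

Let dynkin_good : dynkin good.
Proof.
split.
- by split=> //; exact: Gapprox.
- move=> A [mA aA]; split; first exact: measurableC.
  have := approximable_lin (-1) (sqint_indic mA) (sqint_indic measurableT) aA (Gapprox GT).
  congr approximable; apply/funext => x; rewrite mulN1r !indicE in_setT in_setC.
  by case: (x \in A); rewrite ?subrr ?addNr ?oppr0 ?add0r.
move=> F tF gF.
have mF k : measurable (F k) by have [] := gF k.
have mU k : measurable (\big[setU/set0]_(j < k) F j) by apply: bigsetU_measurable => j _.
split; first exact: bigcup_measurable.
apply: (@approximable_dct (fun k => \1_(\big[setU/set0]_(j < k) F j)) _ (fun=> 1)).
- by move=> k; apply: measurable_indic.
- move=> x _; rewrite !indicE; have [/set_mem[j _ Fx]|/negP nF] := boolP (_ \in \bigcup_k F k).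
    apply: cvg_near_cst; exists j.+1 => // k /= jk; rewrite indicE mem_set//.
    rewrite -bigcup_mkord; by exists j.
  apply: cvg_near_cst; apply: nearW => k; rewrite indicE memNset//.
  by rewrite -bigcup_mkord => -[j _ Fx]; apply: nF; apply: mem_set; exists j.
- by move=> k x _; rewrite indicE; case: (_ \in _); rewrite ?normr1 ?normr0.
- exact: sqint_cst.
elim=> [|k IH]; first by rewrite big_ord0 indic0; exact: approximable_C.
rewrite big_ord_recr /=.
have := approximable_lin 1 (sqint_indic (mU k)) (sqint_indic (mF k)) IH (gF k).2.
congr approximable; apply/funext => x; rewrite mul1r !indicE in_setU.
have [/set_mem xU|//] := boolP (x \in \big[setU/set0]_(j < k) F j); last by rewrite add0r.
rewrite orTb memNset ?addr0// => Fk; move: xU; rewrite -bigcup_mkord => -[j /= jk Fj].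
have := tF j k I I; have : F j `&` F k !=set0 by exists x.
by move=> h /(_ h) E; rewrite E ltnn in jk.
Qed.

(** Dynkin's $\pi$-$\lambda$ theorem: approximability passes to complements by linearity and to
    countable disjoint unions by dominated convergence. *)
Lemma approximable_sigma A : <<s G >> A -> good A.
Proof.
rewrite -(setI_closed_g_dynkin_g_sigma_algebra GI) => /(_ good); apply; split.
  exact: dynkin_good.
by move=> B GB; split; [exact: Gm|exact: Gapprox].
Qed.

Hypothesis (regular : forall A (e : R), measurable A -> 0 < e ->
  exists2 B, <<s G >> B & (mu (D `&` ((A `\` B) `|` (B `\` A))) < e%:E)%E).

(** The squared $L^2$ distance of two indicators is the measure of the symmetric difference. The
    hypothesis [regular] is what leads from the $\sigma$-algebra generated by [G] to all measurable
    sets, of which a Carathéodory $\sigma$-algebra may have more. *)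
Lemma approximable_indic A : measurable A -> approximable (\1_A).
Proof.
move=> mA; apply: approximable_close; first exact: sqint_indic.
move=> e e0; have [B sB ABe] := regular mA e0; have [mB aB] := approximable_sigma sB.
exists (\1_B); split=> //; first exact: sqint_indic.
have mAB : measurable ((A `\` B) `|` (B `\` A)).
  by apply: measurableU; exact: measurableD.
rewrite /Rdot /Rintegral.
rewrite (eq_integral (fun x => (\1_((A `\` B) `|` (B `\` A)) x)%:E)).
  rewrite integral_indic// setIC -lte_fin fineK// ge0_fin_numE//.
  exact: (lt_trans ABe (ltry _)).
move=> x _; congr EFin; rewrite !indicE in_setU !in_setD.
by case: (x \in A); case: (x \in B); rewrite /= ?subrr ?subr0 ?sub0r ?mulr0 ?mulr1 ?mulrNN ?mul1r.
Qed.

Let approximable_nnsfun (f : {nnsfun T >-> R}) : approximable f.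
Proof.
have [N [s hs]] : exists (N : nat) (s : seq R), forall x,
    f x = \sum_(i < N) (s`_i * \1_(f @^-1` [set s`_i]) x).
  by do 2 eexists; exact: fimfunEord.
have -> : (f : T -> R) = fun x => \sum_(i < N) (s`_i * \1_(f @^-1` [set s`_i]) x).
  exact/funext.
move: N {hs}.
elim=> [|N IH].
  rewrite (_ : (fun x => _) = (fun=> 0)); first exact: approximable_C.
  by apply/funext => x; rewrite big_ord0.
have mP (y : R) : measurable (f @^-1` [set y]) by exact: measurable_sfunP.
have sqs (M : nat) : sqint mu D (fun x => \sum_(i < M) (s`_i * \1_(f @^-1` [set s`_i]) x)).
  elim: M => [|M IHM].
    by rewrite (_ : (fun x => _) = (fun=> 0)); [exact: sqint0|apply/funext => x; rewrite big_ord0].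
  have := sqint_lin mD s`_M (sqint_indic (mP s`_M)) IHM.
  by congr (sqint _ _ _); apply/funext => x; rewrite big_ord_recr addrC.
have := approximable_lin s`_N (sqint_indic (mP s`_N)) (sqs N) (approximable_indic (mP s`_N)) IH.
by congr approximable; apply/funext => x; rewrite big_ord_recr addrC.
Qed.

Let approximable_ge0 f : sqint mu D f -> (forall x, D x -> 0 <= f x) -> approximable f.
Proof.
move=> sf f0; have [mf _] := sf.
have mEf : measurable_fun D (EFin \o f) by exact/measurable_EFinP.
have f0' x : D x -> (0 <= (EFin \o f) x)%E by move=> Dx; rewrite lee_fin f0.
pose g := nnsfun_approx mD mEf.
apply: (@approximable_dct (fun k => g k) _ f).
- by move=> k; exact: measurable_funTS.
- move=> x Dx; have := cvg_nnsfun_approx mD mEf f0' Dx.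
  by move=> /fine_cvgP[_].
- move=> k x Dx; rewrite ger0_norm; last exact: fun_ge0.
  by have := le_approx k f0' Dx; rewrite -nnsfun_approxE lee_fin.
- exact: sf.
- by move=> k; exact: approximable_nnsfun.
Qed.

Lemma approximable_sqint f : sqint mu D f -> approximable f.
Proof.
move=> sf; have [mf _] := sf.
have sp : sqint mu D f^\+.
  apply: (sqint_le mD _ sf); first exact: measurable_funrpos.
  by move=> x _; rewrite ger0_norm ?funrpos_ge0// /funrpos ge_max normr_ge0 ler_norm.
have sn : sqint mu D f^\-.
  apply: (sqint_le mD _ sf); first exact: measurable_funrneg.
  move=> x _; rewrite ger0_norm ?funrneg_ge0// /funrneg ge_max normr_ge0 andbT.
  by rewrite -normrN ler_norm.
have := approximable_lin (-1) sn sp (approximable_ge0 sn _) (approximable_ge0 sp _).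
rewrite (_ : (fun x => _) = f); last first.
  apply/funext => x; rewrite mulN1r /funrpos /funrneg.
  have [h|h] := leP 0 (f x).
    by rewrite max_r ?oppr_le0// oppr0 add0r.
  by rewrite max_l ?oppr_ge0 1?ltW// opprK addr0.
by apply=> x _; [exact: funrneg_ge0|exact: funrpos_ge0].
Qed.

End density.

(** * Sobolev spaces *)

Section leb_regular.
Context (R : realType) (n : nat).
Local Notation X := 'rV[R]_n.+1.
Local Notation mX := (caratheodory_type (@lebesgue_outer R n)).
Local Notation mu := (@leb R n).

Definition open_sets : set (set mX) := [set U | open (U : set X)].

Lemma box_borel (a b : X) : <<s open_sets >> (box a b : set mX).
Proof.
pose S := g_sigma_algebraType open_sets.
suff : measurable (box a b : set S) by [].
rewrite (_ : box a b = \bigcap_(i in [set: 'I_n.+1])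
   ([set x : X | a ord0 i < x ord0 i] `&` ~` [set x : X | b ord0 i < x ord0 i])); last first.
  apply/seteqP; split=> x h i; first by move=> _; have /andP[h1 h2] := h i; split=> //; apply/negP; rewrite -leNgt.
  by have [h1 /negP] := h i I; rewrite -leNgt => h2; apply/andP.
have op (c : R) i : measurable ([set x : X | c < x ord0 i] : set S).
  apply: sub_gen_smallest; apply: (@open_comp _ _ (fun x : X => x ord0 i) [set y | c < y]).
    by move=> x _; exact: coord_continuous.
  exact: open_gt.
by apply: fin_bigcap_measurable => // i _; apply: measurableI => //; exact: measurableC.
Qed.

Lemma borel_leb (A : set mX) : <<s open_sets >> A -> measurable A.
Proof.
by apply: smallest_sub; [exact: sigma_algebra_measurable|move=> U; exact: leb_open].
Qed.

Lemma leb_le_box (a b : X) : (forall i, a ord0 i <= b ord0 i) ->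
  (mu (box a b : set mX) <= (\prod_i (b ord0 i - a ord0 i))%:E)%E.
Proof.
move=> ab; apply: (@le_trans _ _ (box_gauge (box a b))).
  exact: (gauge_ext_le (@box_gauge0 R n) (@box_gauge_ge0 R n)).
by apply: ereal_inf_lbound; exists a, b; split.
Qed.

(** A cover of [A] by arbitrary sets, with gauges summing to nearly the measure of [A], is replaced
    set by set with boxes whose volumes exceed the gauges by a summable error; the union of the
    boxes is Borel. *)
Lemma leb_outer_regular (A : set mX) (e : R) : measurable A -> (mu A < +oo)%E -> 0 < e ->
  exists B : set mX, [/\ <<s open_sets >> B, A `<=` B & (mu (B `\` A) < e%:E)%E].
Proof.
move=> mA Afin e0; have e2 : 0 < e / 4 by lra.
have finA : mu A \is a fin_num by rewrite ge0_fin_numE.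
have [_ [F [_ AF] <-] Flt'] := lb_ereal_inf_adherent e2 finA.
have Flt : (\sum_(k <oo) box_gauge (F k) < mu A + (e / 4)%:E)%E := Flt'.
have gF0 k := @box_gauge_ge0 R n (F k).
have sumlt : (\sum_(k <oo) box_gauge (F k) < +oo)%E.
  by apply: (lt_trans Flt); apply: lte_add_pinfty => //; exact: ltry.
have ek k : 0 < e / 4 / (2 ^ k.+1)%:R by rewrite divr_gt0// ltr0n expn_gt0.
have gfin k : box_gauge (F k) \is a fin_num.
  rewrite ge0_fin_numE//; apply: le_lt_trans sumlt.
  rewrite (nneseriesD1 (n := k))//= leeDl//; exact: nneseries_ge0.
have hbox k : exists ab : X * X, [/\ forall i, ab.1 ord0 i <= ab.2 ord0 i, F k `<=` box ab.1 ab.2 &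
    ((\prod_i (ab.2 ord0 i - ab.1 ord0 i))%:E <= box_gauge (F k) + (e / 4 / (2 ^ k.+1)%:R)%:E)%E].
  have [_ [a [b [ab Fab ->]]] h] := lb_ereal_inf_adherent (ek k) (gfin k).
  by exists (a, b); split=> //=; exact: ltW.
have [ab hab] := choice hbox.
pose B : set mX := \bigcup_k box (ab k).1 (ab k).2.
have sB : <<s open_sets >> B.
  suff : measurable (B : set (g_sigma_algebraType open_sets)) by [].
  by apply: bigcup_measurable => k _; exact: box_borel.
have mB := borel_leb sB.
have AB : A `<=` B by move=> x /AF[k _ Fx]; exists k => //; have [_ h _] := hab k; exact: h.
have muB : (mu B < mu A + (e / 2)%:E)%E.
  apply: (@le_lt_trans _ _ (\sum_(k <oo) mu (box (ab k).1 (ab k).2 : set mX))%E).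
    apply: measure_sigma_subadditive => // k; apply: borel_leb; exact: box_borel.
  apply: (@le_lt_trans _ _ (\sum_(k <oo) (box_gauge (F k) + (e / 4 / (2 ^ k.+1)%:R)%:E))%E).
    apply: lee_nneseries => // k _; have [h1 _ h2] := hab k.
    exact: le_trans (leb_le_box h1) h2.
  apply: (le_lt_trans (epsilon_trick _ gF0 (ltW e2))).
  apply: (@lt_le_trans _ _ (mu A + (e / 4)%:E + (e / 4)%:E)%E).
    by rewrite lteD2rE.
  by rewrite -addeA -EFinD leeD2l// lee_fin; lra.
exists B; split=> //.
have Bfin : (mu B < +oo)%E by apply: (lt_trans muB); apply: lte_add_pinfty => //; exact: ltry.
rewrite measureD// setIidr// lteBlDr//; apply: (lt_trans muB).
by rewrite addeC lteD2rE// lte_fin; lra.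
Qed.

End leb_regular.

(** * Density of test functions, weak gradients and the forms of $H^1(\Omega)$ *)

Section sobolev_theory.
Context (R : realType) (n : nat) (Omega : set 'rV[R]_n.+1).
Hypotheses (oO : open Omega) (bO : bounded_set Omega).
Local Notation X := 'rV[R]_n.+1.
Local Notation mX := (caratheodory_type (@lebesgue_outer R n)).
Local Notation mu := (@leb R n).
Local Notation fct := (X -> R^o).
Implicit Types (u v w phi : fct).

Lemma domain_measurable : measurable (Omega : set mX).
Proof. exact: leb_open. Qed.

Lemma domain_lty : (mu (Omega : set mX) < +oo)%E.
Proof. by apply: leb_bounded_lty => //; exact: domain_measurable. Qed.

Lemma l2_semi_inner : @semi_inner R fct (inL2 Omega) (l2dot Omega).
Proof. exact: (Rdot_semi_inner mu domain_measurable). Qed.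

Lemma continuous_inL2 phi : continuous (phi : X -> R) -> inL2 Omega phi.
Proof.
move=> cphi.
have [r hr] : exists r : R, Omega `<=` cbox 0 r.
  have [M [_ hM]] := bO; exists (`|M| + 1).
  have M1 : M < `|M| + 1 by have := ler_norm M; lra.
  move=> x /(hM _ M1); rewrite /Num.norm/= mx_normrE => hx i; rewrite mxE subr0.
  by apply: le_trans hx; rewrite (le_bigmax _ _ (ord0, i)).
have [M M0 hM] := continuous_cbox_bounded r cphi.
apply: (@sqint_le _ _ _ mu Omega domain_measurable phi (fun=> M)).
- by apply: leb_continuous => //; exact: domain_measurable.
- split; first exact: measurable_cst.
  rewrite integral_cst; last exact: domain_measurable.
  by rewrite lte_mul_pinfty ?lee_fin ?sqr_ge0//; exact: domain_lty.
- by move=> x /hr/hM; rewrite (ger0_norm M0).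
Qed.

Lemma test_fun_lin (a : R) (f g : X -> R) : test_fun Omega f -> test_fun Omega g ->
  test_fun Omega (fun x => a * f x + g x).
Proof.
move=> [sf cf fO] [sg cg gO].
apply: (@test_funI _ _ _ (closure [set x | f x != 0] `|` closure [set x | g x != 0])).
- by apply: smoothD => //; apply: smoothM => //; exact: smooth_cst.
- exact: compactU.
- by move=> x [/fO|/gO].
move=> x /not_orP[h1 h2].
have z (h : X -> R) : ~ closure [set x | h x != 0] x -> h x = 0.
  move=> nc; apply: contrapT => /eqP hx; apply: nc; exact: subset_closure.
by rewrite (z f h1) (z g h2) mulr0 addr0.
Qed.

Lemma test_fun_cst0 : test_fun Omega (fun _ : X => 0 : R).
Proof.
by apply: (@test_funI _ _ _ set0) => //; [exact: smooth_cst|exact: compact0].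
Qed.

Lemma test_inL2 phi : test_fun Omega phi -> inL2 Omega phi.
Proof. by move=> [s _ _]; apply: continuous_inL2; exact: smooth_continuous. Qed.

Lemma smooth_partial_inL2 phi i : smooth phi -> inL2 Omega (partial i phi).
Proof.
by move=> s; apply: continuous_inL2; apply: smooth_continuous; exact: smooth_partial.
Qed.

(** The $\pi$-system is that of the open sets. On [Omega] the indicator of an open [U] agrees with
    that of $U\cap\Omega$, which is a limit of test functions supported there; outer regularity
    handles the remaining measurable sets. *)
Lemma test_dense u (e : R) : inL2 Omega u -> 0 < e ->
  exists2 phi : X -> R, test_fun Omega phi & l2dot Omega (u - phi) (u - phi) < e.
Proof.
move=> hu; move: e.
have mO := domain_measurable.
apply: (@approximable_sqint _ _ _ mu Omega mO domain_lty (test_fun Omega) _ _ _ (@open_sets R n)).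
- exact: test_fun_lin.
- exact: test_fun_cst0.
- exact: test_inL2.
- by move=> A B; exact: openI.
- exact: openT.
- by move=> A; exact: leb_open.
- move=> U oU; have oUO : open (U `&` Omega : set X) by exact: openI.
  apply: (@approximable_dct _ _ _ _ _ mO _ (fun f => @test_inL2 f) (open_approx (U `&` Omega)) _ (fun=> 1)).
  + move=> k; apply: leb_continuous => //; apply: smooth_continuous; exact: open_approx_smooth.
  + move=> x Ox; have := @open_approx_cvg _ _ _ x oUO.
    by rewrite !indicE in_setI (mem_set Ox) andbT.
  + by move=> k x _; have /andP[h1 h2] := open_approx01 (U `&` Omega) k x; rewrite ger0_norm.
  + by apply: continuous_inL2; exact: cst_continuous.
  + move=> k; apply: approximable_C => //.
    have [s c h] := open_approx_test (U `&` Omega) k; split=> //.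
    by apply: (subset_trans h) => x [].
- move=> A e mA e0.
  have mAO : measurable (A `&` Omega : set mX) by exact: measurableI.
  have fAO : (mu (A `&` Omega : set mX) < +oo)%E.
    by apply: le_lt_trans domain_lty; apply: le_measure; rewrite ?inE.
  have [B [sB AB Be]] := leb_outer_regular mAO fAO e0.
  exists B => //; apply: le_lt_trans Be; have mB := borel_leb sB.
  apply: le_measure; rewrite ?inE.
  + by apply: measurableI => //; apply: measurableU; exact: measurableD.
  + exact: measurableD.
  + by move=> x [Ox [[Ax nB]|[Bx nA]]]; [case: nB; apply: AB|split=> // -[]].
- exact: hu.
Qed.

(** A test function $\varphi$ with $\|u-\varphi\|<\|u\|$ would contradict the Cauchy-Schwarz
    inequality, because $(u,u-\varphi)=(u,u)$. *)
Lemma test_orthogonal u : inL2 Omega u ->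
  (forall phi : X -> R, test_fun Omega phi -> l2dot Omega u phi = 0) -> l2dot Omega u u = 0.
Proof.
move=> hu h; have hl := l2_semi_inner.
apply/eqP; rewrite eq_le (si_ge0 hl hu) andbT leNgt; apply/negP => pos.
have [phi tphi lt] := test_dense hu pos.
have sp := test_inL2 tphi.
have := cauchy_schwarz hl hu (si_memB hl hu sp).
rewrite (si_Br hl hu sp hu) (h _ tphi) subr0 expr2.
by rewrite ler_pM2l// leNgt lt.
Qed.

Lemma l2_null u v : inL2 Omega u -> inL2 Omega v -> l2dot Omega u u = 0 -> l2dot Omega u v = 0.
Proof.
move=> hu hv u0; apply: (si_norm0_l l2_semi_inner) => //.
by rewrite /si_norm u0 sqrtr0.
Qed.

(** Almost everywhere uniqueness, expressed through pairings with $L^2$ functions, which is all that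
    the forms see. The difference of the two components is orthogonal to every test function. *)
Lemma wgrad_unique u g h i v : is_wgrad Omega u g -> is_wgrad Omega u h -> inL2 Omega v ->
  l2dot Omega (g i) v = l2dot Omega (h i) v.
Proof.
move=> /(_ i)[sg Hg] /(_ i)[sh Hh] sv; have hl := l2_semi_inner.
have sgh := si_memB hl sg sh.
apply/eqP; rewrite -subr_eq0 -(si_Bl hl)//; apply/eqP; apply: l2_null => //.
apply: test_orthogonal => // phi tphi; have sp := test_inL2 tphi.
rewrite (si_Bl hl)//; have := Hg _ tphi; rewrite Hh// => /eqP; rewrite eqr_opp => /eqP ->.
by rewrite subrr.
Qed.

Lemma wgradP u : inH1 Omega u -> is_wgrad Omega u (wgrad Omega u).
Proof. by move=> [_ [g hg]]; apply: xgetPex; exists g. Qed.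

Lemma wgrad_inL2 u i : inH1 Omega u -> inL2 Omega (wgrad Omega u i).
Proof. by move=> /wgradP/(_ i)[]. Qed.

Lemma is_wgrad_lin (a : R) u v g h : inL2 Omega u -> inL2 Omega v ->
  is_wgrad Omega u g -> is_wgrad Omega v h ->
  is_wgrad Omega (a *: u + v) (fun i => a *: g i + h i).
Proof.
move=> su sv Hg Hh i; have hl := l2_semi_inner.
have [sg Hg'] := Hg i; have [sh Hh'] := Hh i.
split; first exact: (si_lin hl).
move=> phi tphi; have sp := test_inL2 tphi.
have spp : inL2 Omega (partial i phi) by apply: smooth_partial_inL2; case: tphi.
rewrite (si_linl hl a su sv spp) (si_linl hl a sg sh sp) Hg'// Hh'//; ring.
Qed.

(** Frees the gradient form from the representatives selected by choice in [wgrad]; bilinearity is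
    proved with gradients formed explicitly. *)
Lemma graddotE u v gu gv : inH1 Omega u -> inH1 Omega v ->
  is_wgrad Omega u gu -> is_wgrad Omega v gv ->
  graddot Omega u v = \sum_i l2dot Omega (gu i) (gv i).
Proof.
move=> hu hv Hu Hv; apply: eq_bigr => i _; have hl := l2_semi_inner.
rewrite (wgrad_unique i (wgradP hu) Hu (wgrad_inL2 i hv)).
have [sgu _] := Hu i; have [sgv _] := Hv i.
rewrite (si_sym hl sgu (wgrad_inL2 i hv)) (wgrad_unique i (wgradP hv) Hv sgu).
by rewrite (si_sym hl).
Qed.

Lemma inH1_lin (a : R) u v : inH1 Omega u -> inH1 Omega v -> inH1 Omega (a *: u + v).
Proof.
move=> hu hv; have [su _] := hu; have [sv _] := hv; split.
  exact: (si_lin l2_semi_inner).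
by eexists; apply: is_wgrad_lin => //; exact: wgradP.
Qed.

Lemma inH1_0 : inH1 Omega 0.
Proof.
have hl := l2_semi_inner; split; first exact: (si_mem0 hl).
exists (fun=> 0) => i; split; first exact: (si_mem0 hl).
move=> phi tphi; rewrite (si_0l hl) ?(si_0l hl) ?oppr0//; first exact: test_inL2.
by apply: smooth_partial_inL2; case: tphi.
Qed.

Lemma grad_semi_inner : @semi_inner R fct (inH1 Omega) (graddot Omega).
Proof.
have hl := l2_semi_inner; split.
- exact: inH1_lin.
- exact: inH1_0.
- move=> u v hu hv; apply: eq_bigr => i _.
  by apply: (si_sym hl); exact: wgrad_inL2.
- move=> a u v w hu hv hw; have [su _] := hu; have [sv _] := hv.
  have H := is_wgrad_lin a su sv (wgradP hu) (wgradP hv).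
  rewrite (graddotE (inH1_lin a hu hv) hw H (wgradP hw)).
  rewrite /graddot mulr_sumr -big_split; apply: eq_bigr => i _ /=.
  by apply: (si_linl hl); exact: wgrad_inL2.
- by move=> u hu; apply: sumr_ge0 => i _; apply: (si_ge0 hl); exact: wgrad_inL2.
Qed.

Definition h1dot u v := l2dot Omega u v + graddot Omega u v.

Lemma h1_semi_inner : @semi_inner R fct (inH1 Omega) h1dot.
Proof.
have hl := l2_semi_inner; have hg := grad_semi_inner; split.
- exact: inH1_lin.
- exact: inH1_0.
- by move=> u v hu hv; rewrite /h1dot (si_sym hg)// (si_sym hl)//; [case: hu|case: hv].
- move=> a u v w hu hv hw; rewrite /h1dot (si_linl hg)// (si_linl hl).
  + by rewrite mulrDr addrACA.
  + by case: hu.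
  + by case: hv.
  + by case: hw.
- by move=> u hu; apply: addr_ge0; [apply: (si_ge0 hl); case: hu|exact: (si_ge0 hg)].
Qed.

Lemma h1normE u : inH1 Omega u -> h1norm Omega u = si_norm h1dot u.
Proof.
move=> hu; rewrite /h1norm /si_norm /h1dot /l2norm /gradnorm.
rewrite !sqr_sqrtr//; first exact: (si_ge0 grad_semi_inner).
by apply: (si_ge0 l2_semi_inner); case: hu.
Qed.

(** The product with a test function is smooth on the whole space and compactly supported in
    [Omega], so its partial derivative vanishes outside [Omega] and has integral $0$. *)
Lemma smooth_is_wgrad phi : smooth phi -> is_wgrad Omega phi (fun i => partial i phi).
Proof.
move=> sphi i; split; first exact: smooth_partial_inL2.
move=> psi tpsi; have [spsi cpsi psiO] := tpsi; have hl := l2_semi_inner.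
have sp := continuous_inL2 (smooth_continuous sphi).
have sps := test_inL2 tpsi.
have spp := smooth_partial_inL2 i sphi; have sspp := smooth_partial_inL2 i spsi.
apply/eqP; rewrite -addr_eq0; apply/eqP.
pose F : X -> R := fun x => phi x * psi x.
have sF : smooth F by exact: smoothM.
pose K := closure [set x | psi x != 0].
have psi0 x : ~ K x -> psi x = 0.
  by move=> nc; apply: contrapT => /eqP hx; apply: nc; exact: subset_closure.
have F0 x : ~ K x -> F x = 0 by move=> /psi0 h; rewrite /F h mulr0.
have := integral_partial0 i sF cpsi F0 => I0.
have mO := domain_measurable.
have i1 := sqintM mO sp sspp; have i2 := sqintM mO spp sps.
rewrite /l2dot -RintegralD//.
rewrite (_ : \int[mu]_(x in Omega) _ = \int[mu]_(x in Omega) (partial i F x)); last first.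
  by apply: eq_Rintegral => x _; rewrite partialM// [X in _ + X]mulrC.
rewrite Rintegral_mkcond (_ : _ \_ _ = partial i F); first by rewrite /Rintegral I0.
apply/funext => x; rewrite patchE; case: ifPn => //.
rewrite notin_setE => nO; have nK : ~ K x by move=> /psiO.
have H : is_derive x (delta_mx ord0 i : X) F 0.
  apply: (near_eq_is_derive _ (is_derive_cst (0 : R) x _)).
  have : nbhs x (~` K).
    by apply: open_nbhs_nbhs; split=> //; apply: closed_openC; exact: closed_closure.
  by apply: filterS => y /F0.
by rewrite /partial; symmetry; exact: derive_val.
Qed.

Lemma smooth_inH1 phi : smooth phi -> inH1 Omega phi.
Proof.
move=> sphi; split; first by apply: continuous_inL2; exact: smooth_continuous.
by eexists; exact: smooth_is_wgrad.
Qed.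

End sobolev_theory.

(** * The space of $H^1$ functions with zero trace on part of the boundary *)

Section h1z.
Context (R : realType) (n : nat) (Omega S : set 'rV[R]_n.+1).
Hypotheses (oO : open Omega) (bO : bounded_set Omega).
Local Notation X := 'rV[R]_n.+1.
Local Notation hX := (caratheodory_type (@hausdorff_outer R n n)).
Local Notation nu := (@hausdorff R n n).
Local Notation fct := (X -> R^o).
Hypotheses (mS : measurable (S : set hX)) (SO : S `&` Omega = set0).
Implicit Types (u v w phi : fct).

(** Pointwise $(af+g)^2\le 2a^2f^2+2g^2$. Splitting the integral over [S] is the place where
    continuous functions have to be measurable for the Hausdorff measure. *)
Lemma trace_sqr_lin (a : R) (f g : X -> R) : smooth f -> smooth g ->
  (\int[nu]_(x in S) ((a * f x + g x) ^+ 2)%:E <=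
   (2 * a ^+ 2)%:E * (\int[nu]_(x in S) (f x ^+ 2)%:E) +
   2%:E * (\int[nu]_(x in S) (g x ^+ 2)%:E))%E.
Proof.
move=> sf sg.
have mf2 (h : X -> R) : smooth h ->
    measurable_fun (S : set hX) (fun x : hX => (h x ^+ 2)%:E).
  move=> sh; apply/measurable_EFinP; apply: measurable_funX.
  by apply: hausdorff_continuous mS _; exact: smooth_continuous.
have sm : smooth (fun x => a * f x + g x).
  by apply: smoothD => //; apply: smoothM => //; exact: smooth_cst.
have pos (h : X -> R) (x : hX) : S x -> (0 <= (h x ^+ 2)%:E)%E.
  by move=> _; rewrite lee_fin sqr_ge0.
have a0 : (0 <= (2 * a ^+ 2)%:E)%E by rewrite lee_fin mulr_ge0// sqr_ge0.
have t0 : (0 <= 2%:E :> \bar R)%E by rewrite lee_fin.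
rewrite -(ge0_integralZl nu mS (mf2 _ sf) (pos f) a0).
rewrite -(ge0_integralZl nu mS (mf2 _ sg) (pos g) t0).
have p1 (x : hX) : S x -> (0 <= (2 * a ^+ 2)%:E * (f x ^+ 2)%:E)%E.
  by move=> Sx; apply: mule_ge0 => //; exact: pos.
have p2 (x : hX) : S x -> (0 <= 2%:E * (g x ^+ 2)%:E)%E.
  by move=> Sx; apply: mule_ge0 => //; exact: pos.
have m1 := measurable_funeM (2 * a ^+ 2)%:E (mf2 _ sf).
have m2 := measurable_funeM 2%:E (mf2 _ sg).
rewrite -(ge0_integralD nu mS p1 m1 p2 m2).
apply: (ge0_le_integral nu mS (pos _) (mf2 _ sm) (emeasurable_funD m1 m2)) => x _.
rewrite -!EFinM -EFinD lee_fin.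
by have := sqr_ge0 (a * f x - g x); nra.
Qed.

Lemma has_trace0E u : has_trace Omega S u 0 <->
  exists phi : nat -> X -> R,
  [/\ forall k, smooth (phi k), h1norm Omega (phi k - u) @[k --> \oo] --> 0
    & (\int[nu]_(x in S) ((phi k x) ^+ 2)%:E)%E @[k --> \oo] --> 0%E].
Proof.
have E (phi : nat -> fct) : (fun k => \int[nu]_(x in S) ((phi k x - (0 : fct) x : R) ^+ 2)%:E)%E =
    (fun k => \int[nu]_(x in S) ((phi k x) ^+ 2)%:E)%E.
  by apply/funext => k; apply: eq_integral => x _; rewrite subr0.
by split=> -[phi [h1 h2 h3]]; exists phi; split; [exact: h1|exact: h2|move: h3; rewrite E|
  exact: h1|exact: h2|rewrite E].
Qed.

Lemma has_trace0_lin (a : R) u v : inH1 Omega u -> inH1 Omega v ->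
  has_trace Omega S u 0 -> has_trace Omega S v 0 -> has_trace Omega S (a *: u + v) 0.
Proof.
move=> hu hv /has_trace0E[f [sf cf If]] /has_trace0E[g [sg cg Ig]].
have h1 := h1_semi_inner oO bO.
have sm k : smooth (fun x => a * f k x + g k x).
  by apply: smoothD; [apply: smoothM; [exact: smooth_cst|exact: sf]|exact: sg].
apply/has_trace0E; exists (fun k x => a * f k x + g k x); split.
- exact: sm.
- have hf k : inH1 Omega (f k - u) by apply: (si_memB h1); [exact: smooth_inH1|exact: hu].
  have hg k : inH1 Omega (g k - v) by apply: (si_memB h1); [exact: smooth_inH1|exact: hv].
  apply: (@squeeze_cvgr _ _ _ _ (fun=> 0)
    (fun k => `|a| * h1norm Omega (f k - u) + h1norm Omega (g k - v))).
  + apply: nearW => k; rewrite sqrtr_ge0 /=.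
    have -> : (fun x => a * f k x + g k x : R^o) - (a *: u + v) =
        a *: ((f k : fct) - u) + ((g k : fct) - v).
      apply/funext => x; rewrite -[LHS]/(a * f k x + g k x - (a * u x + v x)).
      rewrite -[RHS]/(a * (f k x - u x) + (g k x - v x)); ring.
    rewrite (h1normE oO bO (si_lin h1 a (hf k) (hg k))) (h1normE oO bO (hf k)) (h1normE oO bO (hg k)).
    rewrite -(si_normZ h1 a (hf k)); exact: (si_normD h1 (si_memZ h1 a (hf k)) (hg k)).
  + exact: cvg_cst.
  + rewrite -[X in _ --> X](addr0 (0 : R)) -{1}(mulr0 `|a|).
    by apply: cvgD; [apply: cvgM; [exact: cvg_cst|exact: cf]|exact: cg].
have L : ((2 * a ^+ 2)%:E * (\int[nu]_(x in S) (f k x ^+ 2)%:E) +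
     2%:E * (\int[nu]_(x in S) (g k x ^+ 2)%:E))%E @[k --> \oo] --> 0%E.
  have c1 : ((2 * a ^+ 2)%:E * (\int[nu]_(x in S) (f k x ^+ 2)%:E))%E @[k --> \oo]
      --> ((2 * a ^+ 2)%:E * 0)%E by apply: cvgeZl.
  have c2 : (2%:E * (\int[nu]_(x in S) (g k x ^+ 2)%:E))%E @[k --> \oo]
      --> (2%:E * 0)%E by apply: cvgeZl.
  rewrite mule0 in c1; rewrite mule0 in c2.
  by rewrite -[X in _ --> X](adde0 0%E); apply: cvgeD.
apply: (squeeze_cvge _ _ L); last exact: (cvg_cst 0%E).
apply: nearW => k; apply/andP; split; last exact: trace_sqr_lin.
by apply: integral_ge0 => x _; rewrite lee_fin sqr_ge0.
Qed.

Lemma smooth_has_trace phi : smooth phi -> (forall x, S x -> phi x = 0) ->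
  has_trace Omega S phi 0.
Proof.
move=> sphi phi0; have h1 := h1_semi_inner oO bO.
apply/has_trace0E; exists (fun=> phi); split; first by move=> _; exact: sphi.
  rewrite subrr (h1normE oO bO (si_mem0 h1)) (si_norm0 h1); exact: cvg_cst.
rewrite (_ : (fun k : nat => _) = (fun=> 0%E)); first exact: cvg_cst.
apply/funext => _; apply: integral0_eq => x Sx.
by rewrite phi0 ?expr0n.
Qed.

Lemma test_H1z phi : test_fun Omega phi -> nmem (H1z Omega S) phi.
Proof.
move=> tphi; have [sphi _ _] := tphi; split; first exact: smooth_inH1.
apply: smooth_has_trace => // x Sx; apply: (test_fun0 tphi) => Ox.
by have : (S `&` Omega) x by []; rewrite SO.
Qed.

Lemma h1z_semi_inner : @semi_inner R (H1z Omega S) (nmem (H1z Omega S)) (h1dot Omega).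
Proof.
have h1 := h1_semi_inner oO bO; split.
- move=> a u v [hu tu] [hv tv]; split; first exact: (si_lin h1).
  exact: has_trace0_lin.
- by apply: test_H1z; exact: test_fun_cst0.
- by move=> u v [hu _] [hv _]; exact: (si_sym h1).
- by move=> a u v w [hu _] [hv _] [hw _]; exact: (si_linl h1).
- by move=> u [hu _]; exact: (si_ge0 h1).
Qed.

Lemma h1z_grad_semi_inner :
  @semi_inner R (H1z Omega S) (nmem (H1z Omega S)) (graddot Omega).
Proof.
have h1 := h1z_semi_inner; have hg := grad_semi_inner oO bO; split.
- exact: (si_lin h1).
- exact: (si_mem0 h1).
- by move=> u v [hu _] [hv _]; exact: (si_sym hg).
- by move=> a u v w [hu _] [hv _] [hw _]; exact: (si_linl hg).
- by move=> u [hu _]; exact: (si_ge0 hg).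
Qed.

Lemma h1z_norm u : nmem (H1z Omega S) u -> nnorm (H1z Omega S) u = si_norm (h1dot Omega) u.
Proof. by move=> [hu _]; exact: h1normE. Qed.

End h1z.

Lemma frontier_part_measurable (R : realType) (n s : nat) (Omega S : set 'rV[R]_n.+1) :
  relatively_open (frontier Omega) S ->
  measurable (S : set (caratheodory_type (@hausdorff_outer R n s))).
Proof.
move=> [U [oU ->]]; have hs := @half_space_hausdorff R n s.
apply: measurableI; last exact: open_cara_measurable.
apply: measurableD; first by apply: closed_cara_measurable => //; exact: closed_closure.
by apply: open_cara_measurable => //; exact: open_interior.
Qed.

Lemma frontier_part_disjoint (R : realType) (n : nat) (Omega S : set 'rV[R]_n.+1) :
  open Omega -> relatively_open (frontier Omega) S -> S `&` Omega = set0.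
Proof.
move=> oO [U [_ ->]]; apply/seteqP; split=> // x [[[_ nI] _] Ox]; apply: nI.
by move: oO; rewrite openE => /(_ _ Ox).
Qed.

(** * Bochner L2 spaces *)

Lemma cvg_dist0 (R : realType) (T : Type) (F : set_system T) (FF : Filter F) (f : T -> R) (l : R) :
  `|l - f k| @[k --> F] --> (0 : R) -> f k @[k --> F] --> l.
Proof.
move=> h; apply/cvgrPdist_lt => e e0; move/cvgrPdist_lt : h => /(_ _ e0).
by apply: filterS => k; rewrite sub0r normrN normr_id.
Qed.

(** Two forms occur because convergence is measured in the full norm, given by [b], while the form
    of interest, typically the gradient form, is only dominated by it. *)
Lemma si_cvg_form (R : realType) (V : lmodType R) (S : set V) (a b : V -> V -> R)
  (T : Type) (F : set_system T) (FF : Filter F) (x y : T -> V) (x0 y0 : V) :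
  semi_inner S a -> semi_inner S b -> (forall u, S u -> a u u <= b u u) ->
  (forall k, S (x k)) -> (forall k, S (y k)) -> S x0 -> S y0 ->
  si_norm b (x k - x0) @[k --> F] --> (0 : R) -> si_norm b (y k - y0) @[k --> F] --> (0 : R) ->
  a (x k) (y k) @[k --> F] --> a x0 y0.
Proof.
move=> ha hb ab Sx Sy S0 Sy0 cx cy.
have nle u : S u -> si_norm a u <= si_norm b u.
  by move=> Su; apply: ler_wsqrtr; exact: ab.
apply: cvg_dist0.
have L : si_norm b (x k - x0) * (si_norm b (y k - y0) + si_norm b y0) +
    si_norm b x0 * si_norm b (y k - y0) @[k --> F] --> 0.
  have c1 : si_norm b (x k - x0) * (si_norm b (y k - y0) + si_norm b y0) @[k --> F]
      --> 0 * (0 + si_norm b y0).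
    by apply: cvgM => //; apply: cvgD => //; exact: cvg_cst.
  have c2 : si_norm b x0 * si_norm b (y k - y0) @[k --> F] --> si_norm b x0 * 0.
    by apply: cvgM => //; exact: cvg_cst.
  rewrite mul0r in c1; rewrite mulr0 in c2.
  by rewrite -[X in _ --> X](addr0 (0 : R)); apply: cvgD.
apply: (squeeze_cvgr _ (cvg_cst 0) L); apply: nearW => k; rewrite normr_ge0 /=.
have Sxx := si_memB hb (Sx k) S0; have Syy := si_memB hb (Sy k) Sy0.
have -> : a x0 y0 - a (x k) (y k) = - (a (x k - x0) (y k) + a x0 (y k - y0)).
  by rewrite (si_Bl ha)// (si_Br ha)//; ring.
rewrite normrN; apply: (le_trans (ler_normD _ _)); apply: lerD.
  apply: (le_trans (si_cs ha Sxx (Sy k))); apply: ler_pM; rewrite ?si_norm_ge0 ?nle//.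
  apply: (le_trans (nle _ (Sy k))).
  by have := si_normD hb Syy Sy0; rewrite subrK.
by apply: (le_trans (si_cs ha S0 Syy)); apply: ler_pM; rewrite ?si_norm_ge0 ?nle.
Qed.

Section bochner_theory.
Context (R : realType) (E : nspace R) (b : E -> E -> R).
Hypotheses (hb : semi_inner (nmem E) b)
  (hn : forall u, nmem E u -> nnorm E u = si_norm b u).
Local Notation mu := (@lebesgue_measure R).
Local Notation I01 := (`]0%R, 1%R[%classic : set R).
Implicit Types (v w : R -> E) (f g : seq (set R * E)).

Lemma nnorm_cvg0 (T : Type) (F : set_system T) (u : T -> E) : (forall k, nmem E (u k)) ->
  (nnorm E (u k) @[k --> F] --> (0 : R)) = (si_norm b (u k) @[k --> F] --> (0 : R)).
Proof.
by move=> mu; rewrite (_ : (fun k => nnorm E (u k)) = (fun k => si_norm b (u k)))//;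
  apply/funext => k; exact: hn.
Qed.

Definition pmem v := forall s, 0 < s < 1 -> nmem E (v s).

Lemma I01P (s : R) : I01 s <-> 0 < s < 1.
Proof. by rewrite /= in_itv. Qed.

Lemma simple_wf_cons p f : simple_wf (p :: f) <->
  (measurable (p.1 : set (measurableTypeR R)) /\ nmem E p.2) /\ simple_wf f.
Proof.
split=> [h|[h1 h2] q].
  by split=> [|q qf]; apply: h; rewrite inE ?eqxx// qf orbT.
by rewrite inE => /orP[/eqP ->//|/h2].
Qed.

Lemma simple_wf_cat f g : simple_wf f -> simple_wf g -> simple_wf (f ++ g).
Proof. by move=> hf hg p; rewrite mem_cat => /orP[/hf|/hg]. Qed.

Lemma simple_fun_nil s : simple_fun (E := E) [::] s = 0.
Proof. by rewrite /simple_fun big_nil. Qed.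

Lemma simple_fun_cons p f s : simple_fun (p :: f) s = (\1_(p.1) s : R) *: p.2 + simple_fun f s.
Proof. by rewrite /simple_fun big_cons. Qed.

Lemma simple_fun_cat f g s : simple_fun (f ++ g) s = simple_fun f s + simple_fun g s.
Proof. by rewrite /simple_fun big_cat. Qed.

Lemma simple_int_cat f g : simple_int (f ++ g) = simple_int f + simple_int g.
Proof. by rewrite /simple_int big_cat. Qed.

Lemma simple_fun_mem f s : simple_wf f -> nmem E (simple_fun f s).
Proof.
elim: f => [_|p f IH /simple_wf_cons[[_ h1] /IH h2]].
  by rewrite simple_fun_nil; exact: (si_mem0 hb).
by rewrite simple_fun_cons; exact: (si_lin hb).
Qed.

Lemma simple_int_mem f : simple_wf f -> nmem E (simple_int f).
Proof.
rewrite /simple_int; elim: f => [_|p f IH /simple_wf_cons[[_ h1] /IH h2]].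
  by rewrite big_nil; exact: (si_mem0 hb).
by rewrite big_cons; exact: (si_lin hb).
Qed.

Lemma simple_strongly_measurable f : simple_wf f -> strongly_measurable (simple_fun f).
Proof.
move=> wf; exists (fun=> f); split=> // s _.
rewrite nnorm_cvg0 => [|_]; last by rewrite subrr; exact: (si_mem0 hb).
by rewrite subrr (si_norm0 hb); exact: cvg_cst.
Qed.

Definition simple_scale (c : R) f := [seq (p.1, c *: p.2) | p <- f].

Lemma simple_scale_wf c f : simple_wf f -> simple_wf (simple_scale c f).
Proof.
elim: f => [//|p f IH /simple_wf_cons[[h0 h1] /IH h2]].
by apply/simple_wf_cons; split=> //; split=> //; exact: (si_memZ hb).
Qed.

Lemma simple_fun_scale c f s : simple_fun (simple_scale c f) s = c *: simple_fun f s.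
Proof.
elim: f => [|p f IH]; first by rewrite !simple_fun_nil scaler0.
by rewrite /simple_scale /= !simple_fun_cons /= -/(simple_scale c f) IH scalerDr !scalerA mulrC.
Qed.

Lemma strongly_measurable_lin (c : R) v w : pmem v -> pmem w ->
  strongly_measurable v -> strongly_measurable w ->
  strongly_measurable (fun s => c *: v s + w s).
Proof.
move=> pv pw [f [wf hf]] [g [wg hg]].
exists (fun k => simple_scale c (f k) ++ g k); split.
  by move=> k; apply: simple_wf_cat => //; exact: simple_scale_wf.
move=> s s01.
have mv := pv _ s01; have mw := pw _ s01.
have m1 k : nmem E (simple_fun (f k) s - v s) by apply: (si_memB hb) => //; exact: simple_fun_mem.
have m2 k : nmem E (simple_fun (g k) s - w s) by apply: (si_memB hb) => //; exact: simple_fun_mem.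
have L : `|c| * nnorm E (simple_fun (f k) s - v s) + nnorm E (simple_fun (g k) s - w s)
    @[k --> \oo] --> (0 : R).
  rewrite -[X in _ --> X](addr0 (0 : R)) -{1}(mulr0 `|c|).
  by apply: cvgD; [apply: cvgM; [exact: cvg_cst|exact: hf]|exact: hg].
apply: (squeeze_cvgr _ (cvg_cst 0) L); apply: nearW => k.
have -> : simple_fun (simple_scale c (f k) ++ g k) s - (c *: v s + w s) =
   c *: (simple_fun (f k) s - v s) + (simple_fun (g k) s - w s).
  by rewrite simple_fun_cat simple_fun_scale scalerBr opprD addrACA.
rewrite !hn//; last exact: (si_lin hb).
rewrite si_norm_ge0 /= -(si_normZ hb)//; apply: (si_normD hb) => //; exact: (si_memZ hb).
Qed.

Section form.
Context (a : E -> E -> R) (ha : semi_inner (nmem E) a)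
  (ab : forall u, nmem E u -> a u u <= b u u).

Lemma simple_form_measurable f g : simple_wf f -> simple_wf g ->
  measurable_fun setT (fun s => a (simple_fun f s) (simple_fun g s) : measurableTypeR R).
Proof.
have H u h : nmem E u -> simple_wf h ->
    measurable_fun setT (fun s => a u (simple_fun h s) : measurableTypeR R).
  move=> Su; elim: h => [_|p h IH /simple_wf_cons[[h0 h1] h2]].
    rewrite (_ : (fun s => _) = (fun=> 0)); first exact: measurable_cst.
    by apply/funext => s; rewrite simple_fun_nil (si_0r ha).
  have -> : (fun s => a u (simple_fun (p :: h) s)) =
      (fun s => \1_(p.1) s * a u p.2 + a u (simple_fun h s)).
    apply/funext => s; rewrite simple_fun_cons (si_Dr ha) ?(si_Zr ha)//.
      exact: (si_memZ ha).
    exact: simple_fun_mem.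
  apply: measurable_funD; last exact: IH.
  by apply: measurable_funM; [exact: measurable_indic|exact: measurable_cst].
elim: f => [_ wg|p f IH /simple_wf_cons[[h0 h1] h2] wg].
  rewrite (_ : (fun s => _) = (fun=> 0)); first exact: measurable_cst.
  by apply/funext => s; rewrite simple_fun_nil (si_0l ha)//; exact: simple_fun_mem.
have -> : (fun s => a (simple_fun (p :: f) s) (simple_fun g s)) =
    (fun s => \1_(p.1) s * a p.2 (simple_fun g s) + a (simple_fun f s) (simple_fun g s)).
  by apply/funext => s; rewrite simple_fun_cons (si_linl ha)//; exact: simple_fun_mem.
apply: measurable_funD; last exact: IH.
by apply: measurable_funM; [exact: measurable_indic|exact: H].
Qed.

(** [E] carries no $\sigma$-algebra; measurability of the scalar function is inherited from simple
    functions, along which the form converges pointwise. *)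
Lemma form_measurable v w : pmem v -> pmem w ->
  strongly_measurable v -> strongly_measurable w ->
  measurable_fun I01 (fun s => a (v s) (w s) : measurableTypeR R).
Proof.
move=> pv pw [f [wf hf]] [g [wg hg]].
apply: (@measurable_fun_cvg _ _ _ _
  (fun k s => a (simple_fun (f k) s) (simple_fun (g k) s))).
  by move=> k; apply: measurable_funTS; exact: simple_form_measurable.
move=> s /I01P s01; have mv := pv _ s01; have mw := pw _ s01.
have mf k := simple_fun_mem s (wf k); have mg k := simple_fun_mem s (wg k).
apply: (si_cvg_form _ ha hb ab mf mg mv mw).
  by have := hf _ s01; rewrite nnorm_cvg0// => k; exact: (si_memB hb).
by have := hg _ s01; rewrite nnorm_cvg0// => k; exact: (si_memB hb).
Qed.

Lemma form_le_half (u v : E) : nmem E u -> nmem E v -> `|a u v| <= (b u u + b v v) / 2.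
Proof.
move=> Su Sv; apply: (le_trans (si_cs ha Su Sv)).
have h1 := si_norm_sqr ha Su; have h2 := si_norm_sqr ha Sv.
have := ab Su; have := ab Sv; have := sqr_ge0 (si_norm a u - si_norm a v).
rewrite sqrrB h1 h2; lra.
Qed.

End form.

Lemma BochnerL2_nnorm v s : pmem v -> 0 < s < 1 -> nnorm E (v s) ^+ 2 = b (v s) (v s).
Proof. by move=> pv s01; rewrite hn; [exact: (si_norm_sqr hb (pv _ s01))|exact: pv]. Qed.

Lemma b_le u : nmem E u -> b u u <= b u u. Proof. by []. Qed.

Lemma diff_strongly_measurable f v : simple_wf f -> pmem v -> strongly_measurable v ->
  strongly_measurable (fun s => simple_fun f s - v s).
Proof.
move=> wf pv sv.
have -> : (fun s => simple_fun f s - v s) = (fun s => (-1) *: v s + simple_fun f s).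
  by apply/funext => s; rewrite scaleN1r addrC.
apply: strongly_measurable_lin => //; first by move=> s _; exact: simple_fun_mem.
exact: simple_strongly_measurable.
Qed.

Lemma diff_pmem f v : simple_wf f -> pmem v -> pmem (fun s => simple_fun f s - v s).
Proof. by move=> wf pv s s01; apply: (si_memB hb); [exact: simple_fun_mem|exact: pv]. Qed.

Lemma nnorm_diff_measurable f v : simple_wf f -> pmem v -> strongly_measurable v ->
  measurable_fun I01 (fun s => nnorm E (simple_fun f s - v s) : measurableTypeR R).
Proof.
move=> wf pv sv; have pd := diff_pmem wf pv.
apply: (eq_measurable_fun (fun s => si_norm b (simple_fun f s - v s))).
  by move=> s /set_mem/I01P s01; rewrite hn//; exact: pd.
rewrite /si_norm; apply: measurableT_comp.
  by apply: continuous_measurable_fun; exact: sqrt_continuous.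
by apply: (form_measurable hb b_le) => //; exact: diff_strongly_measurable.
Qed.

Lemma BochnerL2P v : nmem (BochnerL2 E) v <->
  [/\ pmem v, strongly_measurable v &
    mu.-integrable I01 (EFin \o (fun s => b (v s) (v s)))].
Proof.
split=> -[pv sv h]; split=> //.
  apply/integrableP; split.
    by apply/measurable_EFinP; exact: (form_measurable hb b_le).
  apply: le_lt_trans h; rewrite le_eqVlt; apply/orP; left; apply/eqP.
  apply: eq_integral => s /set_mem/I01P s01 /=.
  by rewrite BochnerL2_nnorm// ger0_norm//; apply: (si_ge0 hb); exact: pv.
have /integrableP[_] := h; apply: le_lt_trans; rewrite le_eqVlt; apply/orP; left; apply/eqP.
apply: eq_integral => s /set_mem/I01P s01 /=.
by rewrite BochnerL2_nnorm// ger0_norm//; apply: (si_ge0 hb); exact: pv.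
Qed.

Section weighted_form.
Context (a : E -> E -> R) (ha : semi_inner (nmem E) a)
  (ab : forall u, nmem E u -> a u u <= b u u).
Context (rho : R -> R) (mrho : measurable_fun I01 (rho : measurableTypeR R -> R))
  (M : R) (rhoM : forall s, 0 < s < 1 -> `|rho s| <= M).

(** For [a = b] and [rho = 1] this is the inner product of $L^2(0,1;E)$; for the gradient form and
    an affine weight it is a history term of the Lyapunov functional. *)
Definition wform v w : R := \int[mu]_(s in I01) (rho s * a (v s) (w s)).

Lemma wform_integrable v w : nmem (BochnerL2 E) v -> nmem (BochnerL2 E) w ->
  mu.-integrable I01 (EFin \o (fun s => rho s * a (v s) (w s))).
Proof.
move=> /BochnerL2P[pv sv iv] /BochnerL2P[pw sw iw].
have mI : measurable (I01 : set (measurableTypeR R)) by exact: measurable_itv.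
apply: (le_integrable mI _ _ (integrableZl mI (M / 2) (integrableD mI iv iw))).
  apply/measurable_EFinP; apply: measurable_funM => //.
  exact: (form_measurable ha ab).
move=> s /I01P s01 /=; rewrite lee_fin normrM.
have vv := si_ge0 hb (pv _ s01); have ww := si_ge0 hb (pw _ s01).
have M0 : 0 <= M by apply: le_trans (rhoM s01).
rewrite [leRHS]ger0_norm; last by rewrite mulr_ge0 ?addr_ge0// divr_ge0.
rewrite -mulrA [_^-1 * _]mulrC; apply: ler_pM => //; first exact: rhoM.
by apply: (form_le_half ha ab); [exact: pv|exact: pw].
Qed.

End weighted_form.

Lemma BochnerL2_lin (c : R) v w : nmem (BochnerL2 E) v -> nmem (BochnerL2 E) w ->
  nmem (BochnerL2 E) (c *: v + w).
Proof.
move=> hv hw; have [pv sv iv] := (BochnerL2P v).1 hv; have [pw sw iw] := (BochnerL2P w).1 hw.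
apply/BochnerL2P.
have pvw : pmem (c *: v + w).
  by move=> s s01; apply: (si_lin hb); [exact: pv|exact: pw].
have svw : strongly_measurable (c *: v + w) by exact: strongly_measurable_lin.
split=> //.
have mI : measurable (I01 : set (measurableTypeR R)) by exact: measurable_itv.
apply: (le_integrable mI _ _ (integrableZl mI 2 (integrableD mI (integrableZl mI (c ^+ 2) iv) iw))).
  by apply/measurable_EFinP; exact: (form_measurable hb b_le).
move=> s /I01P s01 /=; rewrite lee_fin.
have mv := pv _ s01; have mw := pw _ s01; have mcv := si_memZ hb c mv.
rewrite !ger0_norm.
- have := si_sqrD_le hb mcv mw; rewrite (si_Zl hb)// (si_Zr hb)// mulrA -expr2.
  by rewrite -[(c *: v + w) s]/(c *: v s + w s); lra.
- apply: mulr_ge0 => //; apply: addr_ge0; last exact: (si_ge0 hb).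
  by apply: mulr_ge0; [exact: sqr_ge0|exact: (si_ge0 hb)].
- by apply: (si_ge0 hb); exact: pvw.
Qed.

Lemma BochnerL2_0 : nmem (BochnerL2 E) 0.
Proof.
have m0 := si_mem0 hb.
apply/BochnerL2P; split; first by move=> s _.
  exists (fun=> [::]); split=> // s _.
  by under eq_cvg do rewrite simple_fun_nil subrr hn// (si_norm0 hb); exact: cvg_cst.
have -> : (fun s => b ((0 : BochnerL2 E) s) ((0 : BochnerL2 E) s)) = (fun=> 0).
  by apply/funext => s; rewrite -[X in b X _]/(0 : E) (si_0l hb).
exact: integrable0.
Qed.

Lemma wform_semi_inner (a : E -> E -> R) (rho : R -> R) (M : R) :
  semi_inner (nmem E) a -> (forall u, nmem E u -> a u u <= b u u) ->
  measurable_fun I01 (rho : measurableTypeR R -> R) ->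
  (forall s, 0 < s < 1 -> 0 <= rho s <= M) ->
  semi_inner (nmem (BochnerL2 E)) (wform a rho).
Proof.
move=> ha ab mrho rhoM.
have rM s : 0 < s < 1 -> `|rho s| <= M.
  by move=> /rhoM/andP[h1 h2]; rewrite ger0_norm.
have mI : measurable (I01 : set (measurableTypeR R)) by exact: measurable_itv.
have int := wform_integrable ha ab mrho rM.
split.
- exact: BochnerL2_lin.
- exact: BochnerL2_0.
- move=> u v [pu _ _] [pv _ _]; apply: eq_Rintegral => s /set_mem/I01P s01.
  by congr (_ * _); exact: (si_sym ha (pu _ s01) (pv _ s01)).
- move=> c u v w hu hv hw; rewrite /wform -RintegralZl//; last exact: int.
  rewrite -RintegralD//; last 2 first.
  + exact: (integrableZl mI c (int _ _ hu hw)).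
  + exact: int.
  have [[pu _ _] [pv _ _] [pw _ _]] := And3 hu hv hw.
  apply: eq_Rintegral => s /set_mem/I01P s01.
  rewrite -[(c *: u + v) s]/(c *: u s + v s).
  rewrite (si_linl ha c (pu _ s01) (pv _ s01) (pw _ s01)); ring.
- move=> u [pu _ _]; apply: Rintegral_ge0 => s /I01P s01.
  by have /andP[h1 _] := rhoM _ s01; rewrite mulr_ge0//; apply: (si_ge0 ha); exact: pu.
Qed.

Lemma BochnerL2_norm v : nmem (BochnerL2 E) v ->
  nnorm (BochnerL2 E) v = si_norm (wform b (fun=> 1)) v.
Proof.
move=> [pv _ _]; rewrite /si_norm /= /wform; congr Num.sqrt.
by apply: eq_Rintegral => s /set_mem/I01P s01; rewrite BochnerL2_nnorm// mul1r.
Qed.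

(** Both sides are limits of $a(\cdot,h)$ at the integrals of the same simple functions. Since [a]
    is dominated by [b], it does not matter that [J] is determined only up to a null vector. *)
Lemma bochner_int_pairing (a : E -> E -> R) v (J h : E) :
  semi_inner (nmem E) a -> (forall u, nmem E u -> a u u <= b u u) ->
  pmem v -> is_bochner_int v J -> nmem E h ->
  mu.-integrable I01 (EFin \o (fun s => a (v s) h)) ->
  \int[mu]_(s in I01) a (v s) h = a J h.
Proof.
move=> ha ab pv [mJ sv [f [wf L1 L2]]] mh iv.
have mI : measurable (I01 : set (measurableTypeR R)) by exact: measurable_itv.
have muI : (mu I01 < +oo)%E by rewrite lebesgue_measure_itv /= lte_fin ltr01 -EFinB ltry.
have simple_pair g : simple_wf g -> mu.-integrable I01 (EFin \o (fun s => a (simple_fun g s) h)) /\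
    \int[mu]_(s in I01) a (simple_fun g s) h = a (simple_int g) h.
  elim: g => [_|p g IH /simple_wf_cons[[m1 m2] wg]].
    rewrite /simple_int big_nil (si_0l ha)//.
    have -> : (fun s => a (simple_fun [::] s) h) = (fun=> 0).
      by apply/funext => s; rewrite simple_fun_nil (si_0l ha).
    by split; [exact: integrable0|rewrite /Rintegral integral0].
  have [i2 e2] := IH wg.
  have Eq : (fun s => a (simple_fun (p :: g) s) h) =
     (fun s => a p.2 h * \1_(p.1) s + a (simple_fun g s) h).
    apply/funext => s; rewrite simple_fun_cons (si_linl ha)// 1?mulrC//; exact: simple_fun_mem.
  have i0 : mu.-integrable I01 (EFin \o (\1_(p.1) : R -> R)).
    apply: (measurable_bounded_integrable mI muI); first exact: measurable_indic.
    exists 1; split=> // M' M1 s _; rewrite /= indicE.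
    by case: (_ \in _); rewrite ?normr1 ?normr0 ltW// (lt_trans ltr01).
  have i1 : mu.-integrable I01 (EFin \o (fun s => a p.2 h * \1_(p.1) s)).
    exact: (integrableZl mI (a p.2 h) i0).
  rewrite Eq; split; first exact: (integrableD mI i1 i2).
  rewrite RintegralD// e2 RintegralZl// /simple_int big_cons (si_linl ha)//; last exact: simple_int_mem.
  by congr (_ + _); rewrite mulrC; congr (_ * _); rewrite /Rintegral integral_indic.
have mfv k s : 0 < s < 1 -> nmem E (simple_fun (f k) s - v s).
  by move=> s01; apply: (si_memB hb); [exact: simple_fun_mem|exact: pv].
have nle u : nmem E u -> si_norm a u <= si_norm b u.
  by move=> Su; apply: ler_wsqrtr; exact: ab.
have c1 : a (simple_int (f k)) h @[k --> \oo] --> a J h.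
  apply: (si_cvg_form (y := fun=> h) _ ha hb ab) => //.
  - by move=> k; exact: simple_int_mem.
  - by move: L2; rewrite nnorm_cvg0// => k; apply: (si_memB hb) => //; exact: simple_int_mem.
  - by rewrite subrr (si_norm0 hb); exact: cvg_cst.
have c2 : a (simple_int (f k)) h @[k --> \oo] --> \int[mu]_(s in I01) a (v s) h.
  apply: cvg_dist0.
  have L : fine ((si_norm b h)%:E * \int[mu]_(s in I01) (nnorm E (simple_fun (f k) s - v s))%:E)%E
      @[k --> \oo] --> (0 : R).
    apply: fine_cvg; have := cvgeZl (y := (si_norm b h)%:E) _ L1.
    by rewrite mule0; apply.
  have fin : \forall k \near \oo, (\int[mu]_(s in I01) (nnorm E (simple_fun (f k) s - v s))%:E)%E \is a fin_num.
    by have /fine_cvgP[] := L1.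
  apply: (squeeze_cvgr _ (cvg_cst 0) L); near=> k; rewrite normr_ge0 /=.
  have fk : (\int[mu]_(s in I01) (nnorm E (simple_fun (f k) s - v s))%:E)%E \is a fin_num by near: k.
  have [i2 <-] := simple_pair _ (wf k).
  rewrite -RintegralB//.
  rewrite fineM// -[fine (si_norm b h)%:E]/(si_norm b h).
  have mnf := nnorm_diff_measurable (wf k) pv sv.
  have inf : mu.-integrable I01 (EFin \o (fun s => nnorm E (simple_fun (f k) s - v s))).
    apply/integrableP; split; first exact/measurable_EFinP.
    have fk' : (\int[mu]_(s in I01) (nnorm E (simple_fun (f k) s - v s))%:E < +oo)%E.
      rewrite -ge0_fin_numE//; apply: integral_ge0 => s /I01P s01.
      by rewrite lee_fin hn ?si_norm_ge0//; exact: mfv.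
    apply: le_lt_trans fk'; rewrite le_eqVlt; apply/orP; left; apply/eqP.
    apply: eq_integral => s /set_mem/I01P s01 /=.
    by rewrite ger0_norm// hn ?si_norm_ge0//; exact: mfv.
  apply: (le_trans (le_normr_Rintegral mI (integrableB mI iv i2))).
  rewrite -[X in _ <= _ * X]/(\int[mu]_(s in I01) (nnorm E (simple_fun (f k) s - v s))).
  rewrite -RintegralZl//.
  apply: le_Rintegral => //.
  - exact: (integrable_norm (integrableB mI iv i2)).
  - exact: (integrableZl mI (si_norm b h) inf).
  move=> s /I01P s01; have Sf := simple_fun_mem s (wf k); have Sv := pv _ s01.
  rewrite distrC -(si_Bl ha)//.
  apply: (le_trans (si_cs ha (mfv k s s01) mh)); rewrite mulrC hn; last exact: mfv.
  by apply: ler_pM; rewrite ?si_norm_ge0//; apply: nle => //; exact: mfv.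
by rewrite -(cvg_lim _ c1)// -(cvg_lim _ c2).
Unshelve. all: by end_near. Qed.

End bochner_theory.

(** * The unit interval *)

Section unit_interval.
Import HBNNSimple.
Context (R : realType).
Local Notation mu := (@lebesgue_measure R).
Local Notation I01 := (`]0%R, 1%R[%classic : set R).
Implicit Types (f g rho phi : R -> R) (s : R).

Lemma I01_measurable : measurable (I01 : set (measurableTypeR R)).
Proof. exact: measurable_itv. Qed.

Lemma I01_lty : (mu I01 < +oo)%E.
Proof. by rewrite lebesgue_measure_itv /= lte_fin ltr01 -EFinB ltry. Qed.

Lemma continuous_add f g : continuous f -> continuous g -> continuous (fun s => f s + g s).
Proof. by move=> cf cg s; exact: (continuousD (cf s) (cg s)). Qed.

Lemma continuous_mul f g : continuous f -> continuous g -> continuous (fun s => f s * g s).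
Proof. by move=> cf cg s; exact: (continuousM (cf s) (cg s)). Qed.

Lemma continuous_cst (c : R) : continuous (fun _ : R => c).
Proof. exact: cst_continuous. Qed.

Lemma continuous_integrable_seg (x y : R) f : continuous f ->
  mu.-integrable `[x, y]%classic (EFin \o f).
Proof.
move=> cf; apply: continuous_compact_integrable; first exact: segment_compact.
exact: continuous_subspaceT.
Qed.

Lemma continuous_integrable01 f : continuous f -> mu.-integrable I01 (EFin \o f).
Proof.
move=> cf; apply: (integrableS _ _ _ (@continuous_integrable_seg 0 1 f cf)) => //.
by move=> s /=; rewrite !in_itv /= => /andP[h1 h2]; rewrite !ltW.
Qed.

Lemma continuous_measurable01 f : continuous f ->
  measurable_fun I01 (f : measurableTypeR R -> R).
Proof. by move=> cf; apply: measurable_funTS; exact: continuous_measurable_fun. Qed.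

Lemma continuous_bounded01 f : continuous f ->
  exists2 M : R, 0 <= M & forall s, 0 <= s <= 1 -> `|f s| <= M.
Proof.
move=> cf; have : compact (f @` `[0, 1]%classic).
  by apply: continuous_compact; [exact: continuous_subspaceT|exact: segment_compact].
move=> /compact_bounded[M [_ hM]]; exists (`|M| + 1); first by rewrite addr_ge0.
have M1 : M < `|M| + 1 by have := ler_norm M; lra.
by move=> s hs; apply: (hM _ M1); exists s => //=; rewrite in_itv.
Qed.

Definition C1 f := (forall s, derivable f s 1) /\ continuous (derive1 f).

Lemma derivable_continuous f : (forall s, derivable f s 1) -> continuous f.
Proof.
by move=> df s; apply: differentiable_continuous; apply/derivable1_diffP.
Qed.

Lemma C1_continuous f : C1 f -> continuous f.
Proof. by move=> [df _]; exact: derivable_continuous. Qed.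

Lemma C1_intro f g : (forall s, is_derive s 1 f (g s)) -> continuous g -> C1 f.
Proof.
by move=> h cg; split; [move=> s; have [] := h s|rewrite (is_derive_fun h)].
Qed.

Lemma C1_lin (c : R) f g : C1 f -> C1 g -> C1 (fun s => c * f s + g s).
Proof.
move=> [df cf] [dg cg]; apply: (@C1_intro _ (fun s => c * derive1 f s + derive1 g s)).
  move=> s; apply: is_deriveD; last exact: derivable_is_derive1.
  by have := is_deriveZ c (derivable_is_derive1 (df s)).
exact: (continuous_add (continuous_mul (@continuous_cst c) cf) cg).
Qed.

Lemma C1M f g : C1 f -> C1 g -> C1 (fun s => f s * g s).
Proof.
move=> hf hg; have [df cf] := hf; have [dg cg] := hg.
apply: (@C1_intro _ (fun s => f s * derive1 g s + g s * derive1 f s)).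
  by move=> s; apply: is_deriveM; apply: derivable_is_derive1.
exact: (continuous_add (continuous_mul (C1_continuous hf) cg)
  (continuous_mul (C1_continuous hg) cf)).
Qed.

Lemma C1_cst (c : R) : C1 (fun=> c).
Proof.
by apply: (@C1_intro _ (fun=> 0)); exact: continuous_cst.
Qed.

Lemma C1_affine (a b : R) : C1 (fun s => a * s + b).
Proof.
by apply: (@C1_intro _ (fun=> a)); [move=> s; exact: is_derive_affine|exact: continuous_cst].
Qed.

Lemma C1X f k : C1 f -> C1 (fun s => f s ^+ k).
Proof.
move=> hf; elim: k => [|k IH].
  by have := C1_cst 1; congr C1; apply/funext => s; rewrite expr0.
by have := C1M hf IH; congr C1; apply/funext => s; rewrite exprS.
Qed.

Lemma smooth1_C1 f : smooth1 f -> C1 f.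
Proof.
move=> sf; split; first by move=> s; exact: smooth1_derivable.
by apply: smooth1_continuous; exact: smooth1_derive.
Qed.

Lemma test01_C1 phi : test01 phi -> C1 phi.
Proof.
move=> [dphi _]; split; first by move=> s; have := dphi 0%N s; rewrite derive1n0.
by apply: derivable_continuous => s; have := dphi 1%N s; rewrite derive1n1.
Qed.

Lemma test01_out phi s : test01 phi -> ~ (0 < s < 1) -> phi s = 0.
Proof.
move=> [_ h] ns; apply: contrapT => /eqP hs; apply: ns.
have : closure [set s | phi s != 0] s by exact: subset_closure.
by move=> /h; rewrite /= in_itv.
Qed.

Lemma Rintegral_oo_cc (x y : R) f : mu.-integrable `[x, y]%classic (EFin \o f) ->
  \int[mu]_(s in `]x, y[) f s = \int[mu]_(s in `[x, y]) f s.
Proof.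
move=> intf; symmetry; rewrite /Rintegral; congr fine; apply: integral_itv_bndoo.
apply: (measurable_funS (E := `[x, y]%classic)) => //.
- exact: subset_itv_oo_cc.
- by have /integrableP[] := intf.
Qed.

Lemma ibp01 phi rho : C1 phi -> C1 rho -> phi 0 = 0 -> phi 1 = 0 ->
  \int[mu]_(s in I01) (derive1 phi s * rho s) = - \int[mu]_(s in I01) (phi s * derive1 rho s).
Proof.
move=> hp hr p0 p1; have [dp cp] := hp; have [dr cr] := hr.
have cphi := C1_continuous hp; have crho := C1_continuous hr.
have c1 : continuous (fun s => derive1 phi s * rho s).
  exact: (continuous_mul cp crho).
have c2 : continuous (fun s => phi s * derive1 rho s).
  exact: (continuous_mul cphi cr).
rewrite !Rintegral_oo_cc; try exact: continuous_integrable_seg.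
have LR f : continuous f -> (forall s, derivable f s 1) -> derivable_oo_LRcontinuous f 0 1.
  by move=> cf df; split; [move=> s _; exact: df|apply: cvg_at_right_filter; exact: cf|
    apply: cvg_at_left_filter; exact: cf].
rewrite (Rintegration_by_parts (F := phi) (f := derive1 phi) (G := rho) (g := derive1 rho) ltr01
  (continuous_subspaceT cp) (LR _ cphi dp) (fun s _ => erefl)
  (continuous_subspaceT cr) (LR _ crho dr) (fun s _ => erefl)).
by rewrite p0 p1 !mul0r subrr sub0r opprK.
Qed.

Lemma indic_integrable01 (A : set R) : measurable (A : set (measurableTypeR R)) ->
  mu.-integrable I01 (EFin \o (\1_A : R -> R)).
Proof.
move=> mA; apply: (measurable_bounded_integrable I01_measurable I01_lty).
  exact: measurable_indic.
exists 1; split=> // M' M1 s _; rewrite /= indicE.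
by case: (_ \in _); rewrite ?normr1 ?normr0 ltW// (lt_trans ltr01).
Qed.

Lemma scalar_list_integral (L : seq (set R * R)) :
  (forall p, p \in L -> measurable (p.1 : set (measurableTypeR R))) ->
  mu.-integrable I01 (EFin \o (fun s => \sum_(p <- L) \1_(p.1) s * p.2)) /\
  \int[mu]_(s in I01) (\sum_(p <- L) \1_(p.1) s * p.2) =
  \sum_(p <- L) fine (mu (p.1 `&` I01)) * p.2.
Proof.
have mI := I01_measurable.
elim: L => [_|p L IH h].
  rewrite big_nil (_ : (fun s => _) = (fun=> 0)); last by apply/funext => s; rewrite big_nil.
  by split; [exact: integrable0|rewrite /Rintegral integral0].
have hL q : q \in L -> measurable (q.1 : set (measurableTypeR R)).
  by move=> qL; apply: h; rewrite inE qL orbT.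
have [i2 e2] := IH hL.
have mp : measurable (p.1 : set (measurableTypeR R)) by apply: h; rewrite inE eqxx.
have i1 : mu.-integrable I01 (EFin \o (fun s => p.2 * \1_(p.1) s)).
  exact: (integrableZl mI p.2 (indic_integrable01 mp)).
rewrite (_ : (fun s => _) = (fun s => p.2 * \1_(p.1) s + \sum_(q <- L) \1_(q.1) s * q.2)); last first.
  by apply/funext => s; rewrite big_cons mulrC.
split; first exact: (integrableD mI i1 i2).
rewrite RintegralD// e2 RintegralZl//; last exact: indic_integrable01.
rewrite big_cons mulrC; congr (_ * _ + _).
by rewrite /Rintegral integral_indic.
Qed.

(** Positive and negative parts are approximated from below, which gives the domination by $|\rho|$.
    The approximants are lists because multiplying their values by a vector turns them into
    [E]-valued simple functions. *)
Lemma scalar_list_approx rho : measurable_fun I01 (rho : measurableTypeR R -> R) ->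
  exists L : nat -> seq (set R * R),
    (forall k p, p \in L k -> measurable (p.1 : set (measurableTypeR R))) /\
    (forall s, 0 < s < 1 ->
      (\sum_(p <- L k) \1_(p.1) s * p.2 @[k --> \oo] --> rho s) /\
      forall k, `|\sum_(p <- L k) \1_(p.1) s * p.2| <= `|rho s|).
Proof.
move=> mrho.
pose fs (g : {nnsfun (measurableTypeR R) >-> R}) (c : R) : seq (set R * R) :=
  [seq (g @^-1` [set y], c * y) | y <- finmap.enum_fset (fset_set (range g))].
have fsE (g : {nnsfun (measurableTypeR R) >-> R}) (c : R) s : \sum_(p <- fs g c) \1_(p.1) s * p.2 = c * g s.
  rewrite big_map /= (fimfunE g s) fsbig_finite//= mulr_sumr.
  by apply: eq_bigr => y _; ring.
pose rp : R -> R := rho^\+; pose rn : R -> R := rho^\-.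
have mp : measurable_fun I01 (rp : measurableTypeR R -> R) by exact: measurable_funrpos.
have mn : measurable_fun I01 (rn : measurableTypeR R -> R) by exact: measurable_funrneg.
have mEp : measurable_fun I01 (EFin \o rp) by exact/measurable_EFinP.
have mEn : measurable_fun I01 (EFin \o rn) by exact/measurable_EFinP.
have p0 (s : measurableTypeR R) : I01 s -> (0 <= (EFin \o rp) s)%E by move=> _; rewrite lee_fin; exact: funrpos_ge0.
have n0 (s : measurableTypeR R) : I01 s -> (0 <= (EFin \o rn) s)%E by move=> _; rewrite lee_fin; exact: funrneg_ge0.
pose P := nnsfun_approx I01_measurable mEp; pose N := nnsfun_approx I01_measurable mEn.
exists (fun k => fs (P k) 1 ++ fs (N k) (-1)); split.
  move=> k p; rewrite mem_cat => /orP[|] /mapP[y _ ->]; exact: measurable_sfunP.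
move=> s s01; have Is : I01 s by rewrite /= in_itv.
have E k : \sum_(p <- fs (P k) 1 ++ fs (N k) (-1)) \1_(p.1) s * p.2 = P k s - N k s.
  by rewrite big_cat /= !fsE mul1r mulN1r.
have rE : rho s = rp s - rn s.
  rewrite /rp /rn /funrpos /funrneg; have [h|h] := leP 0 (rho s).
    by rewrite max_r ?oppr_le0// subr0.
  by rewrite max_l ?oppr_ge0 1?ltW// opprK add0r.
split.
  rewrite rE (_ : (fun k => _) = (fun k => P k s - N k s)); last by apply/funext => k; exact: E.
  apply: cvgB.
    by have := cvg_nnsfun_approx I01_measurable mEp p0 Is => /fine_cvgP[_].
  by have := cvg_nnsfun_approx I01_measurable mEn n0 Is => /fine_cvgP[_].
move=> k; rewrite E.
have hP : 0 <= P k s <= rp s.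
  rewrite fun_ge0 /=.
  by have := le_approx k p0 Is; rewrite -(nnsfun_approxE I01_measurable mEp) lee_fin.
have hN : 0 <= N k s <= rn s.
  rewrite fun_ge0 /=.
  by have := le_approx k n0 Is; rewrite -(nnsfun_approxE I01_measurable mEn) lee_fin.
move: hP hN; rewrite /rp /rn /funrpos /funrneg ler_norml; have [h|h] := leP 0 (rho s).
  rewrite (ger0_norm h) max_r ?oppr_le0// => /andP[? ?] /andP[? ?]; apply/andP; split; lra.
rewrite (ltr0_norm h) max_l; last by rewrite oppr_ge0 ltW.
move=> /andP[? ?] /andP[? ?]; apply/andP; split; lra.
Qed.

(** The $\pi$-system consists of the open intervals and the whole line; the indicator of $]x,y[$ is
    the limit of $1-(1-\beta)^k$ with $\beta$ the smooth bump on that interval. *)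
Lemma C1_dense f (e : R) : sqint mu I01 f -> 0 < e ->
  exists2 rho, C1 rho & Rdot mu I01 (fun s => f s - rho s) (fun s => f s - rho s) < e.
Proof.
move=> sf; move: e.
pose G : set (set (measurableTypeR R)) := [set A | A = setT \/ exists x y, A = `]x, y[%classic].
have sqC1 g : C1 g -> sqint mu I01 g.
  move=> hg; have cg := C1_continuous hg; apply: sqintP; first exact: continuous_measurable01.
  by apply: continuous_integrable01; exact: continuous_mul.
apply: (@approximable_sqint _ _ _ mu I01 I01_measurable I01_lty C1 _ _ _ G).
- exact: C1_lin.
- exact: C1_cst.
- exact: sqC1.
- move=> A B [->|[x [y ->]]]; first by rewrite setTI.
  move=> [->|[x' [y' ->]]]; first by rewrite setIT; right; exists x, y.
  right; exists (Num.max x x'), (Num.min y y').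
  apply/seteqP; split=> s /=; rewrite !in_itv /= gt_max lt_min.
    by move=> [/andP[-> ->] /andP[-> ->]].
  by move=> /andP[/andP[-> ->] /andP[-> ->]].
- by left.
- by move=> A [->|[x [y ->]]]; [exact: measurableT|exact: measurable_itv].
- move=> A [->|[x [y ->]]].
    by rewrite indicT; apply: approximable_C; [exact: I01_measurable|exact: C1_cst].
  have sb k : smooth1 (fun s => 1 - (1 - bump x y s) ^+ k).
    have sB g : smooth1 g -> smooth1 (fun s => 1 - g s).
      move=> sg j; have := DkD (Dk_cst j 1) (DkM (Dk_cst j (-1)) (sg j)).
      by congr Dk; apply/funext => s; rewrite mulN1r.
    apply: (sB (fun s => (1 - bump x y s) ^+ k)); elim: k => [|k IH].
      by move=> j; have := Dk_cst j (1 : R); congr Dk; apply/funext => s; rewrite expr0.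
    move=> j; have := DkM (sB _ (@bump_smooth _ x y) j) (IH j).
    by congr Dk; apply/funext => s; rewrite exprS.
  apply: (@approximable_dct _ _ _ _ _ I01_measurable _ sqC1
    (fun k s => 1 - (1 - bump x y s) ^+ k) _ (fun=> 1)).
  + by move=> k; apply: continuous_measurable01; exact: smooth1_continuous.
  + move=> s _; have /andP[b0 b1] : 0 <= bump x y s <= 1 by rewrite bump_ge0 bump_le1.
    rewrite indicE; have [/set_mem/=|/negP ns] := boolP (_ \in _).
      rewrite in_itv /= => /bump_gt0 bp; rewrite -[X in _ --> X](subr0 (1 : R)).
      apply: cvgB; first exact: cvg_cst.
      by apply: cvg_expr; rewrite ger0_norm; lra.
    apply: cvg_near_cst; apply: nearW => k.
    have -> : bump x y s = 0.
      apply/eqP; apply: contraPT isT => h _; apply: ns; apply: mem_set => /=.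
      by rewrite in_itv /= -bump_neq0.
    by rewrite subr0 expr1n subrr.
  + move=> k s _; have /andP[b0 b1] : 0 <= bump x y s <= 1 by rewrite bump_ge0 bump_le1.
    have h0 : 0 <= (1 - bump x y s) ^+ k by rewrite exprn_ge0// subr_ge0.
    have h1 : (1 - bump x y s) ^+ k <= 1 by rewrite exprn_ile1// ?subr_ge0// gerBl.
    by rewrite ger0_norm; lra.
  + exact/sqC1/C1_cst.
  + by move=> k; apply: approximable_C; [exact: I01_measurable|exact: smooth1_C1].
(* Measurable sets of the line are generated by open intervals, so the set itself serves as its own
   approximation. *)
- move=> A e mA e0; exists A.
    have sub : (@RGenOpens.G R) `<=` G by move=> B [x [y ->]]; right; exists x, y.
    have := mA; rewrite [in X in X -> _](RGenOpens.measurableE R).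
    exact: (sub_smallest2r _ sub).
  by rewrite setDv setU0 setI0 measure0 lte_fin.
- exact: sf.
Qed.

End unit_interval.

(** * Density of C1 functions in the Bochner L2 space *)

Lemma cvg_norm_dist0 (R : realType) (T : Type) (F : set_system T) (FF : Filter F) (f : T -> R) (l c : R) :
  f @ F --> l -> `|f x - l| * c @[x --> F] --> (0 : R).
Proof.
move=> h; rewrite -[X in _ --> X](mul0r c); apply: cvgM; last exact: cvg_cst.
rewrite -[X in _ --> X](normr0 R); apply: cvg_norm.
by rewrite -[X in _ --> X](subrr l); apply: cvgB => //; exact: cvg_cst.
Qed.

Section bochner_density.
Context (R : realType) (E : nspace R) (b : E -> E -> R).
Hypotheses (hb : semi_inner (nmem E) b)
  (hn : forall u, nmem E u -> nnorm E u = si_norm b u).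
Local Notation mu := (@lebesgue_measure R).
Local Notation I01 := (`]0%R, 1%R[%classic : set R).
Local Notation C1 := (@C1 R).
Implicit Types (v w : R -> E) (f : seq (set R * E)) (l : seq ((R -> R) * E)) (u : E) (rho : R -> R).

(** A list of pairs $(\rho,u)$ stands for the finite sum of the functions $\rho(s)u$. For such sums
    derivatives, traces and Bochner integrals are computed term by term. *)
Fixpoint lwf (P : (R -> R) -> Prop) l : Prop :=
  if l is p :: l' then [/\ P p.1, nmem E p.2 & lwf P l'] else True.

Definition lsum l (s : R) : E := \sum_(p <- l) p.1 s *: p.2.

Lemma lwf_cat P l l' : lwf P l -> lwf P l' -> lwf P (l ++ l').
Proof. by elim: l => //= p l IH [h1 h2 /IH h3] /h3. Qed.

Lemma lwf_map (P Q : (R -> R) -> Prop) (F : (R -> R) -> R -> R) l :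
  (forall rho, P rho -> Q (F rho)) -> lwf P l -> lwf Q [seq (F p.1, p.2) | p <- l].
Proof. by move=> PQ; elim: l => //= p l IH [h1 h2 /IH]; split=> //; exact: PQ. Qed.

Lemma lwf_sub (P Q : (R -> R) -> Prop) l : (forall rho, P rho -> Q rho) -> lwf P l -> lwf Q l.
Proof. by move=> PQ; elim: l => //= p l IH [h1 h2 /IH]; split=> //; exact: PQ. Qed.

Lemma lsum_nil s : lsum [::] s = 0. Proof. by rewrite /lsum big_nil. Qed.

Lemma lsum_cons p l s : lsum (p :: l) s = p.1 s *: p.2 + lsum l s.
Proof. by rewrite /lsum big_cons. Qed.

Lemma lsum_cat l l' s : lsum (l ++ l') s = lsum l s + lsum l' s.
Proof. by rewrite /lsum big_cat. Qed.

Lemma lsum_mem P l s : lwf P l -> nmem E (lsum l s).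
Proof.
elim: l => [_|p l IH /= [_ h1 /IH h2]]; first by rewrite lsum_nil; exact: (si_mem0 hb).
by rewrite lsum_cons; exact: (si_lin hb).
Qed.

Lemma bochner_int_add v w (I J : E) : pmem v -> pmem w ->
  is_bochner_int v I -> is_bochner_int w J ->
  is_bochner_int (fun s => v s + w s) (I + J).
Proof.
move=> pv pw [mI sv [f [wf f1 f2]]] [mJ sw [g [wg g1 g2]]].
have svw : strongly_measurable (fun s => v s + w s).
  have := strongly_measurable_lin hb hn 1 pv pw sv sw.
  by congr strongly_measurable; apply/funext => s; rewrite scale1r.
have pvw : pmem (fun s => v s + w s).
  by move=> s s01; apply: (si_memD hb); [exact: pv|exact: pw].
split=> //; first exact: (si_memD hb).
have wfg k : simple_wf (f k ++ g k) by exact: simple_wf_cat.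
exists (fun k => f k ++ g k); split=> //.
  have L : (\int[mu]_(s in I01) (nnorm E (simple_fun (f k) s - v s))%:E +
     \int[mu]_(s in I01) (nnorm E (simple_fun (g k) s - w s))%:E)%E @[k --> \oo] --> 0%E.
    by rewrite -[X in _ --> X](adde0 0%E); apply: cvgeD.
  apply: (squeeze_cvge _ (cvg_cst 0%E) L); apply: nearW => k.
  have dv := diff_pmem hb (wf k) pv; have dw := diff_pmem hb (wg k) pw.
  have mv := nnorm_diff_measurable hb hn (wf k) pv sv.
  have mw := nnorm_diff_measurable hb hn (wg k) pw sw.
  have mvw := nnorm_diff_measurable hb hn (wfg k) pvw svw.
  have dvw := diff_pmem hb (wfg k) pvw.
  apply/andP; split.
    by apply: integral_ge0 => s /I01P s01; rewrite lee_fin hn ?si_norm_ge0//; exact: dvw.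
  have nn0 (h : R -> E) : pmem h -> forall s : measurableTypeR R, I01 s -> (0 <= (nnorm E (h s))%:E)%E.
    by move=> ph s /I01P s01; rewrite lee_fin hn ?si_norm_ge0//; exact: ph.
  rewrite -ge0_integralD//; last 4 first.
  - exact: (nn0 _ dv).
  - exact/measurable_EFinP.
  - exact: (nn0 _ dw).
  - exact/measurable_EFinP.
  apply: ge0_le_integral => //.
  - exact: (nn0 _ dvw).
  - exact/measurable_EFinP.
  - by apply: emeasurable_funD; exact/measurable_EFinP.
  move=> s /I01P s01; rewrite -EFinD lee_fin.
  have -> : simple_fun (f k ++ g k) s - (v s + w s) =
     (simple_fun (f k) s - v s) + (simple_fun (g k) s - w s).
    by rewrite simple_fun_cat opprD addrACA.
  have d1 := dv _ s01; have d2 := dw _ s01.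
  by rewrite !hn//; [exact: (si_normD hb)|exact: (si_memD hb)].
have L : nnorm E (simple_int (f k) - I) + nnorm E (simple_int (g k) - J) @[k --> \oo] --> (0 : R).
  by rewrite -[X in _ --> X](addr0 (0 : R)); apply: cvgD.
apply: (squeeze_cvgr _ (cvg_cst 0) L); apply: nearW => k.
have m1 : nmem E (simple_int (f k) - I) by apply: (si_memB hb) => //; exact: (simple_int_mem hb).
have m2 : nmem E (simple_int (g k) - J) by apply: (si_memB hb) => //; exact: (simple_int_mem hb).
have -> : simple_int (f k ++ g k) - (I + J) = (simple_int (f k) - I) + (simple_int (g k) - J).
  by rewrite simple_int_cat opprD addrACA.
rewrite !hn//; last exact: (si_memD hb).
by rewrite si_norm_ge0 (si_normD hb).
Qed.

(** The same scalar step functions, multiplied by [u], serve for strong measurability and for the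
    integral; their domination by $|\rho|$ gives convergence in $L^1$. *)
Lemma bochner_int_single rho u : continuous rho -> nmem E u ->
  is_bochner_int (fun s => rho s *: u) ((\int[mu]_(s in I01) rho s) *: u).
Proof.
move=> cr mu_; have mI := @I01_measurable R.
have mr := continuous_measurable01 cr.
have [L [mL hL]] := scalar_list_approx mr.
pose sc k (s : R) : R := \sum_(p <- L k) \1_(p.1) s * p.2.
pose f k : seq (set R * E) := [seq (p.1, p.2 *: u) | p <- L k].
have wf k : simple_wf (f k).
  move=> p /mapP[q qL ->] /=; split; first exact: mL qL.
  exact: (si_memZ hb).
have fE k s : simple_fun (f k) s = sc k s *: u.
  rewrite /simple_fun big_map /sc scaler_suml; apply: eq_bigr => p _ /=.
  by rewrite scalerA.
have dE k s : simple_fun (f k) s - rho s *: u = (sc k s - rho s) *: u.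
  by rewrite fE scalerBl.
have msc k : measurable_fun I01 (sc k : measurableTypeR R -> R).
  rewrite /sc; have : forall p, p \in L k -> measurable (p.1 : set (measurableTypeR R)) by move=> p; exact: mL.
  elim: (L k) => [|p l IH] hl.
    by rewrite (_ : (fun s => _) = (fun=> 0)); [exact: measurable_cst|apply/funext => s; rewrite big_nil].
  rewrite (_ : (fun s => _) = (fun s => \1_(p.1) s * p.2 + \sum_(q <- l) \1_(q.1) s * q.2)); last first.
    by apply/funext => s; rewrite big_cons.
  apply: measurable_funD; last by apply: IH => q ql; apply: hl; rewrite inE ql orbT.
  apply: measurable_funM; last exact: measurable_cst.
  by apply: measurable_indic; apply: hl; rewrite inE eqxx.
have irho := continuous_integrable01 cr.
have isc k : mu.-integrable I01 (EFin \o sc k).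
  apply: (le_integrable mI _ _ irho); first by apply/measurable_EFinP; exact: msc.
  by move=> s /I01P s01 /=; rewrite lee_fin; have [_] := hL _ s01; apply.
have [_ L1 L3] : [/\ mu.-integrable I01 (EFin \o rho),
    (\int[mu]_(s in I01) `| (sc k s)%:E - (rho s)%:E |)%E @[k --> \oo] --> 0%E &
    (\int[mu]_(s in I01) (sc k s)%:E)%E @[k --> \oo] --> (\int[mu]_(s in I01) (rho s)%:E)%E].
  apply: (@dominated_convergence _ _ _ mu I01 mI (fun k => EFin \o sc k) (EFin \o rho)
    (fun s => `|(rho s)%:E|%E)).
  - by move=> k; apply/measurable_EFinP; exact: msc.
  - exact/measurable_EFinP.
  - apply: aeW => s /I01P s01; apply: cvg_EFin; first exact: nearW.
    by have [] := hL _ s01.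
  - exact: (integrable_abse irho).
  - by apply: aeW => s k /I01P s01; rewrite /= lee_fin; have [_] := hL _ s01; apply.
have mnru k s : nmem E ((sc k s - rho s) *: u) by exact: (si_memZ hb).
have L2 : (\int[mu]_(s in I01) (nnorm E (simple_fun (f k) s - rho s *: u))%:E)%E @[k --> \oo] --> 0%E.
  have : ((si_norm b u)%:E * \int[mu]_(s in I01) `| (sc k s)%:E - (rho s)%:E |)%E @[k --> \oo]
      --> ((si_norm b u)%:E * 0)%E by apply: cvgeZl.
  rewrite mule0; apply: cvg_trans; apply: near_eq_cvg; apply: nearW => k.
  rewrite -ge0_integralZl//; last 2 first.
  - by apply: measurableT_comp => //; apply: emeasurable_funB; apply/measurable_EFinP; [exact: msc|].
  - by rewrite lee_fin si_norm_ge0.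
  apply: eq_integral => s _; rewrite dE hn// (si_normZ hb)// -EFinB abse_EFin -EFinM.
  by rewrite mulrC.
split=> //; first exact: (si_memZ hb).
  exists f; split=> // s s01.
  have -> : (fun k => nnorm E (simple_fun (f k) s - rho s *: u)) =
      (fun k => `|sc k s - rho s| * si_norm b u).
    by apply/funext => k; rewrite dE hn// (si_normZ hb).
  by apply: cvg_norm_dist0; have [] := hL _ s01.
exists f; split=> //.
have siE k : simple_int (f k) = (\int[mu]_(s in I01) sc k s) *: u.
  rewrite /sc (scalar_list_integral (mL k)).2 /simple_int big_map /= scaler_suml.
  by apply: eq_bigr => p _; rewrite scalerA.
have L3' : \int[mu]_(s in I01) sc k s @[k --> \oo] --> \int[mu]_(s in I01) rho s.
  apply: fine_cvg; rewrite fineK; [exact: L3|exact: (integrable_fin_num mI irho)].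
have -> : (fun k => nnorm E (simple_int (f k) - (\int[mu]_(s in I01) rho s) *: u)) =
    (fun k => `|\int[mu]_(s in I01) sc k s - \int[mu]_(s in I01) rho s| * si_norm b u).
  apply/funext => k; rewrite siE -scalerBl hn; last exact: (si_memZ hb).
  by rewrite (si_normZ hb).
exact: cvg_norm_dist0.
Qed.

Lemma bochner_int_lsum l : lwf (fun rho => continuous rho) l ->
  is_bochner_int (lsum l) (\sum_(p <- l) (\int[mu]_(s in I01) p.1 s) *: p.2).
Proof.
elim: l => [_|p l IH /= [c1 m1 wl]].
  have := bochner_int_single (@continuous_cst R 0) (si_mem0 hb).
  have -> : (fun s : R => (@cst R R 0 s) *: (0 : E)) = lsum [::].
    by apply/funext => s; rewrite lsum_nil scaler0.
  by rewrite scaler0 big_nil.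
rewrite big_cons.
have -> : lsum (p :: l) = (fun s => p.1 s *: p.2 + lsum l s).
  by apply/funext => s; rewrite lsum_cons.
apply: bochner_int_add.
- by move=> s _; exact: (si_memZ hb).
- by move=> s _; exact: lsum_mem wl.
- exact: bochner_int_single.
- exact: IH.
Qed.

Let BF : (R -> E) -> (R -> E) -> R := wform b (fun=> 1).

Lemma BF_semi_inner : semi_inner (nmem (BochnerL2 E)) BF.
Proof.
apply: (wform_semi_inner (M := 1) hb hn hb) => //.
by move=> s _; rewrite ler01 lexx.
Qed.

Lemma lsum_BochnerL2 l : lwf (fun rho => continuous rho) l -> nmem (BochnerL2 E) (lsum l).
Proof.
elim: l => [_|p l IH /= [c1 m1 wl]].
  have -> : lsum [::] = (0 : BochnerL2 E) by apply/funext => s; rewrite lsum_nil.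
  exact: (si_mem0 BF_semi_inner).
have -> : lsum (p :: l) = ((fun s => p.1 s *: p.2) : BochnerL2 E) + lsum l.
  by apply/funext => s; rewrite lsum_cons.
apply: (si_memD BF_semi_inner); last exact: IH.
apply/(BochnerL2P hb hn); split.
- by move=> s _; exact: (si_memZ hb).
- by have [] := bochner_int_single c1 m1.
have -> : (fun s => b (p.1 s *: p.2) (p.1 s *: p.2)) = (fun s => p.1 s * p.1 s * b p.2 p.2).
  apply/funext => s; have h := si_memZ hb (p.1 s) m1.
  by rewrite (si_Zl hb)// (si_Zr hb)// mulrA.
apply: continuous_integrable01; apply: continuous_mul; last exact: continuous_cst.
exact: continuous_mul.
Qed.

Definition lderive l := [seq (derive1 p.1, p.2) | p <- l].

Lemma lwf_C1_continuous l : lwf C1 l -> lwf (fun rho => continuous rho) l.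
Proof. by apply: lwf_sub => rho; exact: C1_continuous. Qed.

Lemma lderive_wf l : lwf C1 l -> lwf (fun rho => continuous rho) (lderive l).
Proof. by rewrite /lderive; apply: (@lwf_map C1 (fun rho => continuous rho) (fun rho => derive1 rho)) => rho []. Qed.

Lemma lsum_sderiv l : lwf C1 l -> is_sderiv (lsum l : R -> E) (lsum (lderive l)).
Proof.
move=> wl; have wc := lwf_C1_continuous wl; have wd := lderive_wf wl.
split; [exact: lsum_BochnerL2|exact: lsum_BochnerL2|].
move=> phi tphi; have hphi := test01_C1 tphi; have [dphi cphi] := hphi.
have p0 : phi 0 = 0 by apply: (test01_out tphi); rewrite ltxx.
have p1 : phi 1 = 0 by apply: (test01_out tphi); rewrite ltxx andbF.
have mulE (psi : R -> R) l' : (fun s => psi s *: lsum l' s) =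
    lsum [seq ((fun s => psi s * p.1 s), p.2) | p <- l'].
  apply/funext => s; rewrite /lsum scaler_sumr big_map /=.
  by apply: eq_bigr => p _; rewrite scalerA.
exists (\sum_(p <- l) (\int[mu]_(s in I01) (derive1 phi s * p.1 s)) *: p.2); split.
  rewrite mulE -[X in is_bochner_int _ X](big_map (fun p : (R -> R) * E => ((fun s => derive1 phi s * p.1 s), p.2)) xpredT
    (fun q : (R -> R) * E => (\int[mu]_(s in I01) q.1 s) *: q.2)).
  apply: bochner_int_lsum.
  by apply: (lwf_map (F := fun rho s => derive1 phi s * rho s)) wc => rho cr; exact: continuous_mul.
rewrite mulE.
have -> : - (\sum_(p <- l) (\int[mu]_(s in I01) (derive1 phi s * p.1 s)) *: p.2) =
   \sum_(q <- [seq ((fun s => phi s * p.1 s), p.2) | p <- lderive l])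
      (\int[mu]_(s in I01) q.1 s) *: q.2.
  rewrite /lderive -map_comp big_map /= -sumrN.
  elim: l wl {wc wd} => [|p l IH /= [h1 h2 h3]]; first by rewrite !big_nil.
  rewrite !big_cons IH//; congr (_ + _).
  by rewrite ibp01// scaleNr opprK.
apply: bochner_int_lsum.
apply: (lwf_map (F := fun rho s => phi s * rho s)) wd => rho cr.
by apply: continuous_mul => //; exact: C1_continuous.
Qed.

Lemma lsum_strace l (s0 : R) : lwf C1 l -> 0 <= s0 <= 1 -> has_strace (lsum l : R -> E) s0 (lsum l s0).
Proof.
move=> wl s01; have m s := lsum_mem s wl; split=> //.
exists (lsum l); split=> //.
- move=> s _; apply: cvg_within_filter; change (nnorm E (lsum l r - lsum l s) @[r --> (s : R)] --> (0 : R)).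
  elim: l wl {m} => [_|p l IH /= wl].
    rewrite (_ : (fun r => _) = (fun=> 0)); first exact: cvg_cst.
    by apply/funext => r; rewrite !lsum_nil subrr hn ?(si_norm0 hb)//; exact: (si_mem0 hb).
  have [c1 m1 wl'] := wl.
  have L : `|p.1 r - p.1 s| * si_norm b p.2 + nnorm E (lsum l r - lsum l s) @[r --> s] --> (0 : R).
    rewrite -[X in _ --> X](addr0 (0 : R)); apply: cvgD; last exact: IH.
    have c : continuous p.1 := C1_continuous c1.
    exact: cvg_norm_dist0 (c s).
  apply: (squeeze_cvgr _ (cvg_cst 0) L); apply: nearW => r.
  have m2 := lsum_mem r wl'; have m3 := lsum_mem s wl'.
  have -> : lsum (p :: l) r - lsum (p :: l) s = (p.1 r - p.1 s) *: p.2 + (lsum l r - lsum l s).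
    by rewrite !lsum_cons opprD addrACA scalerBl.
  have m4 := si_memZ hb (p.1 r - p.1 s) m1; have m5 := si_memB hb m2 m3.
  by rewrite !hn//; [rewrite si_norm_ge0 -(si_normZ hb)// (si_normD hb)|exact: (si_memD hb)].
- by apply: aeW => s _; rewrite subrr hn ?(si_norm0 hb)//; exact: (si_mem0 hb).
- by rewrite subrr hn ?(si_norm0 hb)//; exact: (si_mem0 hb).
Qed.

Definition C1_approximable v := nmem (BochnerL2 E) v /\
  forall e : R, 0 < e -> exists2 l, lwf C1 l & si_norm BF ((v : BochnerL2 E) - lsum l) < e.

Lemma C1_approximable_lin (c : R) v w : C1_approximable v -> C1_approximable w ->
  C1_approximable (fun s => c *: v s + w s).
Proof.
have hB := BF_semi_inner.
move=> [mv hv] [mw hw]; split; first exact: (si_lin hB c mv mw).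
move=> e e0; have e1 : 0 < e / (2 * (`|c| + 1)).
  by rewrite divr_gt0// mulr_gt0// ltr_wpDl.
have e2 : 0 < e / 2 by lra.
have [l wl hl] := hv _ e1; have [l' wl' hl'] := hw _ e2.
pose cl := [seq ((fun s => c * p.1 s), p.2) | p <- l].
have wcl : lwf C1 cl.
  apply: (lwf_map (F := fun rho s => c * rho s)) wl => rho hr.
  by apply: C1M => //; exact: C1_cst.
have clE s : lsum cl s = c *: lsum l s.
  by rewrite /lsum big_map scaler_sumr; apply: eq_bigr => p _; rewrite scalerA.
exists (cl ++ l'); first exact: lwf_cat.
have m1 := si_memB hB mv (lsum_BochnerL2 (lwf_C1_continuous wl)).
have m2 := si_memB hB mw (lsum_BochnerL2 (lwf_C1_continuous wl')).
have -> : (fun s => c *: v s + w s : E) - lsum (cl ++ l') =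
    c *: ((v : BochnerL2 E) - lsum l) + ((w : BochnerL2 E) - lsum l').
  apply/funext => s; rewrite -[LHS]/(c *: v s + w s - lsum (cl ++ l') s).
  rewrite -[RHS]/(c *: (v s - lsum l s) + (w s - lsum l' s)).
  by rewrite lsum_cat clE scalerBr opprD addrACA.
have m3 := si_memZ hB c m1.
apply: (le_lt_trans (si_normD hB m3 m2)); rewrite (si_normZ hB)//.
have : `|c| * si_norm BF ((v : BochnerL2 E) - lsum l) <= e / 2.
  move: hl; rewrite ltr_pdivlMr ?mulr_gt0// ?ltr_wpDl// => hl.
  have := normr_ge0 c; have := si_norm_ge0 BF ((v : BochnerL2 E) - lsum l); nra.
lra.
Qed.

Lemma C1_approximable_closed v : nmem (BochnerL2 E) v ->
  (forall e : R, 0 < e -> exists2 w, C1_approximable w &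
     si_norm BF ((v : BochnerL2 E) - w) < e) -> C1_approximable v.
Proof.
have hB := BF_semi_inner.
move=> mv h; split=> // e e0; have e2 : 0 < e / 2 by lra.
have [w [mw hw] vw] := h _ e2; have [l wl hl] := hw _ e2; exists l => //.
have ml := lsum_BochnerL2 (lwf_C1_continuous wl).
have -> : (v : BochnerL2 E) - lsum l = ((v : BochnerL2 E) - w) + ((w : BochnerL2 E) - lsum l).
  by rewrite addrA subrK.
have := si_normD hB (si_memB hB mv mw) (si_memB hB mw ml); lra.
Qed.

Lemma BF_scalar (rho : R -> R) u : nmem E u -> sqint mu I01 rho ->
  BF (fun s => rho s *: u) (fun s => rho s *: u) = Rdot mu I01 rho rho * b u u.
Proof.
move=> mu_ sr; rewrite mulrC -RintegralZl//; last first.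
  exact: (sqintM (@I01_measurable R) sr sr).
apply: eq_Rintegral => s _; rewrite mul1r (si_Zl hb) ?(si_Zr hb)//; last exact: (si_memZ hb).
by ring.
Qed.

Lemma sqrt_lt (x e : R) : 0 < e -> x < e ^+ 2 -> Num.sqrt x < e.
Proof.
by move=> e0 xe; rewrite -[ltRHS]ger0_norm ?ltW// -sqrtr_sqr ltr_sqrt// exprn_gt0.
Qed.

Lemma indic_C1_approximable (A : set R) u : measurable (A : set (measurableTypeR R)) ->
  nmem E u -> C1_approximable (fun s => (\1_A s : R) *: u).
Proof.
move=> mA mu_; have hB := BF_semi_inner; have mI := @I01_measurable R.
have sA : sqint mu I01 (\1_A : R -> R).
  apply: sqintP; first exact: measurable_indic.
  have := indic_integrable01 mA; congr (mu.-integrable _ _).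
  by apply/funext => s; rewrite /= indicE; case: (_ \in _); rewrite ?expr1n ?expr0n.
have wA : nmem (BochnerL2 E) (fun s => (\1_A s : R) *: u).
  apply/(BochnerL2P hb hn); split.
  - by move=> s _; exact: (si_memZ hb).
  - have wf : simple_wf [:: (A, u)] by apply/simple_wf_cons.
    have := simple_strongly_measurable hb hn wf; congr strongly_measurable.
    by apply/funext => s; rewrite simple_fun_cons simple_fun_nil addr0.
  have := integrableZl mI (b u u) (indic_integrable01 mA).
  apply: eq_integrable => // s _ /=; rewrite -EFinM; congr EFin.
  rewrite (si_Zl hb) ?(si_Zr hb)//; last exact: (si_memZ hb).
  by rewrite indicE; case: (_ \in _); rewrite ?mul1r ?mulr1 ?mul0r ?mulr0.
split=> // e e0; have bu := si_ge0 hb mu_.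
have e1 : 0 < e ^+ 2 / (b u u + 1) by rewrite divr_gt0 ?exprn_gt0// ltr_wpDl.
have [rho hr lt] := C1_dense sA e1.
exists [:: (rho, u)] => //.
have sr : sqint mu I01 (fun s => \1_A s - rho s).
  have cr := C1_continuous hr.
  have s2 : sqint mu I01 rho.
    apply: sqintP; first exact: continuous_measurable01.
    by apply: continuous_integrable01; exact: continuous_mul.
  have := sqint_lin mI (-1) s2 sA; congr (sqint _ _ _).
  by apply/funext => s; rewrite mulN1r addrC.
have -> : (fun s => (\1_A s : R) *: u : E) - lsum [:: (rho, u)] =
    (fun s => (\1_A s - rho s) *: u).
  apply/funext => s; rewrite -[LHS]/((\1_A s : R) *: u - lsum [:: (rho, u)] s).
  by rewrite lsum_cons lsum_nil addr0 scalerBl.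
apply: sqrt_lt => //; rewrite BF_scalar//.
move: lt; rewrite ltr_pdivlMr ?ltr_wpDl//.
have := si_ge0 (Rdot_semi_inner mu mI) sr.
set x := Rdot _ _ _ _ => x0; nra.
Qed.

Lemma simple_C1_approximable f : simple_wf f -> C1_approximable (simple_fun f).
Proof.
have hB := BF_semi_inner.
elim: f => [_|p f IH /simple_wf_cons[[h1 h2] /IH h3]].
  split; first by rewrite (_ : simple_fun [::] = 0); [exact: (si_mem0 hB)|apply/funext => s; rewrite simple_fun_nil].
  move=> e e0; exists [::] => //; rewrite (_ : _ - _ = 0) ?(si_norm0 hB)//.
  by apply/funext => s; rewrite -[LHS]/(simple_fun [::] s - lsum [::] s) simple_fun_nil lsum_nil subrr.
have := C1_approximable_lin 1 (indic_C1_approximable h1 h2) h3.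
by congr C1_approximable; apply/funext => s; rewrite simple_fun_cons scale1r.
Qed.

Lemma BochnerL2_C1_approximable v : nmem (BochnerL2 E) v -> C1_approximable v.
Proof.
have hB := BF_semi_inner; have mI := @I01_measurable R.
move=> mv; have [pv sv iv] := (BochnerL2P hb hn v).1 mv.
have [f [wf hf]] := sv.
(* The simple functions converge pointwise but without a bound. Setting them to $0$ off [S k] makes
   the distance to [v] at most $3\|v\|+1$, and at each point the truncation is eventually inactive
   because $4b(v,v)+1>b(v,v)$. *)
pose S k : set R := I01 `&` [set s | b (simple_fun (f k) s) (simple_fun (f k) s) <= 4 * b (v s) (v s) + 1].
have bb u : nmem E u -> b u u <= b u u by [].
have mbv := form_measurable hb hn hb bb pv pv sv sv.
have mS k : measurable (S k : set (measurableTypeR R)).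
  apply: measurable_fun_le => //.
    by apply: measurable_funTS; exact: (simple_form_measurable hb hb).
  by apply: measurable_funD; [apply: measurable_funM; [exact: measurable_cst|]|exact: measurable_cst].
pose g k : seq (set R * E) := [seq (p.1 `&` S k, p.2) | p <- f k].
have gE k s : simple_fun (g k) s = (\1_(S k) s : R) *: simple_fun (f k) s.
  rewrite /simple_fun big_map scaler_sumr; apply: eq_bigr => p _ /=.
  by rewrite scalerA indicI mulrC.
have wg k : simple_wf (g k).
  move=> p /mapP[q qf ->] /=; have [h1 h2] := wf k q qf; split=> //; exact: measurableI.
pose N (h : R -> E) (s : R) : R := si_norm b (h s).
have mN h : pmem h -> strongly_measurable h -> measurable_fun I01 (N h : measurableTypeR R -> R).
  move=> ph sh; rewrite /N /si_norm; apply: measurableT_comp.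
    by apply: continuous_measurable_fun; exact: sqrt_continuous.
  exact: (form_measurable hb hn hb bb).
pose h k s := simple_fun (g k) s - v s.
have ph k : pmem (h k) by exact: (diff_pmem hb).
have sh k : strongly_measurable (h k) by exact: (diff_strongly_measurable hb hn).
have sN : sqint mu I01 (N v).
  apply: sqintP; first exact: mN.
  apply: eq_integrable iv => // s /set_mem/I01P s01.
  by rewrite /= /N (si_norm_sqr hb)//; exact: pv.
have s1 : sqint mu I01 (fun=> 1 : R).
  apply: sqintP; first exact: measurable_cst.
  by apply: continuous_integrable01; exact: continuous_cst.
have sdom := sqint_lin mI 3 sN s1.
apply: C1_approximable_closed => // e e0.
have BE k : BF ((v : BochnerL2 E) - simple_fun (g k)) ((v : BochnerL2 E) - simple_fun (g k)) =
    Rdot mu I01 (fun s => N (h k) s - 0) (fun s => N (h k) s - 0).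
  apply: eq_Rintegral => s /set_mem/I01P s01; rewrite mul1r subr0 -expr2 (si_norm_sqr hb (ph k _ s01)).
  rewrite -[((v : BochnerL2 E) - simple_fun (g k)) s]/(v s - simple_fun (g k) s).
  rewrite -opprB; have m := ph k _ s01; rewrite -/(h k s).
  by rewrite (si_Nl hb) ?(si_Nr hb)// ?opprK//; exact: (si_memN hb).
have e2 : 0 < e ^+ 2 by rewrite exprn_gt0.
have [_ _ LL] : [/\ forall k, sqint mu I01 (N (h k)), sqint mu I01 (fun=> 0 : R) &
    Rdot mu I01 (fun s => N (h k) s - 0) (fun s => N (h k) s - 0) @[k --> \oo] --> (0 : R)].
  apply: (sqint_dct mI (fun k => mN _ (ph k) (sh k)) _ _ sdom).
  - move=> s /I01P s01.
    have mvs := pv _ s01; have mfs k := simple_fun_mem hb s (wf k).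
    have c0 : si_norm b (simple_fun (f k) s - v s) @[k --> \oo] --> (0 : R).
      by have := hf _ s01; rewrite (nnorm_cvg0 hn)// => k; exact: (si_memB hb).
    have c1 : b (simple_fun (f k) s) (simple_fun (f k) s) @[k --> \oo] --> b (v s) (v s).
      exact: (si_cvg_form _ hb hb bb mfs mfs mvs mvs c0 c0).
    apply: cvg_trans c0; apply: near_eq_cvg.
    have pos : b (v s) (v s) < 4 * b (v s) (v s) + 1 by have := si_ge0 hb mvs; lra.
    have [K _ hK] := cvgr_lt _ c1 _ pos; exists K => // k /hK hk.
    rewrite /N /h gE indicE mem_set ?scale1r//; split; last exact: ltW.
    by rewrite /= in_itv.
  - move=> k s /I01P s01; have mvs := pv _ s01; have mfs := simple_fun_mem hb s (wf k).
    rewrite ger0_norm ?si_norm_ge0// /N /h gE indicE.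
    have nv := si_norm_ge0 b (v s).
    have [/set_mem[_ /= hS]|_] := boolP (_ \in _); last first.
      by rewrite scale0r sub0r (si_normN hb)//; lra.
    rewrite scale1r; apply: (le_trans (si_normB hb mfs mvs)).
    have : si_norm b (simple_fun (f k) s) <= 2 * si_norm b (v s) + 1.
      rewrite -ler_sqr ?nnegrE ?si_norm_ge0//; last by rewrite addr_ge0// mulr_ge0.
      rewrite (si_norm_sqr hb)//; apply: (le_trans hS); rewrite -(si_norm_sqr hb)//.
      nra.
    lra.
have [K _ hK] := cvgr_lt _ LL _ e2.
exists (simple_fun (g K)); first exact: simple_C1_approximable.
by apply: sqrt_lt => //; rewrite BE; exact: hK (leqnn K).
Qed.

Lemma BF_scalar_pow_cvg (rho : R -> R) u : continuous rho -> nmem E u ->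
  (forall s, 0 < s < 1 -> 0 <= rho s < 1) ->
  si_norm BF (fun s => rho s ^+ k *: u) @[k --> \oo] --> (0 : R).
Proof.
move=> cr mu_ hr; have mI := @I01_measurable R.
have cX k : continuous (fun s => rho s ^+ k).
  elim: k => [|k IH].
    by rewrite (_ : (fun s => _) = (fun=> 1)); [exact: continuous_cst|apply/funext => s; rewrite expr0].
  rewrite (_ : (fun s => _) = (fun s => rho s * rho s ^+ k)); first exact: continuous_mul.
  by apply/funext => s; rewrite exprS.
have s1 : sqint mu I01 (fun=> 1 : R).
  apply: sqintP; first exact: measurable_cst.
  by apply: continuous_integrable01; exact: continuous_cst.
have [sk _ LL] : [/\ forall k, sqint mu I01 (fun s => rho s ^+ k), sqint mu I01 (fun=> 0 : R) &
    Rdot mu I01 (fun s => rho s ^+ k - 0) (fun s => rho s ^+ k - 0) @[k --> \oo] --> (0 : R)].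
  apply: (sqint_dct mI (fun k => continuous_measurable01 (cX k)) _ _ s1).
  - move=> s /I01P/hr/andP[h0 h1]; apply: cvg_expr; by rewrite ger0_norm.
  - move=> k s /I01P/hr/andP[h0 h1]; rewrite ger0_norm ?exprn_ge0//.
    by rewrite exprn_ile1// ltW.
have LB : BF (fun s => rho s ^+ k *: u) (fun s => rho s ^+ k *: u) @[k --> \oo] --> (0 : R).
  rewrite -(mul0r (b u u)) (_ : (fun k => _) = (fun k =>
     Rdot mu I01 (fun s => rho s ^+ k - 0) (fun s => rho s ^+ k - 0) * b u u)).
    by apply: cvgM => //; exact: cvg_cst.
  apply/funext => k; rewrite (BF_scalar mu_ (sk k)).
  by congr (_ * _); apply: eq_Rintegral => s _; rewrite subr0.
have := cvg_comp _ _ LB (@sqrt_continuous R 0).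
by rewrite sqrtr0.
Qed.

(** End values cost nothing in $L^2$: an approximation is corrected by $(1-s)^Nx'+s^Ny'$, where $x'$
    and $y'$ are its defects at the two ends, and the correction tends to $0$ in norm as $N$
    grows. *)
Lemma BochnerL2_C1_dense v (x y : E) (e : R) : nmem (BochnerL2 E) v ->
  nmem E x -> nmem E y -> 0 < e ->
  exists l, [/\ lwf C1 l, lsum l 0 = x, lsum l 1 = y &
    nnorm (BochnerL2 E) ((v : BochnerL2 E) - lsum l) < e].
Proof.
have hB := BF_semi_inner.
move=> mv mx my e0; have e3 : 0 < e / 3 by lra.
have [l0 wl0 hl0] := (BochnerL2_C1_approximable mv).2 _ e3.
pose x' := x - lsum l0 0; pose y' := y - lsum l0 1.
have mx' : nmem E x' by apply: (si_memB hb) => //; exact: lsum_mem wl0.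
have my' : nmem E y' by apply: (si_memB hb) => //; exact: lsum_mem wl0.
have c1 : C1 (fun s : R => 1 - s).
  by have := @C1_affine R (-1) 1; congr C1; apply/funext => s; rewrite mulN1r addrC.
have c2 : C1 (fun s : R => s).
  by have := @C1_affine R 1 0; congr C1; apply/funext => s; rewrite mul1r addr0.
have L1 := @BF_scalar_pow_cvg (fun s => 1 - s) x' (C1_continuous c1) mx'.
have L2 := @BF_scalar_pow_cvg (fun s => s) y' (C1_continuous c2) my'.
have {}L1 := L1 (fun s h => ltac:(move: h => /andP[? ?]; apply/andP; split; lra)).
have {}L2 := L2 (fun s h => ltac:(move: h => /andP[? ?]; apply/andP; split; lra)).
have [N1 _ hN1] := cvgr_lt _ L1 _ e3.
have [N2 _ hN2] := cvgr_lt _ L2 _ e3.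
pose N := (maxn N1 N2).+1.
have h1 := hN1 N (leq_trans (leq_maxl _ _) (leqnSn _)).
have h2 := hN2 N (leq_trans (leq_maxr _ _) (leqnSn _)).
pose l1 : seq ((R -> R) * E) := [:: ((fun s => (1 - s) ^+ N), x')].
pose l2 : seq ((R -> R) * E) := [:: ((fun s => s ^+ N), y')].
have wl1 : lwf C1 l1 by split=> //; exact: C1X.
have wl2 : lwf C1 l2 by split=> //; exact: C1X.
have wl := lwf_cat wl0 (lwf_cat wl1 wl2).
exists (l0 ++ (l1 ++ l2)); split=> //.
- rewrite !lsum_cat /l1 /l2 !lsum_cons !lsum_nil /= subr0 expr1n expr0n /= scale1r scale0r !addr0.
  by rewrite addrC subrK.
- rewrite !lsum_cat /l1 /l2 !lsum_cons !lsum_nil /= subrr expr1n expr0n /= scale1r scale0r !addr0 add0r.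
  by rewrite addrC subrK.
have m0 := lsum_BochnerL2 (lwf_C1_continuous wl0).
have m1 := lsum_BochnerL2 (lwf_C1_continuous wl1).
have m2 := lsum_BochnerL2 (lwf_C1_continuous wl2).
have E1 : lsum l1 = (fun s => (1 - s) ^+ N *: x').
  by apply/funext => s; rewrite lsum_cons lsum_nil addr0.
have E2 : lsum l2 = (fun s => s ^+ N *: y').
  by apply/funext => s; rewrite lsum_cons lsum_nil addr0.
rewrite -E1 in h1; rewrite -E2 in h2.
have ml := lsum_BochnerL2 (lwf_C1_continuous wl).
rewrite (BochnerL2_norm hb hn); last exact: (si_memB hB).
rewrite -/BF.
have -> : (v : BochnerL2 E) - lsum (l0 ++ (l1 ++ l2)) =
    ((v : BochnerL2 E) - lsum l0) - ((lsum l1 : BochnerL2 E) + lsum l2).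
  apply/funext => s; rewrite -[LHS]/(v s - lsum (l0 ++ (l1 ++ l2)) s).
  rewrite -[RHS]/(v s - lsum l0 s - (lsum l1 s + lsum l2 s)).
  by rewrite !lsum_cat opprD addrA.
have m12 := si_memD hB m1 m2.
apply: (le_lt_trans (si_normB hB (si_memB hB mv m0) m12)).
have := si_normD hB m1 m2.
move: hl0 h1 h2; lra.
Qed.

End bochner_density.

(** * Weak derivatives with traces *)

Section real_line.
Context (R : realType).
Local Notation mu := (@lebesgue_measure R).
Local Notation I01 := (`]0%R, 1%R[%classic : set R).
Local Notation step := (@step R).
Implicit Types (f g w p q : R -> R) (l s x y : R).

(** The supremum of the points reachable from $0$ is itself reachable and, if it were less than $1$,
    could be passed: the local hypothesis at the supremum covers intervals reaching to both of its
    sides. *)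
Lemma cousin (Q : R -> R -> Prop) :
  (forall x y z, 0 <= x -> x <= y -> y <= z -> z <= 1 -> Q x y -> Q y z -> Q x z) ->
  (forall s, 0 <= s <= 1 -> exists2 d : R, 0 < d & forall x y,
     0 <= x -> y <= 1 -> x <= s -> s <= y -> s - d < x -> y < s + d -> Q x y) ->
  Q 0 1.
Proof.
move=> Qcat Qloc.
pose S : set R := [set x | 0 <= x <= 1 /\ Q 0 x].
have S0 : S 0.
  split; first by rewrite lexx ler01.
  have z01 : 0 <= (0 : R) <= 1 by rewrite lexx ler01.
  by have [d d0 h] := Qloc _ z01; apply: h; lra.
have hsup : has_sup S by split; [exists 0|exists 1 => x [/andP[]]].
set c := sup S.
have c0 : 0 <= c by exact: ub_le_sup hsup.2 _ S0.
have c1 : c <= 1 by apply: ge_sup; [exists 0|move=> x [/andP[]]].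
have c01 : 0 <= c <= 1 by rewrite c0.
have [d d0 h] := Qloc _ c01.
have [x [/andP[x0 x1] Qx] xc] := sup_adherent d0 hsup.
have xle : x <= c by apply: (ub_le_sup hsup.2); split=> //; rewrite x0.
have Qto y : c <= y -> y <= 1 -> y < c + d -> Q 0 y.
  by move=> cy y1 yd; apply: (Qcat 0 x y) => //; [exact: le_trans cy|exact: h].
have [e1|n1] := eqVneq c 1; first by rewrite -e1; apply: Qto => //; lra.
have lt1 : c < 1 by rewrite lt_neqAle n1.
pose y := Num.min 1 (c + d / 2).
have cy : c < y by rewrite lt_min lt1 /=; lra.
have y1 : y <= 1 by rewrite ge_min lexx.
have yd : y < c + d by rewrite gt_min; apply/orP; right; lra.
have : y <= c.
  by apply: (ub_le_sup hsup.2); split; [rewrite y1 andbT; lra|apply: Qto => //; exact: ltW].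
by rewrite leNgt cy.
Qed.

Lemma dist_lt (s x d : R) : s - d < x -> x < s + d -> `|s - x| < d.
Proof. by move=> h1 h2; rewrite ltr_norml; apply/andP; split; lra. Qed.

Lemma seq_cvg_unique (u : nat -> R) x y : u k @[k --> \oo] --> x -> u k @[k --> \oo] --> y -> x = y.
Proof. by move=> ux uy; apply: (cvg_unique _ ux uy). Qed.

Lemma ae_sub (P Q : R -> Prop) : {ae mu, forall s, P s} -> (forall s, P s -> Q s) ->
  {ae mu, forall s, Q s}.
Proof.
move=> [N [mN N0 hN]] PQ; exists N; split=> // s /= nQ.
by apply: hN => /= Ps; exact/nQ/PQ.
Qed.

Lemma ae_point (P : R -> Prop) x y : {ae mu, forall s, P s} -> x < y ->
  exists2 s, x < s < y & P s.
Proof.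
move=> [N [mN N0 hN]] xy; apply: contrapT => h.
have sub : `]x, y[%classic `<=` N.
  move=> s /=; rewrite in_itv /= => sxy; apply: hN => /= Ps; apply: h.
  by exists s.
have : (mu `]x, y[%classic <= mu N)%E.
  by apply: le_measure => //; rewrite inE//; exact: measurable_itv.
rewrite N0 lebesgue_measure_itv /= lte_fin xy -EFinB lee_fin; lra.
Qed.

(** The primitive is an integral over the fixed interval $]0,1[$ with a cut-off factor, so that
    linearity and comparison involve no change of domain. *)
Definition prim f x : R := \int[mu]_(s in I01) ((s <= x)%R%:R * f s).

Lemma cut_integrable f x : mu.-integrable I01 (EFin \o f) ->
  mu.-integrable I01 (EFin \o (fun s => (s <= x)%R%:R * f s)).
Proof.
move=> fi; apply: (le_integrable (@I01_measurable R) _ _ fi).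
  apply/measurable_EFinP; apply: measurable_funM; last first.
    by apply/measurable_EFinP; case/integrableP : fi.
  rewrite (_ : (fun s => _) = \1_(`]-oo, x]%classic)); first exact: measurable_indic.
  by apply/funext => s; rewrite indicE /= mem_setE in_itv.
move=> s _ /=; rewrite lee_fin; case: (s <= x); rewrite ?mul1r// mul0r normr0//.
Qed.

Lemma prim0 f : prim f 0 = 0.
Proof.
rewrite /prim; under eq_Rintegral => s /set_mem /I01P/andP[s0 _].
  rewrite leNgt s0 mul0r; over.
by rewrite Rintegral_cst ?mul0r//; exact: I01_measurable.
Qed.

Lemma prim1 f : prim f 1 = \int[mu]_(s in I01) f s.
Proof.
by apply: eq_Rintegral => s /set_mem /I01P/andP[_ s1]; rewrite ltW// mul1r.
Qed.

Lemma prim_lin (c : R) f g x : mu.-integrable I01 (EFin \o f) -> mu.-integrable I01 (EFin \o g) ->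
  prim (fun s => c * f s + g s) x = c * prim f x + prim g x.
Proof.
move=> fi gi; have mI := @I01_measurable R; have cf := cut_integrable x fi.
rewrite /prim -RintegralZl// -RintegralD//; last 2 first.
- exact: (integrableZl mI c cf).
- exact: cut_integrable.
by apply: eq_Rintegral => s _ /=; ring.
Qed.

Lemma prim_le f w x y : x <= y -> mu.-integrable I01 (EFin \o f) -> mu.-integrable I01 (EFin \o w) ->
  (forall s, 0 < s < 1 -> 0 <= w s) ->
  {ae mu, forall s, 0 < s < 1 -> x < s -> s <= y -> `|f s| <= w s} ->
  `|prim f y - prim f x| <= prim w y - prim w x.
Proof.
move=> xy fi wi w0 fw; have mI := @I01_measurable R.
have [fx fy wx wy] := And4 (cut_integrable x fi) (cut_integrable y fi) (cut_integrable x wi) (cut_integrable y wi).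
rewrite /prim -!RintegralB//.
have iB := integrableB mI fy fx; have iW := integrableB mI wy wx.
apply: (le_trans (le_normr_Rintegral mI iB)).
have E g s : (s <= y)%R%:R * g s - (s <= x)%R%:R * g s = ((x < s) && (s <= y))%R%:R * g s.
  rewrite -mulrBl; congr (_ * _); rewrite ltNge.
  have [sx|sx] := boolP (s <= x); last by rewrite subr0.
  by rewrite (le_trans sx xy) subrr.
have n0 s : I01 s -> (0 <= ((s <= y)%R%:R * w s - (s <= x)%R%:R * w s)%:E)%E.
  by move=> /I01P s01; rewrite E lee_fin mulr_ge0// w0.
rewrite /Rintegral fine_le//.
- exact: (integrable_fin_num mI (integrable_norm iB)).
- exact: (integrable_fin_num mI iW).
apply: ae_ge0_le_integral => //.
- by case/integrableP : (integrable_norm iB).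
- by case/integrableP : iW.
apply: (ae_sub fw) => s {}fw /I01P s01; rewrite !E lee_fin normrM ger0_norm//.
have [/andP[xs sy]|_] := boolP (_ && _); last by rewrite !mul0r.
by rewrite !mul1r; exact: fw.
Qed.

(** A smooth rise from $0$ at $x$ to $1$ at $x+1/l$; its derivative approximates a Dirac mass at
    $x$. *)
Definition ramp (l x : R) s := step (l * s + - (l * x)).

Lemma ramp_smooth l x : smooth1 (ramp l x).
Proof. by move=> k; apply: Dk_comp_affine; exact: step_smooth. Qed.

Lemma ramp_C1 l x : C1 (ramp l x).
Proof. exact/smooth1_C1/ramp_smooth. Qed.

Lemma derive_ramp l x s : derive1 (ramp l x) s = l * derive1 step (l * s + - (l * x)).
Proof.
have h := @is_derive_comp_affine R step l (- (l * x)) s.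
rewrite derive1E; apply: derive_val; apply: h.
by apply: smooth1_derivable; exact: step_smooth.
Qed.

Lemma ramp_le l x s : 0 < l -> s <= x -> ramp l x s = 0.
Proof. by move=> l0 sx; rewrite /ramp step_le0// subr_le0 ler_pM2l. Qed.

Lemma ramp_ge l x s : 0 < l -> x + l^-1 <= s -> ramp l x s = 1.
Proof.
move=> l0 sx; rewrite /ramp step_ge1//; rewrite -mulrBr mulrC -ler_pdivrMr// mul1r; lra.
Qed.

Lemma derive_ramp_out l x s : 0 < l -> s < x \/ x + l^-1 < s -> derive1 (ramp l x) s = 0.
Proof.
move=> l0 h; rewrite derive_ramp derive_step_out ?mulr0//.
case: h => h; [left|right]; first by rewrite subr_lt0 ltr_pM2l.
by rewrite -mulrBr mulrC -ltr_pdivrMr// mul1r; lra.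
Qed.

Lemma derive_step_bounded : exists2 M : R, 0 <= M & forall s, `|derive1 step s| <= M.
Proof.
have [_ c] := smooth1_C1 (@step_smooth R); have [M M0 hM] := continuous_bounded01 c.
exists M => // s; have [s0|s0] := ltP s 0.
  by rewrite derive_step_out ?normr0//; left.
have [s1|s1] := ltP 1 s; first by rewrite derive_step_out ?normr0//; right.
by apply: hM; rewrite s0.
Qed.

Lemma ramp_mass l x : 0 < l -> 0 < x -> x + l^-1 < 1 ->
  \int[mu]_(s in I01) derive1 (ramp l x) s = 1.
Proof.
move=> l0 x0 x1; have [dr cr] := ramp_C1 l x; have c := C1_continuous (ramp_C1 l x).
rewrite Rintegral_oo_cc; last exact: continuous_integrable_seg.
rewrite /Rintegral (continuous_FTC2 (F := ramp l x) ltr01 (continuous_subspaceT cr)) //=.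
  by rewrite ramp_ge ?(ltW x1)// ramp_le ?subr0// ltW.
split; [by move=> s _; exact: dr|exact: cvg_at_right_filter (c 0)|exact: cvg_at_left_filter (c 1)].
Qed.

Definition lam (k : nat) : R := (k + 8)%:R.

(** The point is moved towards $1/2$ by the fraction $4/\lambda_k$, so that the interval
    $[x_k,x_k+1/\lambda_k]$ on which the ramp rises stays inside $]0,1[$ even for $x=0$ and $x=1$.
    The bound $\lambda_k\ge 8$ keeps the fraction at most $1/2$. *)
Definition xlam x k : R := x + (1 / 2 - x) * (4 * (lam k)^-1).

Lemma lam_gt0 k : 0 < lam k. Proof. by rewrite ltr0n addn_gt0 orbT. Qed.

Lemma lamV_le k : 0 < (lam k)^-1 <= 1 / 8.
Proof.
rewrite invr_gt0 lam_gt0 /= div1r lef_pV2 ?posrE ?lam_gt0//.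
by rewrite ler_nat leq_addl.
Qed.

Lemma lamV_cvg : (lam k)^-1 @[k --> \oo] --> (0 : R).
Proof.
have := @cvg_harmonic R; rewrite -(cvg_shiftn 7) /harmonic /=.
by under eq_fun do rewrite -addnS.
Qed.

Lemma xlam_cvg x : xlam x k @[k --> \oo] --> x.
Proof.
rewrite -[X in _ --> X]addr0 -[X in _ --> _ + X](mulr0 (1 / 2 - x)) -[X in _ * X](mulr0 (4 : R)).
by apply: cvgD (cvg_cst x) (cvgM (cvg_cst (1 / 2 - x)) (cvgM (cvg_cst (4 : R)) lamV_cvg)).
Qed.

Lemma xlamV_cvg x : xlam x k + (lam k)^-1 @[k --> \oo] --> x.
Proof. by rewrite -[X in _ --> X]addr0; exact: cvgD (@xlam_cvg x) lamV_cvg. Qed.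

Lemma xlam_in x k : 0 <= x <= 1 -> 0 < xlam x k /\ xlam x k + (lam k)^-1 < 1.
Proof.
move=> /andP[x0 x1]; have /andP[] := lamV_le k; rewrite /xlam.
set i := (lam k)^-1 => i0 i1; have := mulr_ge0 x0 (ltW i0).
have : 0 <= (1 - x) * (1 / 8 - i) by rewrite mulr_ge0//; lra.
have : 0 <= x * (1 / 8 - i) by rewrite mulr_ge0//; lra.
split; lra.
Qed.

(** The ramps are bounded by $1$ and converge to the indicator of $s>x$ except possibly at the
    single point $s=x$. *)
Lemma ramp_cut_cvg p x : 0 <= x <= 1 -> mu.-integrable I01 (EFin \o p) ->
  \int[mu]_(s in I01) (ramp (lam k) (xlam x k) s * p s) @[k --> \oo] -->
    \int[mu]_(s in I01) p s - prim p x.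
Proof.
move=> x01 ip; have mI := @I01_measurable R.
have mp : measurable_fun I01 (p : measurableTypeR R -> R).
  by apply/measurable_EFinP; case/integrableP : ip.
have cp := cut_integrable x ip.
rewrite /prim -RintegralB//.
have iB := integrableB mI ip cp.
have [i1 _ L] : [/\ mu.-integrable I01 (EFin \o (fun s => p s - (s <= x)%R%:R * p s)),
   (\int[mu]_(s in I01) `|(ramp (lam k) (xlam x k) s * p s)%:E - (p s - (s <= x)%R%:R * p s)%:E|)%E @[k --> \oo] --> 0%E &
   (\int[mu]_(s in I01) (ramp (lam k) (xlam x k) s * p s)%:E)%E @[k --> \oo] -->
    (\int[mu]_(s in I01) (p s - (s <= x)%R%:R * p s)%:E)%E].
  apply: (@dominated_convergence _ _ _ mu I01 mI (fun k => EFin \o (fun s => ramp (lam k) (xlam x k) s * p s))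
     (EFin \o (fun s => p s - (s <= x)%R%:R * p s)) (fun s => `|(p s)%:E|%E)).
  - move=> k; apply/measurable_EFinP; apply: measurable_funM => //.
    exact: (continuous_measurable01 (C1_continuous (ramp_C1 _ _))).
  - by case/integrableP : iB.
  - exists [set x]; split; [exact: measurable_set1|exact: lebesgue_measure_set1|].
    move=> s /= hs; apply: contrapT => sx; apply: hs => _; apply: cvg_EFin; first exact: nearW.
    have {}sx : s != x by apply/eqP.
    have [lt|gt|eq] := ltgtP s x; last by rewrite eq eqxx in sx.
      rewrite mul1r subrr; have [K _ hK] := cvgr_gt _ (@xlam_cvg x) _ lt.
      apply: (@cvg_near_cst _ _ (0 : R)); exists K => // k /hK /= h.
      by rewrite ramp_le ?mul0r ?lam_gt0// ltW.
    rewrite mul0r subr0; have [K _ hK] := cvgr_lt _ (@xlamV_cvg x) _ gt.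
    apply: (@cvg_near_cst _ _ (p s)); exists K => // k /hK /= h.
    by rewrite ramp_ge ?mul1r ?lam_gt0// ltW.
  - exact: (integrable_abse ip).
  - apply: aeW => s k _ /=; rewrite lee_fin normrM ger0_norm ?step_ge0//.
    by rewrite ler_piMl// step_le1.
by apply: fine_cvg; rewrite fineK; [exact: L|exact: (integrable_fin_num mI i1)].
Qed.

(** The derivatives of the ramps form an approximate identity at $x$: they have integral $1$, are
    bounded by $M\lambda_k$ with [M] a bound for the derivative of [step], and vanish off an
    interval of length $1/\lambda_k$ that shrinks to $x$. Only [qc] is continuous; [q] enters
    through almost everywhere equality. *)
Lemma ramp_delta_cvg q qc x : 0 <= x <= 1 -> mu.-integrable I01 (EFin \o q) ->
  {ae mu, forall s, 0 < s < 1 -> q s = qc s} ->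
  qc s @[s --> within `[0, 1]%classic (nbhs x)] --> qc x ->
  \int[mu]_(s in I01) (derive1 (ramp (lam k) (xlam x k)) s * q s) @[k --> \oo] --> qc x.
Proof.
move=> x01 iq qqc cq; have mI := @I01_measurable R.
have [M M0 hM] := derive_step_bounded.
apply/cvgrPdist_le => e e0.
pose e' := e / (M + 1).
have e'0 : 0 < e' by rewrite divr_gt0// ltr_wpDl.
move/cvgrPdist_le : cq => /(_ _ e'0) [d /= d0 hd].
have xd1 : x - d < x by lra.
have xd2 : x < x + d by lra.
have [K1 _ hK1] := cvgr_gt _ (@xlam_cvg x) _ xd1.
have [K2 _ hK2] := cvgr_lt _ (@xlamV_cvg x) _ xd2.
exists (maxn K1 K2) => // k /=; rewrite geq_max => /andP[/hK1 /= h1 /hK2 /= h2].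
have [a0 a1] := xlam_in k x01; have l0 := lam_gt0 k.
set l := lam k in a1 h2 l0 *; set a := xlam x k in a0 a1 h1 h2 *.
have [_ cr] := ramp_C1 l a.
have ir := continuous_integrable01 cr.
have mq : measurable_fun I01 (q : measurableTypeR R -> R).
  by apply/measurable_EFinP; case/integrableP : iq.
have [M' M'0 hM'] := continuous_bounded01 cr.
have irq : mu.-integrable I01 (EFin \o (fun s => derive1 (ramp l a) s * q s)).
  apply: (le_integrable mI _ _ (integrableZl mI M' iq)).
    by apply/measurable_EFinP; apply: measurable_funM => //; exact: continuous_measurable01.
  move=> s /I01P/andP[s0 s1] /=; rewrite lee_fin !normrM (ger0_norm M'0) ler_wpM2r//.
  by apply: hM'; rewrite !ltW.
have -> : qc x = qc x * \int[mu]_(s in I01) derive1 (ramp l a) s by rewrite ramp_mass// mulr1.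
rewrite -RintegralZl//.
have irz := integrableZl mI (qc x) ir.
rewrite -RintegralB//.
have iB := integrableB mI irz irq.
apply: (le_trans (le_normr_Rintegral mI iB)).
(* A majorant of the error whose integral $e'M\le e$ does not depend on the slope [l]. *)
pose w s : R := e' * (M * l) * \1_(`[a, a + l^-1]%classic) s.
have iw : mu.-integrable I01 (EFin \o w).
  apply: (integrableZl mI (e' * (M * l)) (indic_integrable01 _)); exact: measurable_itv.
have w0 s : 0 <= w s.
  apply: mulr_ge0; last by rewrite indicE; case: (_ \in _).
  by apply: mulr_ge0; [exact: ltW|apply: mulr_ge0 => //; exact: ltW].
have wE : \int[mu]_(s in I01) w s = e' * M.
  rewrite RintegralZl//; last by apply: indic_integrable01; exact: measurable_itv.
  rewrite /Rintegral integral_indic//.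
  rewrite setIidl; last first.
    move=> s /=; rewrite !in_itv /= => /andP[s1 s2]; apply/andP; split.
      exact: lt_le_trans s1.
    exact: le_lt_trans a1.
  have H : mu `[a, a + l^-1]%classic = (l^-1)%:E.
    by rewrite lebesgue_measure_itv /= lte_fin ltrDl invr_gt0 l0 -EFinB [a + _]addrC addrK.
  transitivity (e' * (M * l) * l^-1); first by congr (_ * _); exact: (congr1 fine H).
  by rewrite -!mulrA mulfV ?mulr1// gt_eqF.
apply: (@le_trans _ _ (\int[mu]_(s in I01) w s)); last first.
  have : e' * (M + 1) = e by rewrite /e' divfK// gt_eqF// ltr_wpDl.
  by rewrite wE mulrDr mulr1; lra.
rewrite /Rintegral fine_le//.
- exact: (integrable_fin_num mI (integrable_norm iB)).
- exact: (integrable_fin_num mI iw).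
apply: ae_ge0_le_integral => //.
- by case/integrableP : (integrable_norm iB).
- by move=> s _; rewrite lee_fin.
- by case/integrableP : iw.
apply: (ae_sub qqc) => s hq /I01P s01; rewrite hq// lee_fin /=.
rewrite mulrC -mulrBr normrM /w indicE mem_setE in_itv /=.
have [/andP[h3 h4]|/negP h] := boolP (_ && _); last first.
  rewrite derive_ramp_out ?normr0 ?mul0r ?mulr0//.
  have [|h3] := ltP s a; first by left.
  by right; rewrite ltNge; apply/negP => h4; apply: h; rewrite h3.
rewrite mulr1 derive_ramp normrM (gtr0_norm l0) mulrC; apply: ler_pM => //.
- by rewrite mulr_ge0// ltW.
- apply: hd => /=; last by rewrite in_itv /=; case/andP: s01 => ? ?; rewrite !ltW.
  rewrite ltr_distlC; apply/andP; split; lra.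
- by rewrite mulrC ler_wpM2r// ltW.
Qed.

(** A single ramp equals $1$ near $s=1$ and is not a test function; the difference of two ramps
    vanishes near both ends. *)
Lemma ramp_test x y k : 0 <= x <= 1 -> 0 <= y <= 1 ->
  test01 (fun s => ramp (lam k) (xlam x k) s - ramp (lam k) (xlam y k) s).
Proof.
move=> x01 y01; have [a0 a1] := xlam_in k x01; have [b0 b1] := xlam_in k y01.
have l0 := lam_gt0 k; split.
  apply: smooth1_derive1n => j; have h1 := ramp_smooth (lam k) (xlam x k) j.
  have h2 := DkM (Dk_cst j (-1)) (ramp_smooth (lam k) (xlam y k) j).
  by have := DkD h1 h2; congr Dk; apply/funext => s; rewrite mulN1r.
pose lo := Num.min (xlam x k) (xlam y k).
pose hi := Num.max (xlam x k + (lam k)^-1) (xlam y k + (lam k)^-1).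
have sub : [set s | ramp (lam k) (xlam x k) s - ramp (lam k) (xlam y k) s != 0] `<=` `[lo, hi]%classic.
  move=> s /= h; rewrite in_itv /=; apply/andP; split; rewrite leNgt; apply/negP => hs.
    move: hs; rewrite lt_min => /andP[h1 h2].
    by rewrite !ramp_le ?subrr ?eqxx ?ltW// in h.
  move: hs; rewrite gt_max => /andP[h1 h2].
  by rewrite !ramp_ge ?subrr ?eqxx ?ltW// in h.
move=> s /(closure_subset sub); rewrite -(closure_id _).1; last exact: itv_closed.
rewrite /= !in_itv /= => /andP[h1 h2]; apply/andP; split.
  by apply: lt_le_trans h1; rewrite lt_min a0.
by apply: (le_lt_trans h2); rewrite gt_max a1.
Qed.

End real_line.

Lemma prim_one (R : realType) (x : R) : 0 <= x <= 1 -> prim (fun=> 1) x = x.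
Proof.
move=> /andP[x0 x1]; have mI := @I01_measurable R.
move: x1; rewrite le_eqVlt => /predU1P[->|x1].
  rewrite prim1 Rintegral_cst// mul1r.
  have H : @lebesgue_measure R `]0%R, 1%R[%classic = 1%:E.
    by rewrite lebesgue_measure_itv /= lte_fin ltr01 -EFinB subr0.
  exact: (congr1 fine H).
rewrite /prim (_ : (fun s => _) = \1_(`]-oo, x]%classic)); last first.
  by apply/funext => s; rewrite mulr1 indicE mem_setE in_itv.
rewrite /Rintegral integral_indic//.
have -> : `]-oo, x]%classic `&` `]0, 1[%classic = `]0, x]%classic.
  apply/seteqP; split=> s /=; rewrite !in_itv /=; first by move=> [-> /andP[->]].
  by move=> /andP[-> sx]; rewrite sx (le_lt_trans sx).
have H : @lebesgue_measure R `]0%R, x]%classic = x%:E.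
  rewrite lebesgue_measure_itv /= lte_fin -EFinB subr0.
  by case: ltP => // x0'; congr EFin; apply/eqP; rewrite eq_le x0 x0'.
exact: (congr1 fine H).
Qed.

(** * The chain rule for quadratic forms of weakly differentiable functions *)

Section sderiv.
Context (R : realType) (E : nspace R) (b a : E -> E -> R).
Hypotheses (hb : semi_inner (nmem E) b)
  (hn : forall u, nmem E u -> nnorm E u = si_norm b u)
  (ha : semi_inner (nmem E) a) (ab : forall u, nmem E u -> a u u <= b u u).
Local Notation mu := (@lebesgue_measure R).
Local Notation I01 := (`]0%R, 1%R[%classic : set R).
Implicit Types (v g vc : R -> E) (u h : E) (rho : R -> R) (s x y : R).

Lemma form_norm_le u : nmem E u -> si_norm a u <= si_norm b u.
Proof. by move=> mu_; apply: ler_wsqrtr; exact: ab. Qed.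

Lemma form_cs u h : nmem E u -> nmem E h -> `|a u h| <= si_norm b u * si_norm b h.
Proof.
move=> mu_ mh; apply: (le_trans (si_cs ha mu_ mh)).
by apply: ler_pM; rewrite ?si_norm_ge0//; exact: form_norm_le.
Qed.

Lemma form_null u h w : nmem E u -> nmem E h -> nmem E w -> nnorm E (u - h) = 0 -> a u w = a h w.
Proof.
move=> mu_ mh mw; have m := si_memB hb mu_ mh; rewrite hn// => e.
apply/eqP; rewrite -subr_eq0 -(si_Bl ha)// -normr_le0.
by apply: (le_trans (form_cs m mw)); rewrite e mul0r.
Qed.

Lemma form_null2 u h : nmem E u -> nmem E h -> nnorm E (u - h) = 0 -> a u u = a h h.
Proof.
by move=> mu_ mh e; rewrite (form_null mu_ mh mu_ e) (si_sym ha)// (form_null mu_ mh mh e).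
Qed.

Lemma cst_BochnerL2 h : nmem E h -> nmem (BochnerL2 E) (fun=> h).
Proof.
move=> mh; have : lwf (fun rho : R -> R => continuous rho) [:: (fun=> 1, h)].
  by split=> //; exact: continuous_cst.
move/(lsum_BochnerL2 hb hn); congr (nmem (BochnerL2 E)).
by apply/funext => s; rewrite lsum_cons lsum_nil scale1r addr0.
Qed.

Lemma pairing_integrable v g : nmem (BochnerL2 E) v -> nmem (BochnerL2 E) g ->
  mu.-integrable I01 (EFin \o (fun s => a (v s) (g s))).
Proof.
move=> mv mg.
have h1 : measurable_fun I01 ((fun=> 1) : measurableTypeR R -> R) by exact: measurable_cst.
have h2 s : 0 < s < 1 -> `|1 : R| <= 1 by rewrite normr1.
have := wform_integrable hb hn ha ab h1 h2 mv mg.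
by congr (mu.-integrable _ _); apply/funext => s /=; rewrite mul1r.
Qed.

Lemma continuous_mul_integrable rho (f : R -> R) : continuous rho -> mu.-integrable I01 (EFin \o f) ->
  mu.-integrable I01 (EFin \o (fun s => rho s * f s)).
Proof.
move=> cr fi; have mI := @I01_measurable R.
have [M M0 hM] := continuous_bounded01 cr.
apply: (le_integrable mI _ _ (integrableZl mI M fi)).
  apply/measurable_EFinP; apply: measurable_funM; first exact: continuous_measurable01.
  by apply/measurable_EFinP; case/integrableP : fi.
move=> s /I01P/andP[s0 s1] /=; rewrite lee_fin !normrM (ger0_norm M0) ler_wpM2r//.
by apply: hM; rewrite !ltW.
Qed.

(** Pairing with [h] commutes with both Bochner integrals in the definition of the weak derivative,
    and their common value [J] drops out. *)
Lemma sderiv_pairing v g (phi : R -> R) h : is_sderiv v g -> test01 phi -> nmem E h ->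
  \int[mu]_(s in I01) (derive1 phi s * a (v s) h) = - \int[mu]_(s in I01) (phi s * a (g s) h).
Proof.
move=> [mv mg sd] tphi mh; have [dphi cphi] := test01_C1 tphi.
have [pv _ _] := mv; have [pg _ _] := mg.
have c0 := C1_continuous (test01_C1 tphi).
have [J [hJ1 hJ2]] := sd _ tphi; have [mJ _ _] := hJ1.
have iv := continuous_mul_integrable cphi (pairing_integrable mv (cst_BochnerL2 mh)).
have ig := continuous_mul_integrable c0 (pairing_integrable mg (cst_BochnerL2 mh)).
have key (psi : R -> R) (w : R -> E) K : pmem w ->
    mu.-integrable I01 (EFin \o (fun s => psi s * a (w s) h)) ->
    is_bochner_int (fun s => psi s *: w s) K ->
    \int[mu]_(s in I01) (psi s * a (w s) h) = a K h.
  move=> pw iw hK; rewrite -(bochner_int_pairing hb hn ha ab _ hK mh).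
  - by apply: eq_Rintegral => s /set_mem/I01P s01; rewrite (si_Zl ha)//; exact: pw.
  - by move=> s s01; apply: (si_memZ hb); exact: pw.
  - move: iw; apply: eq_integrable => // s /set_mem/I01P s01 /=.
    by rewrite (si_Zl ha)//; exact: pw.
by rewrite (key _ _ _ pv iv hJ1) (key _ _ _ pg ig hJ2) (si_Nl ha)// opprK.
Qed.

Definition continuous_rep v vc := [/\ forall s, 0 <= s <= 1 -> nmem E (vc s),
   forall s, 0 <= s <= 1 -> nnorm E (vc r - vc s) @[r --> within `[0, 1]%classic (nbhs s)] --> (0 : R) &
   {ae mu, forall s, 0 < s < 1 -> nnorm E (v s - vc s) = 0}].

Lemma continuous_rep_near v vc s (e : R) : continuous_rep v vc -> 0 <= s <= 1 -> 0 < e ->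
  exists2 d : R, 0 < d & forall r, 0 <= r <= 1 -> `|s - r| < d -> si_norm b (vc r - vc s) <= e.
Proof.
move=> [mvc cvc _] s01 e0; have := cvc _ s01; move/cvgrPdist_le => /(_ _ e0) [d /= d0 hd].
exists d => // r r01 sr; have := hd r sr; rewrite /= in_itv /= => /(_ r01).
by rewrite sub0r normrN -hn ?ger0_norm ?hn ?si_norm_ge0//; apply: (si_memB hb); exact: mvc.
Qed.

Lemma rep_form_cvg v vc h (z : R) : continuous_rep v vc -> nmem E h -> 0 <= z <= 1 ->
  a (vc s) h @[s --> within `[0, 1]%classic (nbhs z)] --> a (vc z) h.
Proof.
move=> rep mh z01; have [mvc _ _] := rep.
apply/cvgrPdist_le => e e0.
have e1 : 0 < e / (si_norm b h + 1) by rewrite divr_gt0// ltr_wpDl// si_norm_ge0.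
have [d d0 hd] := continuous_rep_near rep z01 e1.
exists d => //= r zr; rewrite /= in_itv /= => r01.
have mr := mvc _ r01; have mz := mvc _ z01; have m := si_memB hb mr mz.
rewrite distrC -(si_Bl ha)//; apply: (le_trans (form_cs m mh)).
apply: (@le_trans _ _ (e / (si_norm b h + 1) * si_norm b h)).
  by rewrite ler_wpM2r ?si_norm_ge0//; exact: hd.
by rewrite mulrAC ler_pdivrMr ?ltr_wpDl ?si_norm_ge0// ler_pM2l// lerDl.
Qed.

Lemma sderiv_ramp v g h k x y : is_sderiv v g -> nmem E h -> 0 <= x <= 1 -> 0 <= y <= 1 ->
  \int[mu]_(s in I01) (derive1 (ramp (lam R k) (xlam x k)) s * a (v s) h) -
  \int[mu]_(s in I01) (derive1 (ramp (lam R k) (xlam y k)) s * a (v s) h) =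
  - (\int[mu]_(s in I01) (ramp (lam R k) (xlam x k) s * a (g s) h) -
     \int[mu]_(s in I01) (ramp (lam R k) (xlam y k) s * a (g s) h)).
Proof.
move=> sd mh x01 y01; have mI := @I01_measurable R; have [mv mg _] := sd.
have iq := pairing_integrable mv (cst_BochnerL2 mh).
have ip := pairing_integrable mg (cst_BochnerL2 mh).
have [dx cx] := ramp_C1 (lam R k) (xlam x k); have [dy cy] := ramp_C1 (lam R k) (xlam y k).
have cx' := C1_continuous (ramp_C1 (lam R k) (xlam x k)).
have cy' := C1_continuous (ramp_C1 (lam R k) (xlam y k)).
have H := sderiv_pairing sd (ramp_test k x01 y01) mh.
apply: (eq_trans (esym (RintegralB mI (continuous_mul_integrable cx iq) (continuous_mul_integrable cy iq)))).
apply: (eq_trans _ (congr1 -%R (RintegralB mI (continuous_mul_integrable cx' ip) (continuous_mul_integrable cy' ip)))).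
transitivity (\int[mu]_(s in I01) (derive1 (fun s => ramp (lam R k) (xlam x k) s - ramp (lam R k) (xlam y k) s) s * a (v s) h)).
  apply: eq_Rintegral => s _; rewrite -mulrBl; congr (_ * _).
  have D := is_deriveB (derivable_is_derive1 (dx s)) (derivable_is_derive1 (dy s)).
  by symmetry; rewrite derive1E; case: D.
by rewrite H; congr (- _); apply: eq_Rintegral => s _; rewrite mulrBl.
Qed.

(** The test functions are differences of ramps at [x] and [y]: the terms with derivatives of ramps
    converge to point values of the continuous representative, the others to integrals of $a(g,h)$
    beyond [x] and beyond [y]. *)
Lemma sderiv_increment v g vc h x y : is_sderiv v g -> continuous_rep v vc -> nmem E h ->
  0 <= x <= 1 -> 0 <= y <= 1 ->
  a (vc y) h - a (vc x) h = prim (fun s => a (g s) h) y - prim (fun s => a (g s) h) x.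
Proof.
move=> sd rep mh x01 y01; have [mv mg _] := sd; have [mvc cvc aevc] := rep.
have [pv _ _] := mv; have mI := @I01_measurable R.
have iq := pairing_integrable mv (cst_BochnerL2 mh).
have ip := pairing_integrable mg (cst_BochnerL2 mh).
have qqc : {ae mu, forall s, 0 < s < 1 -> a (v s) h = a (vc s) h}.
  apply: (ae_sub aevc) => s hs s01; apply: form_null => //; last exact: hs.
    exact: pv.
  by apply: mvc; case/andP : s01 => ? ?; rewrite !ltW.
have cq (z : R) (z01 : 0 <= z <= 1) := rep_form_cvg rep mh z01.
pose A z k := \int[mu]_(s in I01) (derive1 (ramp (lam R k) (xlam z k)) s * a (v s) h).
pose B z k := \int[mu]_(s in I01) (ramp (lam R k) (xlam z k) s * a (g s) h).
have L1 : A x k - A y k @[k --> \oo] --> a (vc x) h - a (vc y) h.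
  exact: (cvgB (ramp_delta_cvg (qc := fun s => a (vc s) h) x01 iq qqc (cq _ x01))
    (ramp_delta_cvg (qc := fun s => a (vc s) h) y01 iq qqc (cq _ y01))).
have L2 : - (B x k - B y k) @[k --> \oo] --> - ((\int[mu]_(s in I01) a (g s) h - prim (fun s => a (g s) h) x)
     - (\int[mu]_(s in I01) a (g s) h - prim (fun s => a (g s) h) y)).
  by apply: cvgN; exact: (cvgB (ramp_cut_cvg x01 ip) (ramp_cut_cvg y01 ip)).
have E12 : (fun k => A x k - A y k) = (fun k => - (B x k - B y k)).
  by apply/funext => k; exact: sderiv_ramp.
rewrite E12 in L1.
have H := seq_cvg_unique L1 L2.
by rewrite -[LHS]opprB H; ring.
Qed.

Lemma sderiv_increment_sqr v g vc x y : is_sderiv v g -> continuous_rep v vc ->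
  0 <= x <= 1 -> 0 <= y <= 1 ->
  a (vc y) (vc y) - a (vc x) (vc x) =
    prim (fun s => a (g s) (vc y + vc x)) y - prim (fun s => a (g s) (vc y + vc x)) x.
Proof.
move=> sd rep x01 y01; have [mvc _ _] := rep.
have mx := mvc _ x01; have my := mvc _ y01; have ms := si_memD hb my mx.
rewrite -(sderiv_increment sd rep ms x01 y01) !(si_Dr ha)// (si_sym ha my mx); ring.
Qed.

Lemma eps_zero (x M : R) : 0 <= M -> (forall e : R, 0 < e -> `|x| <= e * M) -> x = 0.
Proof.
move=> M0 h; apply/eqP; rewrite -normr_le0 leNgt; apply/negP => x0.
have M1 : 0 < M + 1 by rewrite ltr_wpDl.
have e0 : 0 < `|x| / (2 * (M + 1)) by rewrite divr_gt0// mulr_gt0.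
have := h _ e0; rewrite mulrAC ler_pdivlMr ?mulr_gt0// ler_pM2l//; lra.
Qed.

(** With the weight $\rho(r)=c_0+c_1r$, the first two terms are the density whose integral over
    $]x,y[$ is the increment of $\rho\,a(v,v)$, and the bracket is the integrand that the chain rule
    predicts. Continuity of [v] at [s] makes them differ by little, relative to the integrable
    function $1+b(g,g)$. *)
Lemma sderiv_local_bound v g vc (c0 c1 e s : R) : is_sderiv v g -> continuous_rep v vc ->
  0 < e -> 0 <= s <= 1 ->
  exists2 d : R, 0 < d & forall x y r, 0 <= x <= 1 -> 0 <= y <= 1 -> 0 < r < 1 ->
    `|s - x| < d -> `|s - y| < d -> `|s - r| < d ->
    `|(c0 + c1 * y) * a (g r) (vc y + vc x) + c1 * a (vc x) (vc x)
       - (2 * ((c0 + c1 * r) * a (vc r) (g r)) + c1 * a (vc r) (vc r))|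
    <= e * (1 + b (g r) (g r)).
Proof.
move=> [_ [pg _ _] _] rep e0 s01; have [mvc _ _] := rep.
set m := si_norm b (vc s); have m0 : 0 <= m by exact: si_norm_ge0.
pose B := `|c0| + `|c1| + 1.
have B1 : 1 <= B by rewrite lerDr addr_ge0.
have B0 : 0 < B by exact: lt_le_trans B1.
have k0 : 0 < 2 * B * (4 * m + 6) by rewrite !mulr_gt0// ltr_wpDl// mulr_ge0.
(* Near [s] the representative has norm at most $m+1$ and [B] bounds the weight and its slope. Each
   of the three terms of the difference then carries a factor [eta], and $2B(4m+6)$ bounds the sum
   of the constants. *)
pose eta := Num.min 1 (e / (2 * B * (4 * m + 6))).
have eta0 : 0 < eta by rewrite lt_min ltr01 divr_gt0.
have eta1 : eta <= 1 by rewrite ge_min lexx.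
have etae : eta * (2 * B * (4 * m + 6)) <= e.
  by rewrite -ler_pdivlMr// ge_min lexx orbT.
have [d d0 hd] := continuous_rep_near rep s01 eta0.
exists (Num.min d (eta / 2)); first by rewrite lt_min d0 divr_gt0.
move=> x y r x01 y01 r01 sx sy sr.
have {}r01' : 0 <= r <= 1 by case/andP: r01 => ? ?; rewrite !ltW.
move: sx sy sr; rewrite !lt_min => /andP[sx _] /andP[sy sy'] /andP[sr sr'].
have [mx my mr ms] := And4 (mvc _ x01) (mvc _ y01) (mvc _ r01') (mvc _ s01).
have mg := pg _ r01.
have hx := hd _ x01 sx; have hy := hd _ y01 sy; have hr := hd _ r01' sr.
have nb u : nmem E u -> si_norm b (u - vc s) <= eta -> si_norm b u <= m + 1.
  move=> mu_ hu; have := si_normD hb (si_memB hb mu_ ms) ms; rewrite subrK -/m; lra.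
have nx := nb _ mx hx; have ny := nb _ my hy; have nr := nb _ mr hr.
have dd u w : nmem E u -> nmem E w -> si_norm b (u - vc s) <= eta -> si_norm b (w - vc s) <= eta ->
    si_norm b (u - w) <= 2 * eta.
  move=> mu_ mw hu hw; have mB1 := si_memB hb mu_ ms; have mB2 := si_memB hb mw ms.
  by have := si_normB hb mB1 mB2; rewrite opprB addrA subrK; lra.
have dyr := dd _ _ my mr hy hr; have dxr := dd _ _ mx mr hx hr.
set n := si_norm b (g r); have n0 : 0 <= n by exact: si_norm_ge0.
have E1 : (c0 + c1 * y) * a (g r) (vc y + vc x) + c1 * a (vc x) (vc x)
       - (2 * ((c0 + c1 * r) * a (vc r) (g r)) + c1 * a (vc r) (vc r)) =
  c1 * ((y - r) * a (g r) (vc y + vc x)) + (c0 + c1 * r) * a (g r) ((vc y - vc r) + (vc x - vc r))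
  + c1 * a (vc x - vc r) (vc x + vc r).
  have mxr := si_memD hb mx mr.
  have [m1 m2] := (si_memB hb my mr, si_memB hb mx mr).
  rewrite (si_Bl ha)// (si_Dr ha my mx mg) (si_Dr ha m1 m2 mg) (si_Br ha my mr mg) (si_Br ha mx mr mg).
  by rewrite (si_Dr ha mx mr mx) (si_Dr ha mx mr mr) (si_sym ha mr mg) (si_sym ha mr mx); ring.
have mxy := si_memD hb my mx.
have q1 : `|a (g r) (vc y + vc x)| <= n * (2 * (m + 1)).
  apply: (le_trans (form_cs mg mxy)); rewrite ler_wpM2l//.
  by apply: (le_trans (si_normD hb my mx)); lra.
have m1 := si_memB hb my mr; have m2 := si_memB hb mx mr; have m3 := si_memD hb m1 m2.
have q2 : `|a (g r) ((vc y - vc r) + (vc x - vc r))| <= n * (4 * eta).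
  apply: (le_trans (form_cs mg m3)); rewrite ler_wpM2l//.
  by apply: (le_trans (si_normD hb m1 m2)); lra.
have m4 := si_memD hb mx mr.
have q3 : `|a (vc x - vc r) (vc x + vc r)| <= 2 * eta * (2 * (m + 1)).
  apply: (le_trans (form_cs m2 m4)); apply: ler_pM; rewrite ?si_norm_ge0//.
  by apply: (le_trans (si_normD hb mx mr)); lra.
have yr : `|y - r| <= eta.
  have -> : y - r = (s - r) - (s - y) by ring.
  by apply: (le_trans (ler_normB _ _)); lra.
have cB : `|c1| <= B by rewrite /B -[leLHS]add0r -addrA lerD// lerDl.
have rB : `|c0 + c1 * r| <= B.
  apply: (le_trans (ler_normD _ _)); rewrite normrM.
  have : `|c1| * `|r| <= `|c1| by rewrite ler_piMr// ger0_norm; case/andP: r01'.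
  by rewrite /B; lra.
have nn : n ^+ 2 = b (g r) (g r) by exact: (si_norm_sqr hb mg).
rewrite E1 -nn; apply: (le_trans (ler_normD _ _)).
apply: (le_trans (lerD (ler_normD _ _) (lexx _))); rewrite !normrM.
apply: (@le_trans _ _ (B * (eta * (n * (2 * (m + 1)))) + B * (n * (4 * eta)) + B * (2 * eta * (2 * (m + 1))))).
  apply: lerD; last exact: ler_pM.
  by apply: lerD; apply: ler_pM => //; exact: ler_pM.
have -> : B * (eta * (n * (2 * (m + 1)))) + B * (n * (4 * eta)) + B * (2 * eta * (2 * (m + 1)))
   = eta * B * (n * (2 * m + 6) + (4 * m + 4)) by ring.
apply: (@le_trans _ _ (eta * B * (2 * (4 * m + 6) * (1 + n ^+ 2)))).
  rewrite ler_wpM2l ?mulr_ge0 ?ltW//.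
  have h1 := sqr_ge0 (n - 1); have h2 : 0 <= m * n by rewrite mulr_ge0.
  have h3 : 0 <= m * (n - 1) ^+ 2 by rewrite mulr_ge0 ?sqr_ge0.
  by move: h1 h2 h3; rewrite !sqrrB !expr1n mulr1; nra.
have -> : eta * B * (2 * (4 * m + 6) * (1 + n ^+ 2)) = eta * (2 * B * (4 * m + 6)) * (1 + n ^+ 2) by ring.
by rewrite ler_wpM2r// addr_ge0// sqr_ge0.
Qed.

(* a(v, v) increases by a(v(y) - v(x), v(y) + v(x)), the integral of a(g, v(y) + v(x))
   over ]x, y[; the local errors are summed by Cousin's lemma. *)
Lemma sderiv_weighted_sqr v g vc (c0 c1 : R) : is_sderiv v g -> continuous_rep v vc ->
  2 * wform a (fun s => c0 + c1 * s) v g =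
    (c0 + c1) * a (vc 1) (vc 1) - c0 * a (vc 0) (vc 0) - c1 * wform a (fun=> 1) v v.
Proof.
move=> sd rep; have [mv mg _] := sd; have [mvc _ aevc] := rep.
have [pv _ _] := mv; have [pg _ _] := mg; have mI := @I01_measurable R.
pose rho s : R := c0 + c1 * s.
have crho : continuous rho.
  have -> : rho = (fun s => c1 * s + c0) by apply/funext => s; rewrite addrC.
  exact: C1_continuous (@C1_affine R c1 c0).
have i1 := continuous_mul_integrable crho (pairing_integrable mv mg).
have i2 : mu.-integrable I01 (EFin \o (fun s => 1 * a (v s) (v s))).
  by have := pairing_integrable mv mv; congr (mu.-integrable _ _); apply/funext => s /=; rewrite mul1r.
have i3 := integrableZl mI c1 i2.
pose f s : R := 2 * (rho s * a (v s) (g s)) + c1 * (1 * a (v s) (v s)).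
have fi : mu.-integrable I01 (EFin \o f) := integrableD mI (integrableZl mI 2 i1) i3.
have fE : \int[mu]_(s in I01) f s = 2 * wform a rho v g + c1 * wform a (fun=> 1) v v.
  rewrite /f RintegralD//; last exact: (integrableZl mI 2 i1).
  by congr (_ + _); rewrite RintegralZl.
have i01 : mu.-integrable I01 (EFin \o (fun=> 1 : R)).
  exact: (continuous_integrable01 (@continuous_cst R 1)).
have hbb u : nmem E u -> b u u <= b u u by [].
have igg : mu.-integrable I01 (EFin \o (fun s => b (g s) (g s))).
  by have [] := (BochnerL2P hb hn g).1 mg.
have iw := integrableD mI i01 igg.
pose w s : R := 1 + b (g s) (g s).
have w0 s : 0 < s < 1 -> 0 <= w s by move=> s01; rewrite addr_ge0// (si_ge0 hb)//; exact: pg.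
pose N x := a (vc x) (vc x).
suff : (rho 1 * N 1 - rho 0 * N 0) - (prim f 1 - prim f 0) = 0.
  rewrite prim1 prim0 subr0 fE /rho mulr0 addr0 mulr1 /N; lra.
have W0 : 0 <= \int[mu]_(s in I01) w s by apply: Rintegral_ge0 => s /I01P; exact: w0.
apply: (eps_zero W0) => e e0.
pose we s := e * w s.
have iwe : mu.-integrable I01 (EFin \o we) := integrableZl mI e iw.
have we0 s : 0 < s < 1 -> 0 <= we s by move=> s01; apply: mulr_ge0; [exact: ltW|exact: w0].
have -> : e * \int[mu]_(s in I01) w s = prim we 1 - prim we 0.
  by rewrite prim1 prim0 subr0 /we RintegralZl.
pose Q x y := `|(rho y * N y - rho x * N x) - (prim f y - prim f x)| <= prim we y - prim we x.
change (Q 0 1); apply: (@cousin R Q) => [x y z _ _ _ _|s s01].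
  by rewrite /Q !ler_norml => /andP[h1 h2] /andP[h3 h4]; apply/andP; split; lra.
have [d d0 hd] := sderiv_local_bound c0 c1 sd rep e0 s01.
exists d => // x y x0 y1 xs sy xd yd; rewrite /Q.
have xy := le_trans xs sy.
have x01 : 0 <= x <= 1 by rewrite x0 (le_trans xy).
have y01 : 0 <= y <= 1 by rewrite (le_trans x0 xy).
have mxy := si_memD hb (mvc _ y01) (mvc _ x01).
pose h s := a (g s) (vc y + vc x).
have ih : mu.-integrable I01 (EFin \o h) := pairing_integrable mg (cst_BochnerL2 mxy).
(* The density of the local error. The factor $1$ and the final $0$ only bring it to the shape
   [c * f s + g s] required by [prim_lin]. *)
pose F s := rho y * h s + (c1 * N x * 1 + (-1 * f s + 0)).
have i0 : mu.-integrable I01 (EFin \o (fun=> 0 : R)).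
  exact: (continuous_integrable01 (@continuous_cst R 0)).
have ifz := integrableD mI (integrableZl mI (-1) fi) i0.
have ifz1 := integrableD mI (integrableZl mI (c1 * N x) i01) ifz.
have iF : mu.-integrable I01 (EFin \o F) := integrableD mI (integrableZl mI (rho y) ih) ifz1.
have pF (z : R) : 0 <= z <= 1 -> prim F z = rho y * prim h z + (c1 * N x * z + - prim f z).
  move=> z01; rewrite /F prim_lin// prim_lin// prim_lin// prim_one//.
  have -> : prim (fun=> 0) z = 0 :> R.
    by rewrite /prim; under eq_Rintegral do rewrite mulr0; rewrite Rintegral_cst// mul0r.
  by ring.
have -> : (rho y * N y - rho x * N x) - (prim f y - prim f x) = prim F y - prim F x.
  rewrite !pF//; have := sderiv_increment_sqr sd rep x01 y01; rewrite -/h -/(N y) -/(N x) => H.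
  have -> : N y = N x + (prim h y - prim h x) by rewrite -H; ring.
  by rewrite /rho; ring.
apply: prim_le => //; apply: (ae_sub aevc) => t ht t01 xt ty.
have t01' : 0 <= t <= 1 by case/andP: t01 => ? ?; rewrite !ltW.
have mt := mvc _ t01'; have mvt := pv _ t01; have mgt := pg _ t01; have et := ht t01.
have := hd x y t x01 y01 t01.
rewrite /we /w /F /f /h -(form_null mvt mt mgt et) -(form_null2 mvt mt et) -/(N x) -/(rho t) -/(rho y).
have -> : rho y * a (g t) (vc y + vc x) + (c1 * N x * 1 + (-1 * (2 * (rho t * a (v t) (g t)) + c1 * (1 * a (v t) (v t))) + 0))
  = rho y * a (g t) (vc y + vc x) + c1 * N x - (2 * (rho t * a (v t) (g t)) + c1 * a (v t) (v t)) by ring.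
apply.
- by apply: dist_lt => //; exact: le_lt_trans yd.
- by apply: dist_lt => //; apply: lt_le_trans sy; rewrite ltrBlDr ltrDl.
- by apply: dist_lt; [exact: lt_trans xt|exact: le_lt_trans yd].
Qed.

(** Needed because the traces at $s=0$ and $s=1$ each come with their own continuous representative.
    The two agree with [v] almost everywhere, hence at points arbitrarily close to [z]. *)
Lemma continuous_rep_unique v vc wc (z : R) : pmem v -> continuous_rep v vc -> continuous_rep v wc ->
  0 <= z <= 1 -> nnorm E (vc z - wc z) = 0.
Proof.
move=> pv rv rw z01; have [mvc _ av] := rv; have [mwc _ aw] := rw.
have mz := mvc _ z01; have mz' := mwc _ z01; rewrite hn; last exact: (si_memB hb).
apply: (@eps_zero _ 2) => // e e0; rewrite ger0_norm ?si_norm_ge0//.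
have [d1 d10 h1] := continuous_rep_near rv z01 e0.
have [d2 d20 h2] := continuous_rep_near rw z01 e0.
have aevw : {ae mu, forall s, 0 < s < 1 -> nnorm E (v s - vc s) = 0 /\ nnorm E (v s - wc s) = 0}.
  move: av aw => [N1 [mN1 N10 h1']] [N2 [mN2 N20 h2']]; exists (N1 `|` N2); split.
  - exact: measurableU.
  - exact: null_set_setU.
  move=> s /= ns; have [n1|n1] := pselect (N1 s); [by left|right].
  apply: h2' => /= w0; apply: ns => s01; split; last exact: w0.
  by apply: contrapT => n2; apply: n1; apply: h1' => /= /(_ s01).
pose lo := Num.max 0 (z - Num.min d1 d2); pose hi := Num.min 1 (z + Num.min d1 d2).
have d0 : 0 < Num.min d1 d2 by rewrite lt_min d10.
have lohi : lo < hi.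
  case/andP: z01 => z0 z1; rewrite gt_max !lt_min ltr01 /=; apply/andP; split; first lra.
  apply/andP; split; lra.
have [s /andP[sl sh] hs] := ae_point aevw lohi.
move: sl sh; rewrite gt_max lt_min => /andP[s0 sl] /andP[s1 sh].
have s01 : 0 < s < 1 by rewrite s0.
have s01' : 0 <= s <= 1 by rewrite !ltW.
have [e1 e2] := hs s01.
have zs : `|z - s| < Num.min d1 d2 by exact: dist_lt.
move: zs; rewrite lt_min => /andP[/(h1 _ s01') q1 /(h2 _ s01') q2].
have ms := mvc _ s01'; have ms' := mwc _ s01'; have mv := pv _ s01.
have m1 := si_memB hb mv ms; have m2 := si_memB hb mv ms'.
rewrite hn// in e1; rewrite hn// in e2.
have n1 := si_normB hb m2 m1; rewrite e1 e2 addr0 opprB [X in si_norm b X]addrC addrA subrK in n1.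
have m3 := si_memB hb ms mz; have m4 := si_memB hb ms' mz'; have m5 := si_memB hb m4 m3.
have m6 := si_memB hb ms ms'.
have n2 := si_normB hb m4 m3; have n3 := si_normD hb m5 m6.
have e3 : ((wc s - wc z) - (vc s - vc z)) + (vc s - wc s) = vc z - wc z.
  by rewrite opprB -addrA (addrA (vc z - vc s)) subrK addrC addrA subrK.
by rewrite e3 in n3; lra.
Qed.

Lemma sderiv_strace_weighted_sqr v g (x z : E) (c0 c1 : R) : is_sderiv v g ->
  has_strace v 0 x -> has_strace v 1 z ->
  2 * wform a (fun s => c0 + c1 * s) v g =
    (c0 + c1) * a z z - c0 * a x x - c1 * wform a (fun=> 1) v v.
Proof.
move=> sd [mx [vc [m1 k1 ae1 e1]]] [mz [wc [m2 k2 ae2 e2]]].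
have i0 : 0 <= (0 : R) <= 1 by rewrite lexx ler01.
have i1 : 0 <= (1 : R) <= 1 by rewrite lexx ler01.
have [[pv _ _] _ _] := sd.
have rv : continuous_rep v vc by []; have rw : continuous_rep v wc by [].
rewrite (sderiv_weighted_sqr _ _ sd rv) -(form_null2 (m1 _ i0) mx e1) -(form_null2 (m2 _ i1) mz e2).
by rewrite (form_null2 (m1 _ i1) (m2 _ i1) (continuous_rep_unique pv rv rw i1)).
Qed.

End sderiv.

(** * Semigroups with a dissipative generator *)

Section right_calculus.
Context (R : realType).
Implicit Types (f psi : R -> R) (s t x y e d : R).

Lemma cvg_right0P f : f h @[h --> 0^'+] --> (0 : R) <->
  forall e, 0 < e -> exists2 d, 0 < d & forall h, 0 < h < d -> `|f h| < e.
Proof.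
split=> [hf e e0|hf].
  move/cvgrPdist_lt : hf => /(_ _ e0) [d /= d0 hd]; exists d => // h /andP[h0 hd'].
  by have := hd h; rewrite /= !sub0r !normrN gtr0_norm//; apply.
apply/cvgrPdist_lt => e e0; have [d d0 hd] := hf _ e0.
exists d => //= h hd' h0; rewrite sub0r normrN; apply: hd; rewrite h0 /=.
by move: hd'; rewrite /= sub0r normrN gtr0_norm.
Qed.

(** For a small slope [e], the supremum of the times at which $\psi(t)\le\psi(0)+et$ is attained by
    the condition from the left, and it must be [b], since the condition from the right would carry
    the inequality further. *)
Lemma dini_nonincreasing psi (b : R) : 0 <= b ->
  (forall t e, 0 <= t < b -> 0 < e -> exists2 d, 0 < d & forall h, 0 < h < d -> psi (t + h) <= psi t + e * h) ->
  (forall t e, 0 < t <= b -> 0 < e -> exists2 d, 0 < d & forall s, 0 <= s -> t - d < s <= t -> psi t <= psi s + e) ->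
  psi b <= psi 0.
Proof.
move=> b0 right left; apply/ler_addgt0Pr => e0 e00.
pose e := e0 / (b + 1); have b1 : 0 < b + 1 by rewrite ltr_wpDl.
have e_gt0 : 0 < e by rewrite divr_gt0.
pose S : set R := [set t | 0 <= t <= b /\ psi t <= psi 0 + e * t].
have S0 : S 0 by split; [rewrite lexx|rewrite mulr0 addr0].
have hsup : has_sup S by split; [exists 0|exists b => t [/andP[]]].
set c := sup S.
have c0 : 0 <= c by exact: ub_le_sup hsup.2 _ S0.
have cb : c <= b by apply: ge_sup; [exists 0|move=> t [/andP[]]].
have Sc : psi c <= psi 0 + e * c.
  have [->|nc0] := eqVneq c 0; first by rewrite mulr0 addr0.
  have cgt0 : 0 < c by rewrite lt_neqAle eq_sym nc0.
  apply/ler_addgt0Pr => e1 e10.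
  have cI : 0 < c <= b by rewrite cgt0.
  have [d d0 hd] := left _ _ cI e10.
  have [x [/andP[x0 xb] Sx] xc] := sup_adherent d0 hsup.
  have xle : x <= c by apply: (ub_le_sup hsup.2); split=> //; rewrite x0.
  have xI : c - d < x <= c by rewrite xc.
  apply: (le_trans (hd x x0 xI)); rewrite lerD2r; apply: (le_trans Sx).
  by rewrite lerD2l ler_pM2l.
have [e1|n1] := eqVneq c b.
  rewrite -{1}e1; apply: (le_trans Sc); rewrite lerD2l e1 /e mulrAC ler_pdivrMr//.
  by rewrite ler_pM2l// lerDl.
have cltb : c < b by rewrite lt_neqAle n1.
have cI : 0 <= c < b by rewrite c0.
have [d d0 hd] := right _ _ cI e_gt0.
pose h := Num.min (d / 2) (b - c).
have h0 : 0 < h by rewrite lt_min divr_gt0//= subr_gt0.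
have hd' : h < d by rewrite gt_min; apply/orP; left; lra.
have hb : h <= b - c by rewrite ge_min lexx orbT.
have : c + h <= c.
  apply: (ub_le_sup hsup.2); split; first by apply/andP; split; lra.
  have hI : 0 < h < d by rewrite h0.
  by have := hd _ hI; rewrite mulrDr; lra.
lra.
Qed.

End right_calculus.

(** * Continuity of orbits and decay of a form along a semigroup *)

Section semigroup.
Context (R : realType) (H : nspace R) (B : H -> H -> R).
Hypotheses (hB : semi_inner (nmem H) B)
  (hn : forall u, nmem H u -> nnorm H u = si_norm B u).
Context (T : R -> H -> H) (hT : C0_semigroup T).
Implicit Types (u w : H) (t s h e d : R).
Local Notation N := (si_norm B).

Lemma sg_mem t u : 0 <= t -> nmem H u -> nmem H (T t u).
Proof. exact: (semigroup_mem hT). Qed.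

Lemma sg_linear t (a : R) u w : 0 <= t -> nmem H u -> nmem H w ->
  N (T t (a *: u + w) - (a *: T t u + T t w)) = 0.
Proof.
move=> t0 mu mw; rewrite -hn; first exact: (semigroup_linear hT).
apply: (si_memB hB); first exact/sg_mem/(si_lin hB).
by apply: (si_lin hB); exact: sg_mem.
Qed.

Lemma sg_bounded t : 0 <= t -> exists2 M : R, 0 <= M & forall u, nmem H u -> N (T t u) <= M * N u.
Proof.
move=> t0; have [M hM] := semigroup_bounded hT t0; exists `|M| => // u mu.
have := hM _ mu; rewrite !hn//; last exact: sg_mem.
by move=> /le_trans; apply; rewrite ler_wpM2r ?si_norm_ge0// ler_norm.
Qed.

Lemma N_eq u w : nmem H u -> nmem H w -> N (u - w) = 0 -> N u = N w.
Proof. exact: si_norm_eq. Qed.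

Lemma sg_zero t : 0 <= t -> N (T t 0) = 0.
Proof.
move=> t0; have [M M0 hM] := sg_bounded t0; have m0 := si_mem0 hB.
by apply/eqP; rewrite eq_le si_norm_ge0 andbT; have := hM _ m0; rewrite (si_norm0 hB) mulr0.
Qed.

Lemma N_trans u v w : nmem H u -> nmem H v -> nmem H w -> N (u - v) = 0 -> N (v - w) = 0 -> N (u - w) = 0.
Proof.
move=> mu mv mw h1 h2; apply/eqP; rewrite eq_le si_norm_ge0 andbT.
have := si_normD hB (si_memB hB mu mv) (si_memB hB mv mw).
by rewrite h1 h2 addr0 addrA subrK.
Qed.

Lemma sg_sub t u w : 0 <= t -> nmem H u -> nmem H w -> N (T t (u - w) - (T t u - T t w)) = 0.
Proof.
move=> t0 mu mw; have := sg_linear (-1) t0 mw mu.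
by rewrite !scaleN1r [- w + u]addrC [- T t w + _]addrC.
Qed.

Lemma sg_scale t (a : R) u : 0 <= t -> nmem H u -> N (T t (a *: u) - a *: T t u) = 0.
Proof.
move=> t0 mu; have m0 := si_mem0 hB; have mTu := sg_mem t0 mu; have mT0 := sg_mem t0 m0.
have ma := si_memZ hB a mTu.
have mz : nmem H (T t (a *: u)) by exact/sg_mem/(si_memZ hB).
apply: (N_trans mz (si_memD hB ma mT0) ma).
  by have := sg_linear a t0 mu m0; rewrite addr0.
by rewrite [_ + T t 0]addrC addrK; exact: sg_zero.
Qed.

Lemma sg_lip t : 0 <= t -> exists2 M : R, 0 <= M & forall u w, nmem H u -> nmem H w ->
  N (T t u - T t w) <= M * N (u - w).
Proof.
move=> t0; have [M M0 hM] := sg_bounded t0; exists M => // u w mu mw.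
have m := si_memB hB mu mw.
have m1 := sg_mem t0 m; have m2 := si_memB hB (sg_mem t0 mu) (sg_mem t0 mw).
by rewrite -(N_eq m1 m2 (sg_sub t0 mu mw)); exact: hM.
Qed.

Lemma sg_comp t s u : 0 <= t -> 0 <= s -> nmem H u -> N (T (t + s) u - T t (T s u)) = 0.
Proof.
move=> t0 s0 mu; rewrite -hn; first exact: (semigroup_comp hT).
have ts : 0 <= t + s by exact: addr_ge0.
by apply: (si_memB hB); [exact: sg_mem|apply: sg_mem => //; exact: sg_mem].
Qed.

Lemma sg_cont0 u : nmem H u -> forall e, 0 < e ->
  exists2 d, 0 < d & forall h, 0 < h < d -> N (T h u - u) < e.
Proof.
move=> mu e e0; have /cvg_right0P/(_ _ e0)[d d0 hd] := semigroup_cont hT mu.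
exists d => // h hI; have /andP[h0 _] := hI; have := hd _ hI.
have m : nmem H (T h u - u) by apply: (si_memB hB) => //; apply: sg_mem => //; exact: ltW.
by rewrite hn// ger0_norm ?si_norm_ge0.
Qed.

(** The semigroup law holds only up to null vectors, so it cannot be rewritten inside an element; it
    is applied inside the norm of a difference instead. *)
Lemma sg_norm_sum t s u w : 0 <= t -> 0 <= s -> nmem H u -> nmem H w ->
  N (T (t + s) u - w) = N (T t (T s u) - w).
Proof.
move=> t0 s0 mu mw; have ts : 0 <= t + s by exact: addr_ge0.
have m1 := sg_mem ts mu; have m2 := sg_mem t0 (sg_mem s0 mu).
apply: N_eq; try exact: (si_memB hB).
by rewrite opprB addrA subrK; exact: sg_comp.
Qed.

Lemma sg_norm_sum2 t q s u : 0 <= t -> 0 <= q -> 0 <= s -> nmem H u ->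
  N (T (t + q) u - T (t + s) u) = N (T t (T q u) - T t (T s u)).
Proof.
move=> t0 q0 s0 mu; have ts : 0 <= t + s by exact: addr_ge0.
have m1 := sg_mem ts mu; have m2 := sg_mem t0 (sg_mem q0 mu).
rewrite (sg_norm_sum t0 q0 mu m1) (si_normBC hB m2 m1) (sg_norm_sum t0 s0 mu m2).
by rewrite (si_normBC hB)//; apply: sg_mem => //; exact: sg_mem.
Qed.

Lemma orbit_right_cont u t : nmem H u -> 0 <= t -> forall e, 0 < e ->
  exists2 d, 0 < d & forall h, 0 <= h < d -> N (T (t + h) u - T t u) < e.
Proof.
move=> mu t0 e e0; have mt := sg_mem t0 mu.
have [d d0 hd] := sg_cont0 mt e0; exists d => // h /andP[].
rewrite le_eqVlt => /predU1P[<-|h0] hd'.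
  by rewrite addr0 subrr (si_norm0 hB).
by rewrite [t + h]addrC (sg_norm_sum (ltW h0) t0 mu mt); apply: hd; rewrite h0.
Qed.

(** Baire's theorem on the real line: the set where the oscillation of the orbit is below $1/(k+1)$
    is open, and it is dense because right continuity at [t] makes the orbit nearly constant on an
    interval just after [t]. *)
Lemma orbit_continuity_point u (x y : R) : nmem H u -> 0 <= x -> x < y ->
  exists2 s, x < s < y & forall e, 0 < e -> exists2 d, 0 < d &
    forall r, 0 <= r -> `|s - r| < d -> N (T r u - T s u) < e.
Proof.
move=> mu x0 xy.
(* The orbit is prolonged to negative times by its value at $0$, which makes it right-continuous on
   the whole line, the space to which Baire's theorem is applied. *)
pose f (t : R) := T (Num.max 0 t) u.
have mf t : nmem H (f t) by apply: sg_mem => //; rewrite le_max lexx.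
pose F (k : nat) : set R^o := [set t | exists2 d, 0 < d & forall r r', `|t - r| < d -> `|t - r'| < d ->
  N (f r - f r') < k.+1%:R^-1].
have odF k : open (F k) /\ dense (F k).
  split.
    rewrite openE => t [d d0 hd]; exists (d / 2); first by rewrite /= divr_gt0.
    move=> t' /= tt'; exists (d / 2); first by rewrite divr_gt0.
    move=> r r' h1 h2; apply: hd.
      have -> : t - r = (t - t') + (t' - r) by ring.
      by apply: (le_lt_trans (ler_normD _ _)); rewrite /ball_ /= in tt'; lra.
    have -> : t - r' = (t - t') + (t' - r') by ring.
    by apply: (le_lt_trans (ler_normD _ _)); rewrite /ball_ /= in tt'; lra.
  move=> O [t Ot] oO.
  have [d /= d0 hd] : nbhs t O by exact: open_nbhs_nbhs.
  have e0 : 0 < (k.+1%:R^-1 : R) / 2 by rewrite divr_gt0// invr_gt0 ltr0n.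
  have tm : 0 <= Num.max 0 t by rewrite le_max lexx.
  have [d' d'0 hd'] := orbit_right_cont mu tm e0.
  pose m := Num.min d d' / 2.
  have m0 : 0 < m by rewrite divr_gt0// lt_min d0.
  have m20 : 0 < m / 2 by rewrite divr_gt0.
  have md : m / 2 < d /\ m < d'.
    have h1 : Num.min d d' <= d by rewrite ge_min lexx.
    have h2 : Num.min d d' <= d' by rewrite ge_min lexx orbT.
    by move: m0; rewrite /m => m0; split; lra.
  exists (t + m / 2); split.
    apply: hd => /=; rewrite opprD addrA subrr sub0r normrN gtr0_norm//.
    by case: md.
  exists (m / 2) => //.
  have near r : `|t + m / 2 - r| < m / 2 -> N (f r - f t) < k.+1%:R^-1 / 2.
    rewrite ltr_norml => /andP[h1 h2].
    have -> : f r = T (Num.max 0 t + (Num.max 0 r - Num.max 0 t)) u by rewrite addrC subrK.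
    apply: hd'; rewrite subr_ge0; apply/andP; split.
      by rewrite ge_max le_max lexx /= le_max; apply/orP; right; lra.
    by case: (leP 0 r); case: (leP 0 t); lra.
  move=> r r' /near h1 /near h2.
  have := si_normB hB (si_memB hB (mf r) (mf t)) (si_memB hB (mf r') (mf t)).
  rewrite opprB addrA subrK => /le_lt_trans; apply.
  by rewrite [ltRHS]splitr; exact: ltrD.
have [] := Baire odF (O := `]x, y[%classic).
- by exists ((x + y) / 2); rewrite /= in_itv /=; apply/andP; split; lra.
- exact: itv_open.
move=> s [/=]; rewrite in_itv /= => sxy hs; exists s => // e e0.
have [k hk] : exists k, (k.+1%:R^-1 : R) < e.
  have /cvgrPdist_lt/(_ _ e0)[k _ hk] := @cvg_harmonic R; exists k.
  by have := hk k (leqnn k); rewrite sub0r normrN /= gtr0_norm// invr_gt0 ltr0n.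
have [d d0 hd] := hs k I; have s0 : 0 <= s by case/andP: sxy => ? _; lra.
exists d => // r r0 sr; have := hd r s sr; rewrite subrr normr0 => /(_ d0).
by rewrite /f !max_r// => /lt_trans; apply.
Qed.

(* T (t - s) transports continuity at the point s to the point t; no bound on T
   that is uniform near 0 is needed. *)
Lemma orbit_left_cont u t : nmem H u -> 0 < t -> forall e, 0 < e ->
  exists2 d, 0 < d & forall s, 0 <= s -> t - d < s <= t -> N (T s u - T t u) < e.
Proof.
move=> mu t0 e e0.
have [s /andP[s0 st] hs] := orbit_continuity_point mu (lexx 0) t0.
have ts0 : 0 <= t - s by lra.
have [M M0 hM] := sg_lip ts0.
have e1 : 0 < e / (M + 1) by rewrite divr_gt0// ltr_wpDl.
have [d d0 hd] := hs _ e1.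
exists (Num.min d s); first by rewrite lt_min d0.
move=> r r0 /andP[]; rewrite ltrBlDr -ltrBlDl lt_min => /andP[rd rs] rt.
have q0 : 0 <= r - (t - s) by lra.
have s0' := ltW s0.
have [mq ms] := (sg_mem q0 mu, sg_mem s0' mu).
have er : (t - s) + (r - (t - s)) = r by ring.
have et : (t - s) + s = t by ring.
have := sg_norm_sum2 ts0 q0 s0' mu; rewrite er et => ->.
have sq : `|s - (r - (t - s))| < d by rewrite ltr_norml; apply/andP; split; lra.
apply: (le_lt_trans (hM _ _ mq ms)).
apply: (@le_lt_trans _ _ (M * (e / (M + 1)))); first by rewrite ler_wpM2l// ltW// hd.
by rewrite mulrA ltr_pdivrMr ?ltr_wpDl// mulrC ltr_pM2l//; lra.
Qed.

Context (A : H -> H -> Prop) (hA : is_generator A T)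
  (Amem : forall u w, A u w -> nmem H u /\ nmem H w).

Lemma generatorP u w : nmem H u -> nmem H w -> A u w <->
  forall e, 0 < e -> exists2 d, 0 < d & forall h, 0 < h < d -> N (h^-1 *: (T h u - u) - w) < e.
Proof.
move=> mu mw; rewrite (hA mu mw) cvg_right0P; split=> hh e e0; have [d d0 hd] := hh _ e0;
  exists d => // h hI; have := hd _ hI; have /andP[h0 _] := hI;
  have m : nmem H (h^-1 *: (T h u - u) - w).
- by apply: (si_memB hB) => //; apply/(si_memZ hB)/(si_memB hB) => //; apply: sg_mem => //; exact: ltW.
- by rewrite hn// ger0_norm ?si_norm_ge0.
- by apply: (si_memB hB) => //; apply/(si_memZ hB)/(si_memB hB) => //; apply: sg_mem => //; exact: ltW.
- by rewrite hn// ger0_norm ?si_norm_ge0.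
Qed.

(** Up to null vectors [T t] commutes with the difference quotients of the semigroup, and being
    bounded it preserves their limit. *)
Lemma generator_orbit u w t : A u w -> 0 <= t -> A (T t u) (T t w).
Proof.
move=> Auw t0; have [mu mw] := Amem Auw.
apply/generatorP; try exact: sg_mem.
move=> e e0; have [M M0 hM] := sg_lip t0.
have e1 : 0 < e / (M + 1) by rewrite divr_gt0// ltr_wpDl.
have [d d0 hd] := (generatorP mu mw).1 Auw _ e1.
exists d => // h hI; have /andP[h0 _] := hI; have h0' := ltW h0.
have mhu := sg_mem h0' mu; have mtu := sg_mem t0 mu; have mtw := sg_mem t0 mw.
have mD := si_memB hB mhu mu.
have mZ := si_memZ hB h^-1 mD.
have mtD := sg_mem t0 mD; have mtZ := sg_mem t0 mZ.
have mTT := sg_mem h0' mtu.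
have mTt := sg_mem t0 mhu.
have E1 : N (T h (T t u) - T t (T h u)) = 0.
  rewrite -(sg_norm_sum h0' t0 mu mTt) [h + t]addrC.
  rewrite (sg_norm_sum t0 h0' mu mTt) subrr; exact: (si_norm0 hB).
have m1 := si_memB hB mTT mtu; have m2 := si_memB hB mTt mtu.
have E2 : N (h^-1 *: (T h (T t u) - T t u) - h^-1 *: T t (T h u - u)) = 0.
  rewrite -scalerBr (si_normZ hB); last exact: (si_memB hB).
  rewrite (_ : N _ = 0) ?mulr0//; apply: (N_trans m1 m2 mtD).
    by rewrite opprB addrA subrK.
  by rewrite (si_normBC hB)//; exact: sg_sub.
have E3 : N (h^-1 *: T t (T h u - u) - T t (h^-1 *: (T h u - u))) = 0.
  by rewrite (si_normBC hB)//; [exact: sg_scale|exact: (si_memZ hB)].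
have m3 := si_memZ hB h^-1 m1; have m4 := si_memZ hB h^-1 mtD.
have E4 := N_trans m3 m4 mtZ E2 E3.
have -> : N (h^-1 *: (T h (T t u) - T t u) - T t w) = N (T t (h^-1 *: (T h u - u)) - T t w).
  by apply: N_eq; [exact: (si_memB hB)|exact: (si_memB hB)|rewrite opprB addrA subrK].
apply: (le_lt_trans (hM _ _ mZ mw)).
apply: (@le_lt_trans _ _ (M * (e / (M + 1)))); first by rewrite ler_wpM2l// ltW// hd.
by rewrite mulrA ltr_pdivrMr ?ltr_wpDl// mulrC ltr_pM2l//; lra.
Qed.

Context (L : H -> H -> R) (hL : semi_inner (nmem H) L) (K : R) (K0 : 0 <= K)
  (LN : forall u, nmem H u -> si_norm L u <= K * N u).

(** The square is expanded at $T_hu=u+h(w+r)$ with a remainder $r$ of small norm: $L(u,r)$ is small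
    by the Cauchy-Schwarz inequality, and the term quadratic in $h$ is small because $w+r$ stays
    bounded. *)
Lemma generator_dini u w : A u w -> forall e, 0 < e -> exists2 d, 0 < d &
  forall h, 0 < h < d -> L (T h u) (T h u) <= L u u + 2 * h * L u w + e * h.
Proof.
move=> Auw e e0; have [mu mw] := Amem Auw.
pose nu := si_norm L u; pose nw := si_norm L w.
have nu0 : 0 <= nu by exact: si_norm_ge0.
have nw0 : 0 <= nw by exact: si_norm_ge0.
pose eta := Num.min 1 (e / (4 * (nu + 1) * (K + 1))).
have k0 : 0 < 4 * (nu + 1) * (K + 1) by rewrite !mulr_gt0// ltr_wpDl.
have eta0 : 0 < eta by rewrite lt_min ltr01 divr_gt0.
have [d d0 hd] := (generatorP mu mw).1 Auw _ eta0.
have q0 : 0 < 2 * (nw + K) ^+ 2 + 1 by rewrite ltr_wpDl// mulr_ge0// sqr_ge0.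
exists (Num.min d (e / (2 * (nw + K) ^+ 2 + 1))); first by rewrite lt_min d0 divr_gt0.
move=> h /andP[h0]; rewrite lt_min => /andP[hd1 hd2].
have hI : 0 < h < d by rewrite h0.
have mh := sg_mem (ltW h0) mu.
set r := h^-1 *: (T h u - u) - w.
have mr : nmem H r by apply/(si_memB hB) => //; apply/(si_memZ hB)/(si_memB hB).
have Nr : N r < eta := hd _ hI.
have Lr : si_norm L r <= K * eta.
  by apply: (le_trans (LN mr)); rewrite ler_wpM2l// ltW.
have wr : w + r = h^-1 *: (T h u - u) by rewrite /r addrC subrK.
have -> : T h u = u + h *: (w + r).
  by rewrite wr scalerA divff ?gt_eqF// scale1r [u + _]addrC subrK.
have mwr := si_memD hL mw mr.
rewrite (si_polar hL _ mu mwr) (si_Dr hL)//.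
have Lur : L u r <= nu * (K * eta).
  apply: (le_trans (ler_norm _)); apply: (le_trans (si_cs hL mu mr)).
  by rewrite ler_wpM2l.
have eta1 : eta <= 1 by rewrite ge_min lexx.
have nwr : si_norm L (w + r) <= nw + K.
  apply: (le_trans (si_normD hL mw mr)); rewrite lerD2l; apply: (le_trans Lr).
  by rewrite ler_piMr.
have LL : L (w + r) (w + r) <= (nw + K) ^+ 2.
  by rewrite -(si_norm_sqr hL mwr) ler_pXn2r ?nnegrE ?si_norm_ge0// addr_ge0.
have etae : nu * (K * eta) <= e / 4.
  have : eta * (4 * (nu + 1) * (K + 1)) <= e by rewrite -ler_pdivlMr// ge_min lexx orbT.
  have : nu * (K * eta) <= (nu + 1) * ((K + 1) * eta).
    apply: ler_pM => //; first by rewrite mulr_ge0// ltW.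
      by rewrite lerDl.
    by rewrite ler_pM2r// lerDl.
  by set x := nu * (K * eta); rewrite (_ : eta * _ = 4 * ((nu + 1) * ((K + 1) * eta))); [lra|ring].
have hh : h * (nw + K) ^+ 2 <= e / 2.
  move: hd2; rewrite ltr_pdivlMr// => hd2.
  have : 0 <= h * (nw + K) ^+ 2 by rewrite mulr_ge0 ?sqr_ge0 ?ltW.
  lra.
have -> : L u u + 2 * h * (L u w + L u r) + h ^+ 2 * L (w + r) (w + r) =
  L u u + 2 * h * L u w + h * (2 * L u r + h * L (w + r) (w + r)) by ring.
rewrite lerD2l mulrC ler_pM2r//.
have : h * L (w + r) (w + r) <= h * (nw + K) ^+ 2 by rewrite ler_pM2l.
lra.
Qed.

Lemma orbit_form_left_cont u t : nmem H u -> 0 < t -> forall e, 0 < e ->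
  exists2 d, 0 < d & forall s, 0 <= s -> t - d < s <= t -> `|L (T s u) (T s u) - L (T t u) (T t u)| < e.
Proof.
move=> mu t0 e e0; have mt := sg_mem (ltW t0) mu.
pose n := si_norm L (T t u); have n0 : 0 <= n by exact: si_norm_ge0.
pose eta := Num.min 1 (e / (2 * n + 2)).
have k0 : 0 < 2 * n + 2 by rewrite ltr_wpDl// mulr_ge0.
have eta0 : 0 < eta by rewrite lt_min ltr01 divr_gt0.
have eta1 : eta <= 1 by rewrite ge_min lexx.
have etae : eta * (2 * n + 2) <= e by rewrite -ler_pdivlMr// ge_min lexx orbT.
have e1 : 0 < eta / (K + 1) by rewrite divr_gt0// ltr_wpDl.
have [d d0 hd] := orbit_left_cont mu t0 e1.
exists d => // s s0 sI; have ms := sg_mem s0 mu.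
have h1 : si_norm L (T s u - T t u) < eta.
  apply: (le_lt_trans (LN (si_memB hB ms mt))).
  apply: (@le_lt_trans _ _ (K * (eta / (K + 1)))); first by rewrite ler_wpM2l// ltW// hd.
  by rewrite mulrA ltr_pdivrMr ?ltr_wpDl// mulrC ltr_pM2l//; lra.
have := le_lt_trans (si_norm_dist hL ms mt) h1; rewrite -/n.
rewrite -(si_norm_sqr hL ms) -(si_norm_sqr hL mt) -/n subr_sqr normrM => h2.
have : `|si_norm L (T s u) + n| < 2 * n + 2.
  rewrite ger0_norm ?addr_ge0 ?si_norm_ge0//.
  by move: h2; rewrite ltr_norml => /andP[_]; lra.
by move=> h3; apply: lt_le_trans etae; apply: ltr_pM.
Qed.

Context (alpha : R) (alpha0 : 0 < alpha)
  (dissip : forall u w, A u w -> L u w <= - alpha * L u u).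

(** The function $e^{2\alpha s}L(T_su,T_su)$ meets the two conditions of [dini_nonincreasing]: from
    the right by dissipativity at $T_su$, which stays in the domain, and from the left by left
    continuity of the orbit. *)
Lemma domain_decay u w (t : R) : A u w -> 0 <= t ->
  L (T t u) (T t u) <= expR (- 2 * alpha * t) * L u u.
Proof.
move=> Auw t0; have [mu mw] := Amem Auw.
pose psi (s : R) := expR (2 * alpha * s) * L (T s u) (T s u).
have pos s : 0 <= s -> 0 <= L (T s u) (T s u) by move=> s0; apply: (si_ge0 hL); exact: sg_mem.
have L0 : L (T 0 u) (T 0 u) = L u u.
  have m0 := sg_mem (lexx 0) mu.
  rewrite -(si_norm_sqr hL m0) -(si_norm_sqr hL mu); congr (_ ^+ 2).
  apply: (si_norm_eq hL m0 mu); apply/eqP; rewrite eq_le si_norm_ge0 andbT.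
  have m := si_memB hB m0 mu; apply: (le_trans (LN m)).
  by rewrite -hn// (semigroup_id hT)// mulr0.
suff : psi t <= psi 0.
  rewrite /psi mulr0 expR0 mul1r L0 => h.
  by rewrite !mulNr expRN mulrC ler_pdivlMr ?expR_gt0// mulrC.
apply: dini_nonincreasing => // s e.
  move=> /andP[s0 st] e0; have := generator_orbit Auw s0; set z := T s u => Az.
  (* [k] bounds the exponential factor for steps of length at most $1$, so an error $e/k$ in the
     form costs at most $e$ in [psi]. *)
  pose k := expR (2 * alpha * (s + 1)); have k0 : 0 < k by exact: expR_gt0.
  have e1 : 0 < e / k by rewrite divr_gt0.
  have [d d0 hd] := generator_dini Az e1.
  exists (Num.min d 1); first by rewrite lt_min d0 ltr01.
  move=> h /andP[h0]; rewrite lt_min => /andP[h1 h2].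
  have hI : 0 < h < d by rewrite h0.
  have hle := hd _ hI; have dz := dissip Az.
  have sh : 0 <= s + h by rewrite addr_ge0// ltW.
  have Eh : L (T (s + h) u) (T (s + h) u) = L (T h z) (T h z).
    have m1 := sg_mem sh mu; have m2 := sg_mem (ltW h0) (sg_mem s0 mu).
    rewrite -(si_norm_sqr hL m1) -(si_norm_sqr hL m2); congr (_ ^+ 2).
    apply: (si_norm_eq hL m1 m2); apply/eqP; rewrite eq_le si_norm_ge0 andbT.
    have m := si_memB hB m1 m2; apply: (le_trans (LN m)).
    by rewrite [s + h]addrC (sg_norm_sum (ltW h0) s0 mu m2) subrr (si_norm0 hB) mulr0.
  rewrite /psi Eh -/z mulrDr expRD.
  set E1 := expR (2 * alpha * s); set E2 := expR (2 * alpha * h).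
  have E10 : 0 < E1 by exact: expR_gt0.
  have E20 : 0 < E2 by exact: expR_gt0.
  have zz := pos _ s0; rewrite -/z in zz.
  have b1 : L (T h z) (T h z) <= (1 - 2 * alpha * h) * L z z + e / k * h.
    apply: (le_trans hle); rewrite lerD2r.
    have : 2 * h * L z (T s w) <= 2 * h * (- alpha * L z z) by rewrite ler_wpM2l// mulr_ge0// ltW.
    lra.
  have b2 : E2 * (1 - 2 * alpha * h) <= 1.
    have := expR_ge1Dx (- (2 * alpha * h)); rewrite expRN -/E2 -(ler_pM2l E20).
    by rewrite mulfV// gt_eqF.
  have b3 : E1 * E2 <= k.
    rewrite -expRD ler_expR -mulrDr ler_pM2l ?mulr_gt0// lerD2l; exact: ltW.
  have b4 : E1 * E2 * (e / k * h) <= e * h.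
    rewrite (_ : _ * (e / k * h) = E1 * E2 / k * (e * h)); last by ring.
    have eh : 0 <= e * h by apply: mulr_ge0; exact: ltW.
    by rewrite ler_piMl// ler_pdivrMr// mul1r.
  apply: (@le_trans _ _ (E1 * E2 * ((1 - 2 * alpha * h) * L z z + e / k * h))).
    by rewrite ler_pM2l// mulr_gt0.
  rewrite mulrDr; apply: lerD => //.
  rewrite mulrA -[E1 * E2 * _]mulrA -mulrA ler_pM2l// -[leRHS]mul1r; exact: ler_wpM2r.
move=> /andP[s0 st] e0.
pose k := expR (2 * alpha * s); have k0 : 0 < k by exact: expR_gt0.
pose f := L (T s u) (T s u); have f0 : 0 <= f by exact/pos/ltW.
have e1 : 0 < e / (2 * k) by rewrite divr_gt0// mulr_gt0.
have [d d0 hd] := orbit_form_left_cont mu s0 e1.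
have cE : {for s, continuous (fun r : R => expR (2 * alpha * r))}.
  apply: continuous_comp; last exact: continuous_expR.
  by apply: cvgM; [exact: cvg_cst|exact: cvg_id].
(* [f'] bounds the form at times slightly before [s]. Replacing the form and replacing the
   exponential factor then cost $e/2$ each. *)
pose f' := f + e / (2 * k) + 1; have f'0 : 0 < f' by rewrite ltr_wpDl// addr_ge0// ltW.
have e2 : 0 < e / (2 * f') by rewrite divr_gt0// mulr_gt0.
move/cvgrPdist_lt : cE => /(_ _ e2) [d' /= d'0 hd'].
exists (Num.min d d'); first by rewrite lt_min d0.
move=> r r0 /andP[r1 rs].
have rd : s - d < r <= s.
  by rewrite rs andbT; apply: le_lt_trans r1; rewrite lerD2l lerN2 ge_min lexx.
have rd' : `|s - r| < d'.
  rewrite ger0_norm ?subr_ge0// ltrBlDl -ltrBlDr; apply: le_lt_trans r1.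
  by rewrite lerD2l lerN2 ge_min lexx orbT.
have := hd _ r0 rd; rewrite -/f; set g := L (T r u) (T r u); have g0 := pos _ r0; rewrite -/g in g0.
rewrite ltr_norml => /andP[g1 g2]; have := hd' r rd'; rewrite ltr_norml => /andP[x1 x2].
rewrite /psi -/g -/f -/k; set kr := expR (2 * alpha * r) in x1 x2 *.
have gf' : g <= f' by rewrite /f'; lra.
have a1 : k * f <= k * g + e / 2.
  have : k * f <= k * (g + e / (2 * k)) by rewrite ler_pM2l//; lra.
  have -> : k * (g + e / (2 * k)) = k * g + e / 2 by field; rewrite gt_eqF.
  by [].
have a2 : k * g <= kr * g + e / 2.
  have : (k - kr) * g <= e / (2 * f') * f'.
    apply: (@le_trans _ _ (e / (2 * f') * g)); first by rewrite ler_wpM2r// ltW.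
    by rewrite ler_pM2l.
  have -> : e / (2 * f') * f' = e / 2 by field; rewrite gt_eqF.
  lra.
lra.
Qed.

Hypothesis Adense : forall u e, nmem H u -> 0 < e -> exists u' w, A u' w /\ N (u - u') < e.

Lemma semigroup_decay u (t : R) : nmem H u -> 0 <= t ->
  L (T t u) (T t u) <= expR (- 2 * alpha * t) * L u u.
Proof.
move=> mu t0; have mt := sg_mem t0 mu.
pose q := expR (- alpha * t); have q0 : 0 < q by exact: expR_gt0.
have qq : expR (- 2 * alpha * t) = q ^+ 2 by rewrite /q -expRM_natl; congr expR; ring.
suff h : si_norm L (T t u) <= q * si_norm L u.
  rewrite qq -(si_norm_sqr hL mt) -(si_norm_sqr hL mu) -exprMn.
  by rewrite ler_pXn2r ?nnegrE ?si_norm_ge0// mulr_ge0 ?si_norm_ge0// ltW.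
have [M M0 hM] := sg_lip t0.
apply/ler_addgt0Pr => e e0.
(* The part $KM$ pays for transporting the approximation error with [T t], the part $qK$ for
   changing the initial value; the $1$ keeps [k] positive. *)
pose k := K * M + q * K + 1.
have k0 : 0 < k by rewrite ltr_wpDl// addr_ge0// mulr_ge0// ltW.
have e1 : 0 < e / k by rewrite divr_gt0.
have [u' [w [Au' hu']]] := Adense mu e1.
have [mu' _] := Amem Au'; have mt' := sg_mem t0 mu'.
have m := si_memB hB mu mu'.
have h1 : si_norm L (T t u) <= si_norm L (T t u') + K * (M * (e / k)).
  have mm := si_memB hB mt mt'.
  have := si_normD hL mm mt'; rewrite subrK addrC => /le_trans; apply; rewrite lerD2l.
  apply: (le_trans (LN mm)); rewrite ler_wpM2l//; apply: (le_trans (hM _ _ mu mu')).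
  by rewrite ler_wpM2l// ltW.
have h2 : si_norm L (T t u') <= q * si_norm L u'.
  rewrite -ler_sqr ?nnegrE ?si_norm_ge0//; last by rewrite mulr_ge0 ?si_norm_ge0// ltW.
  by rewrite exprMn -qq (si_norm_sqr hL mt') (si_norm_sqr hL mu') (domain_decay Au').
have h3 : si_norm L u' <= si_norm L u + K * (e / k).
  have := si_normB hL mu m; rewrite opprB addrC subrK => /le_trans; apply; rewrite lerD2l.
  by apply: (le_trans (LN m)); rewrite ler_wpM2l// ltW.
apply: (le_trans h1); apply: (@le_trans _ _ (q * (si_norm L u + K * (e / k)) + K * (M * (e / k)))).
  by rewrite lerD2r; apply: (le_trans h2); rewrite ler_pM2l.
rewrite mulrDr -addrA lerD2l.
have -> : q * (K * (e / k)) + K * (M * (e / k)) = (K * M + q * K) / k * e by ring.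
by rewrite ler_piMl ?ltW// ltr_pdivrMr// mul1r /k ltrDl.
Qed.

End semigroup.

(** * The Lyapunov functional of the delay equation *)

Section form_combinators.
Context (R : realType).

Lemma si_scale (V : lmodType R) (S : set V) (b : V -> V -> R) (c : R) :
  0 <= c -> semi_inner S b -> semi_inner S (fun u v => c * b u v).
Proof.
move=> c0 hb; split.
- exact: (si_lin hb).
- exact: (si_mem0 hb).
- by move=> u v Su Sv; rewrite (si_sym hb).
- by move=> a u v w Su Sv Sw; rewrite (si_linl hb)//; ring.
- by move=> u Su; rewrite mulr_ge0// (si_ge0 hb).
Qed.

Definition pform (E F : nspace R) (bE : E -> E -> R) (bF : F -> F -> R) (p q : nprod E F) : R :=
  bE p.1 q.1 + bF p.2 q.2.

Lemma pform_semi_inner (E F : nspace R) (bE : E -> E -> R) (bF : F -> F -> R) :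
  semi_inner (nmem E) bE -> semi_inner (nmem F) bF -> semi_inner (nmem (nprod E F)) (pform bE bF).
Proof.
move=> hE hF; split.
- by move=> a u v [u1 u2] [v1 v2]; split; [exact: (si_lin hE)|exact: (si_lin hF)].
- by split; [exact: (si_mem0 hE)|exact: (si_mem0 hF)].
- by move=> u v [u1 u2] [v1 v2]; rewrite /pform (si_sym hE)// (si_sym hF).
- move=> a u v w [u1 u2] [v1 v2] [w1 w2].
  by rewrite /pform (si_linl hE)// (si_linl hF)//; ring.
- by move=> u [u1 u2]; rewrite addr_ge0// ?(si_ge0 hE)// (si_ge0 hF).
Qed.

(** A block form whose off-diagonal part is the symmetrisation of [c]; on the diagonal it
    contributes $2c(u,v)$. *)
Definition cross_form (E F : nspace R) (bE : E -> E -> R) (bF : F -> F -> R) (c : E -> F -> R)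
  (p q : nprod E F) : R := bE p.1 q.1 + bF p.2 q.2 + (c p.1 q.2 + c q.1 p.2).

Lemma cross_form_semi_inner (E F : nspace R) (bE : E -> E -> R) (bF : F -> F -> R) (c : E -> F -> R) :
  semi_inner (nmem E) bE -> semi_inner (nmem F) bF ->
  (forall a u v w, nmem E u -> nmem E v -> nmem F w -> c (a *: u + v) w = a * c u w + c v w) ->
  (forall a u v w, nmem F u -> nmem F v -> nmem E w -> c w (a *: u + v) = a * c w u + c w v) ->
  (forall p, nmem (nprod E F) p -> 0 <= cross_form bE bF c p p) ->
  semi_inner (nmem (nprod E F)) (cross_form bE bF c).
Proof.
move=> hE hF cl cr c0; have hp := pform_semi_inner hE hF; split=> //.
- exact: (si_lin hp).
- exact: (si_mem0 hp).
- by move=> u v [u1 u2] [v1 v2]; rewrite /cross_form (si_sym hE)// (si_sym hF)//; ring.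
- move=> a u v w [u1 u2] [v1 v2] [w1 w2].
  by rewrite /cross_form (si_linl hE)// (si_linl hF)// cl// cr//; ring.
Qed.

Lemma pform_norm (E F : nspace R) (bE : E -> E -> R) (bF : F -> F -> R) :
  semi_inner (nmem E) bE -> semi_inner (nmem F) bF ->
  (forall u, nmem E u -> nnorm E u = si_norm bE u) ->
  (forall u, nmem F u -> nnorm F u = si_norm bF u) ->
  forall p, nmem (nprod E F) p -> nnorm (nprod E F) p = si_norm (pform bE bF) p.
Proof.
move=> hE hF nE nF [u v] [/= mu mv]; rewrite /si_norm /pform /=.
by rewrite nE// nF// (si_norm_sqr hE)// (si_norm_sqr hF).
Qed.

End form_combinators.

Lemma half_le_sum4 (R : realFieldType) (x y z t : R) : 0 < x -> 0 < y -> 0 < z -> 0 < t ->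
  [/\ x / 2 <= x + y + z + t, y / 2 <= x + y + z + t, z / 2 <= x + y + z + t
    & t / 2 <= x + y + z + t].
Proof. by move=> x0 y0 z0 t0; split; lra. Qed.

Lemma three_halves_lt (R : realFieldType) (e : R) : 0 < e ->
  (e / 2) ^+ 2 + (e / 2) ^+ 2 + (e / 2) ^+ 2 < e ^+ 2.
Proof.
move=> e0; have -> : (e / 2) ^+ 2 + (e / 2) ^+ 2 + (e / 2) ^+ 2 = 3 / 4 * e ^+ 2 by field.
by rewrite gtr_pMl ?exprn_gt0//; lra.
Qed.

(** The derivative of the functional with every pairing replaced by a scalar. Indices 1 and 2 refer
    to $v_1$ and $v_2$, indices 3 and 4 to the histories and their traces at $s=1$. The numbers
    [a12], [a31], [a32], [a41], [a42] are products of gradients, [l1] and [l2] are the products of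
    the second component of $\mathscr{A}V$ with $v_1$ and $v_2$, [P2] is $\|v_2\|^2$, and [X3], [X4]
    are the history terms. [Y], [Z] and [W] are squared gradient norms of $v_1$ and $v_2$, of the
    traces, and of the histories. The elastic term cancels $Nc_1$ times [a12], and the values of
    [K3] and [K4] cancel the traces. *)
Lemma lyapunov_inequality (R : realFieldType)
  (N c1 c2 d1 d2 cp p q K3 K4 dl eta a12 a31 a32 a41 a42 l1 l2 P2 X3 X4 Y1 Y2 Z3 Z4 W3 W4 : R) :
  0 <= N -> 0 <= c2 -> 0 <= d1 -> 0 <= d2 -> 0 <= Y1 -> 0 <= Y2 -> 0 <= W3 -> 0 <= W4 ->
  eta <= dl -> K3 = (N + 1) * c2 * p -> K4 = (N + 1) * d2 * p ->
  eta <= c1 - q * (c2 + d1 + d2) - K3 - dl ->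
  eta <= N * d1 - N * q * (c2 + d2) - d1 * p - cp - K4 - dl ->
  l1 = - (c1 * Y1 + c2 * a31 + d1 * a12 + d2 * a41) ->
  l2 = - (c1 * a12 + c2 * a32 + d1 * Y2 + d2 * a42) ->
  2 * X3 = - K3 * Z3 + (K3 + dl) * Y1 - dl * W3 ->
  2 * X4 = - K4 * Z4 + (K4 + dl) * Y2 - dl * W4 ->
  P2 <= cp * Y2 ->
  - a32 <= p * Z3 + q * Y2 -> - a42 <= p * Z4 + q * Y2 -> - a31 <= p * Z3 + q * Y1 ->
  - a41 <= p * Z4 + q * Y1 -> - a12 <= p * Y2 + q * Y1 ->
  2 * (N * c1 / 2 * a12 + N / 2 * l2 + (1 / 2 * l1 + 1 / 2 * P2) + X3 + X4)
  <= - eta * (Y1 + Y2 + W3 + W4).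
Proof.
move=> N0 c20 d10 d20 Y10 Y20 W30 W40 e1 -> -> e2 e3 -> -> x3 x4 P2Y y1 y2 y3 y4 y5.
have h1 := ler_wpM2l (mulr_ge0 N0 c20) y1.
have h2 := ler_wpM2l (mulr_ge0 N0 d20) y2.
have h3 := ler_wpM2l c20 y3.
have h4 := ler_wpM2l d20 y4.
have h5 := ler_wpM2l d10 y5.
have g1 := ler_wpM2r W30 e1; have g2 := ler_wpM2r W40 e1.
have g3 := ler_wpM2r Y10 e2; have g4 := ler_wpM2r Y20 e3.
lra.
Qed.

(* 4 p = 2 (c2 + d2) / d1; the last two inequalities bound the coefficients of
   ||grad v1||^2 and ||grad v2||^2 in the derivative of the functional. *)
Lemma lyapunov_parameters (R : realType) (cp c1 c2 d1 d2 : R) :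
  0 < cp -> 0 < c1 -> 0 < c2 -> 0 < d1 -> 0 < d2 ->
  d1 ^+ 2 >= d2 * (c2 + d2) -> d1 ^+ 2 - d2 * (c2 + d2) != 0 ->
  (2 * d1 * cp + (d1 + d2) * (c2 + d2)) / (d1 ^+ 2 - d2 * (c2 + d2))
    < 2 * c1 * d1 / (c2 * (c2 + d2)) - 1
      - d1 ^+ 2 * (c2 + d1 + d2) / (c2 * (c2 + d2) ^+ 2) ->
  Num.sqrt (cp / c1)
    < d1 / (c2 * (c2 + d2))
      * (2 * c1 - (c2 * d1 + d1 ^+ 2 + d1 * d2) / (c2 + d2)
         - c2 * (c2 + d2) / d1) ->
  exists N p dl : R, [/\ Num.sqrt (cp / c1) < N, 0 < p, 0 < dl,
    dl <= c1 - (4 * p)^-1 * (c2 + d1 + d2) - (N + 1) * c2 * p - dl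
    & dl <= N * d1 - N * (4 * p)^-1 * (c2 + d2) - d1 * p - cp - (N + 1) * d2 * p - dl].
Proof.
move=> cp0 c10 c20 d10 d20 hd hden hcond hsqrt.
set D := c2 + d2 in hd hden hcond hsqrt *; have D0 : 0 < D by exact: addr_gt0.
set A := d1 ^+ 2 - d2 * D in hden hcond.
have A0 : 0 < A by rewrite lt_neqAle eq_sym hden subr_ge0.
set Q := 2 * c1 * d1 / (c2 * D) - 1 - _ in hcond.
(* The right-hand sides of the last two conditions coincide, so a single [N] can exceed both
   left-hand sides and stay below [Q]. *)
have QE : d1 / (c2 * D) * (2 * c1 - (c2 * d1 + d1 ^+ 2 + d1 * d2) / D - c2 * D / d1) = Q.
  by rewrite /Q; field; rewrite !gt_eqF.
rewrite QE in hsqrt; set lhs := _ / A in hcond; set sg := Num.sqrt _ in hsqrt *.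
pose m := Num.max lhs sg; have mQ : m < Q by rewrite gt_max hcond.
pose N := (m + Q) / 2; have [mN NQ] : m < N /\ N < Q by rewrite /N; split; lra.
have lN : lhs < N by apply: le_lt_trans mN; rewrite le_max lexx.
have sN : sg < N by apply: le_lt_trans mN; rewrite le_max lexx orbT.
pose p := D / (2 * d1); have p0 : 0 < p by rewrite divr_gt0// mulr_gt0.
(* For this [p] both margins factor: the first is a positive multiple of $Q-N$, the second a
   positive multiple of the distance from the left-hand side to [N]. *)
have k1 : c1 - (4 * p)^-1 * (c2 + d1 + d2) - (N + 1) * c2 * p = c2 * D / (2 * d1) * (Q - N).
  by rewrite /p /Q; field; rewrite !gt_eqF.
have k2 : N * d1 - N * (4 * p)^-1 * D - d1 * p - cp - (N + 1) * d2 * p = A / (2 * d1) * (N - lhs).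
  have -> : A / (2 * d1) * (N - lhs) = A * N / (2 * d1) - (2 * d1 * cp + (d1 + d2) * D) / (2 * d1).
    by rewrite /lhs; field; rewrite !gt_eqF.
  by rewrite /p /A; field; rewrite !gt_eqF.
have g1 : 0 < c2 * D / (2 * d1) * (Q - N) by rewrite mulr_gt0 ?subr_gt0// divr_gt0// mulr_gt0.
have g2 : 0 < A / (2 * d1) * (N - lhs) by rewrite mulr_gt0 ?subr_gt0// divr_gt0// mulr_gt0.
rewrite -k1 in g1; rewrite -k2 in g2.
set x1 := _ - (N + 1) * c2 * p in g1 *; set x2 := _ - (N + 1) * d2 * p in g2 *.
(* Half of the smaller margin is spent on the slope of the weights, the other half remains as
   dissipation. *)
exists N, p, (Num.min x1 x2 / 2).
have y1 : Num.min x1 x2 <= x1 by rewrite ge_min lexx.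
have y2 : Num.min x1 x2 <= x2 by rewrite ge_min lexx orbT.
split=> //; first by rewrite divr_gt0// lt_min g1.
- change (Num.min x1 x2 / 2 <= x1 - Num.min x1 x2 / 2).
  by clearbody x1 x2; move: y1; move: (Num.min x1 x2) => y yx; lra.
- change (Num.min x1 x2 / 2 <= x2 - Num.min x1 x2 / 2).
  by clearbody x1 x2; move: y2; move: (Num.min x1 x2) => y yx; lra.
Qed.

(** The square of $v+2pu$ is nonnegative; it is divided by $4p$. *)
Lemma young (R : realType) (V : lmodType R) (S : set V) (b : V -> V -> R) (p : R) (u v : V) :
  semi_inner S b -> 0 < p -> S u -> S v -> - b u v <= p * b u u + (4 * p)^-1 * b v v.
Proof.
move=> hb p0 Su Sv; have := si_ge0 hb (si_memD hb Sv (si_memZ hb (2 * p) Su)).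
rewrite (si_polar hb _ Sv Su) (si_sym hb Sv Su) => h.
have q0 : 0 < (4 * p)^-1 by rewrite invr_gt0 mulr_gt0.
have := mulr_ge0 (ltW q0) h.
have -> : (4 * p)^-1 * (b v v + 2 * (2 * p) * b u v + (2 * p) ^+ 2 * b u u) =
  (4 * p)^-1 * b v v + b u v + p * b u u by field; rewrite gt_eqF.
lra.
Qed.

Lemma null_form (R : realType) (V : lmodType R) (S : set V) (a b : V -> V -> R) (M : R) (u v w : V) :
  semi_inner S a -> semi_inner S b -> (forall x, S x -> a x x <= M * b x x) ->
  S u -> S v -> S w -> si_norm b (u - v) = 0 -> a u w = a v w.
Proof.
move=> ha hb ab Su Sv Sw e; have m := si_memB hb Su Sv.
apply/eqP; rewrite -subr_eq0 -(si_Bl ha)//; apply/eqP; apply: (si_norm0_l ha) => //.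
have b0 : b (u - v) (u - v) = 0 by rewrite -(si_norm_sqr hb m) e expr0n.
have := ab _ m; rewrite b0 mulr0 => h.
by apply/eqP; rewrite /si_norm sqrtr_eq0.
Qed.

(** The vectors multiplied by [c2] and [d2] are the end values prescribed for the two histories in
    the density argument. The lemma serves for the gradient form and for the $L^2$ pairing with the
    Laplacian of a test function. *)
Lemma stress_free (R : realType) (V : lmodType R) (S : set V) (a : V -> V -> R)
  (c1 c2 d1 d2 : R) (u v w : V) : semi_inner S a -> c2 != 0 -> S u -> S v -> S w ->
  c1 * a u w + c2 * a ((- c2^-1) *: (c1 *: u + d1 *: v)) w + d1 * a v w + d2 * a 0 w = 0.
Proof.
move=> ha c20 Su Sv Sw; have [m1 m2] := (si_memZ ha c1 Su, si_memZ ha d1 Sv).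
have m3 := si_memD ha m1 m2.
rewrite (si_0l ha Sw) (si_Zl ha _ m3 Sw) (si_Dl ha m1 m2 Sw) (si_Zl ha _ Su Sw) (si_Zl ha _ Sv Sw).
by field.
Qed.

(** * Energy, Lyapunov functional and operator of the delay equation *)

Section delay_energy.
Context (R : realType) (n : nat) (Omega Gamma0 : set 'rV[R]_n.+1).
Hypotheses (oO : open Omega) (bO : bounded_set Omega)
  (mS : measurable (Gamma0 : set (caratheodory_type (@hausdorff_outer R n n))))
  (SO : Gamma0 `&` Omega = set0).
Local Notation H1 := (H1z Omega Gamma0).
Local Notation H := (Hspace Omega Gamma0).
Local Notation fct := ('rV[R]_n.+1 -> R^o).
Local Notation grad := (graddot Omega).
Local Notation l2 := (l2dot Omega).
Local Notation I01 := (`]0%R, 1%R[%classic : set R).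
Implicit Types (u v : fct).

Let hh1 : semi_inner (nmem H1) (h1dot Omega) := h1z_semi_inner oO bO mS SO.
Let hg1 : semi_inner (nmem H1) grad := h1z_grad_semi_inner oO bO mS SO.
Let hl : semi_inner (nmem (L2 Omega)) l2 := l2_semi_inner oO.
Let hn1 : forall u : H1, nmem H1 u -> nnorm H1 u = si_norm (h1dot Omega) u.
Proof. by move=> u; exact: h1z_norm. Qed.

Let H1_L2 u : nmem H1 u -> inL2 Omega u. Proof. by move=> [[]]. Qed.

Let grad_le (u : H1) : nmem H1 u -> grad u u <= h1dot Omega u u.
Proof. by move=> /H1_L2 mu; rewrite /h1dot lerDr (si_ge0 hl). Qed.

Let hBo := BF_semi_inner hh1 hn1.

Definition Hdot : H -> H -> R :=
  pform (pform (pform (E := H1) (F := L2 Omega) (h1dot Omega) l2)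
    (F := BochnerL2 H1) (wform (E := H1) (h1dot Omega) (fun=> 1)))
    (F := BochnerL2 H1) (wform (E := H1) (h1dot Omega) (fun=> 1)).

Lemma Hdot_semi_inner : semi_inner (nmem H) Hdot.
Proof.
exact: (pform_semi_inner (pform_semi_inner (pform_semi_inner hh1 hl) hBo) hBo).
Qed.

Lemma Hdot_norm (V : H) : nmem H V -> nnorm H V = si_norm Hdot V.
Proof.
have nBo (v : BochnerL2 H1) : nmem (BochnerL2 H1) v -> nnorm (BochnerL2 H1) v = si_norm (wform (E := H1) (h1dot Omega) (fun=> 1)) v.
  exact: (BochnerL2_norm hh1 hn1).
have nL (u : L2 Omega) : nmem (L2 Omega) u -> nnorm (L2 Omega) u = si_norm l2 u by [].
have p1 := pform_semi_inner hh1 hl.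
have p2 := pform_semi_inner p1 hBo.
exact: (pform_norm p2 hBo (pform_norm p1 hBo (pform_norm hh1 hl hn1 nL) nBo) nBo).
Qed.

Let affine_measurable (c0 c1 : R) : measurable_fun I01 ((fun s => c0 + c1 * s) : measurableTypeR R -> R).
Proof.
apply: continuous_measurable01; rewrite (_ : (fun s => _) = (fun s => c1 * s + c0)).
  exact: C1_continuous (@C1_affine R c1 c0).
by apply/funext => s; rewrite addrC.
Qed.

Let wgrad_semi_inner (c0 c1 : R) : 0 <= c0 -> 0 <= c0 + c1 ->
  semi_inner (nmem (BochnerL2 H1)) (wform (E := H1) grad (fun s => c0 + c1 * s)).
Proof.
move=> h0 h1.
apply: (wform_semi_inner (M := c0 + (c0 + c1)) hh1 hn1 hg1 grad_le (affine_measurable c0 c1)).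
move=> s /andP[s0 s1].
(* An affine weight is a convex combination of its two end values, which are nonnegative. *)
have -> : c0 + c1 * s = (1 - s) * c0 + s * (c0 + c1) by ring.
have q1 : 0 <= (1 - s) * c0 by rewrite mulr_ge0//; lra.
have q2 : 0 <= s * (c0 + c1) by rewrite mulr_ge0//; lra.
have q3 : 0 <= s * c0 by rewrite mulr_ge0//; lra.
have q4 : 0 <= (1 - s) * (c0 + c1) by rewrite mulr_ge0//; lra.
by apply/andP; split; lra.
Qed.

Let one_affine : (fun=> 1 : R) = (fun s : R => 1 + 0 * s).
Proof. by apply/funext => s; rewrite mul0r addr0. Qed.

Let wgrad1 : semi_inner (nmem (BochnerL2 H1)) (wform (E := H1) grad (fun=> 1)).
Proof. by rewrite one_affine; apply: wgrad_semi_inner; rewrite ?addr0 ler01. Qed.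

Context (cp : R) (hcp : 0 < cp)
  (hpoincare : forall u, nmem H1 u -> l2norm Omega u ^+ 2 <= cp * gradnorm Omega u ^+ 2).

Let poincare u : nmem H1 u -> l2 u u <= cp * grad u u.
Proof.
move=> mu; have := hpoincare mu.
by rewrite -(si_norm_sqr hl (H1_L2 mu)) -(si_norm_sqr hg1 mu).
Qed.

Context (tau c1 c2 d1 d2 : R) (htau : 0 < tau) (hc1 : 0 < c1) (hc2 : 0 < c2) (hd1 : 0 < d1) (hd2 : 0 < d2).

(** The energy is polarised because its independence of the representative is obtained from the
    Cauchy-Schwarz inequality for semi-inner products. *)
Definition edot : H -> H -> R :=
  pform (pform (pform (E := H1) (F := L2 Omega) (fun x y => c1 / 2 * grad x y) (fun x y => 1 / 2 * l2 x y))
    (F := BochnerL2 H1) (fun x y => tau * d1 / 2 * wform (E := H1) grad (fun=> 1) x y))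
    (F := BochnerL2 H1) (fun x y => tau * d2 / 2 * wform (E := H1) grad (fun=> 1) x y).

Lemma edot_semi_inner : semi_inner (nmem H) edot.
Proof.
have q1 : 0 <= c1 / 2 by rewrite divr_ge0// ltW.
have q2 : 0 <= (1 : R) / 2 by rewrite divr_ge0.
have q3 : 0 <= tau * d1 / 2 by rewrite divr_ge0// mulr_ge0// ltW.
have q4 : 0 <= tau * d2 / 2 by rewrite divr_ge0// mulr_ge0// ltW.
exact: (pform_semi_inner (pform_semi_inner (pform_semi_inner (si_scale q1 hg1) (si_scale q2 hl))
  (si_scale q3 wgrad1)) (si_scale q4 wgrad1)).
Qed.

Lemma energyE (V : H) : nmem H V -> energy tau c1 d1 d2 V = edot V V.
Proof.
move: V => [[[v1 v2] v3] v4] [[[/= m1 m2] [p3 _ _]] [p4 _ _]].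
rewrite /energy /edot /pform /= -(si_norm_sqr hl m2) -(si_norm_sqr hg1 m1).
rewrite [1 / 2 * _ + _]addrC; congr (_ + _ * _ + _ * _).
  by apply: eq_Rintegral => s /set_mem/I01P s01; rewrite mul1r -(si_norm_sqr hg1 (p3 _ s01)).
by apply: eq_Rintegral => s /set_mem/I01P s01; rewrite mul1r -(si_norm_sqr hg1 (p4 _ s01)).
Qed.

Let sigma := Num.sqrt (cp / c1).
Context (N K3 K4 dl : R) (hN : sigma < N) (hK3 : 0 < K3) (hK4 : 0 < K4) (hdl : 0 < dl).

Let sigma0 : 0 <= sigma. Proof. exact: sqrtr_ge0. Qed.

(** Cauchy-Schwarz, Poincaré and the inequality of arithmetic and geometric means; the factor
    $c_p/c_1$ appears when $c_p\|\nabla u\|^2$ is written in terms of $c_1\|\nabla u\|^2$. This is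
    the origin of the threshold for [N]. *)
Lemma cross_bound u v : nmem H1 u -> inL2 Omega v ->
  `|l2 u v| <= sigma * (1 / 2 * l2 v v + c1 / 2 * grad u u).
Proof.
move=> mu mv; have mu' := H1_L2 mu.
have P := si_ge0 hl mv; have Y := si_ge0 hg1 mu.
have q0 : 0 <= 1 / 2 * l2 v v + c1 / 2 * grad u u.
  by rewrite addr_ge0// mulr_ge0// divr_ge0// ltW.
rewrite -ler_sqr ?nnegrE ?mulr_ge0// real_normK ?num_real//.
apply: (le_trans (cauchy_schwarz hl mu' mv)).
apply: (le_trans (ler_wpM2r P (poincare mu))).
rewrite exprMn sqr_sqrtr; last by rewrite divr_ge0// ltW.
have -> : cp * grad u u * l2 v v = cp / c1 * (c1 * grad u u * l2 v v) by field; rewrite gt_eqF.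
apply: ler_wpM2l; first by apply: divr_ge0; exact: ltW.
have -> : (1 / 2 * l2 v v + c1 / 2 * grad u u) ^+ 2 =
  c1 * grad u u * l2 v v + (1 / 2 * l2 v v - c1 / 2 * grad u u) ^+ 2 by field.
by rewrite lerDl sqr_ge0.
Qed.

(** On the diagonal the two halves of the symmetrised cross term add up to $(v_1,v_2)$. *)
Definition mixed_form : nprod H1 (L2 Omega) -> nprod H1 (L2 Omega) -> R :=
  cross_form (E := H1) (F := L2 Omega) (fun x y => N * c1 / 2 * grad x y) (fun x y => N / 2 * l2 x y)
    (fun x y => 1 / 2 * l2 x y).

Lemma mixed_form_ge (p : nprod H1 (L2 Omega)) : nmem (nprod H1 (L2 Omega)) p ->
  (N - sigma) * (c1 / 2 * grad p.1 p.1 + 1 / 2 * l2 p.2 p.2) <= mixed_form p p.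
Proof.
move=> [m1 m2]; have := cross_bound m1 m2; rewrite ler_norml => /andP[h _].
rewrite /mixed_form /cross_form; lra.
Qed.

Lemma half_energy_ge0 (p : nprod H1 (L2 Omega)) : nmem (nprod H1 (L2 Omega)) p ->
  0 <= c1 / 2 * grad p.1 p.1 + 1 / 2 * l2 p.2 p.2.
Proof.
move=> [m1 m2]; apply: addr_ge0; apply: mulr_ge0.
- by apply: divr_ge0 => //; exact: ltW.
- exact: (si_ge0 hg1 m1).
- exact: divr_ge0.
- exact: (si_ge0 hl m2).
Qed.

Lemma mixed_form_semi_inner : semi_inner (nmem (nprod H1 (L2 Omega))) mixed_form.
Proof.
have N0 : 0 <= N by apply: le_trans sigma0 _; exact: ltW.
have q1 : 0 <= N * c1 / 2 by apply: divr_ge0 => //; apply: mulr_ge0 => //; exact: ltW.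
have q2 : 0 <= N / 2 by apply: divr_ge0.
apply: (cross_form_semi_inner (si_scale q1 hg1) (si_scale q2 hl)).
- move=> a u v w mu mv mw; have [mu' mv'] := (H1_L2 mu, H1_L2 mv).
  by rewrite (si_linl hl a mu' mv' mw) mulrDr mulrCA.
- move=> a u v w mu mv mw; have mw' := H1_L2 mw; have mau := si_memZ hl a mu.
  by rewrite (si_Dr hl mau mv mw') (si_Zr hl a mu mw') mulrDr mulrCA.
move=> p mp; apply: le_trans (mixed_form_ge mp).
by apply: mulr_ge0; [rewrite subr_ge0 ltW|exact: half_energy_ge0].
Qed.

(** The weights $K+\delta(1-s)$ are written in the affine form of the weighted chain rule. Their
    value at $s=1$ is [K3] or [K4], and their slope supplies the dissipation of the histories. *)
Definition lyap : H -> H -> R :=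
  pform (pform mixed_form
    (F := BochnerL2 H1) (fun x y => tau * wform (E := H1) grad (fun s => (K3 + dl) + - dl * s) x y))
    (F := BochnerL2 H1) (fun x y => tau * wform (E := H1) grad (fun s => (K4 + dl) + - dl * s) x y).

Lemma lyap_semi_inner : semi_inner (nmem H) lyap.
Proof.
have t0 := ltW htau.
have w K : 0 < K -> semi_inner (nmem (BochnerL2 H1)) (wform (E := H1) grad (fun s => (K + dl) + - dl * s)).
  by move=> K0; apply: wgrad_semi_inner; [exact/ltW/addr_gt0|rewrite addrK ltW].
exact: (pform_semi_inner (pform_semi_inner mixed_form_semi_inner (si_scale t0 (w _ hK3)))
  (si_scale t0 (w _ hK4))).
Qed.

Let wform_int (c c' : R) (v : BochnerL2 H1) : nmem (BochnerL2 H1) v ->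
  (@lebesgue_measure R).-integrable I01 (EFin \o (fun s => (c + c' * s) * grad (v s) (v s))).
Proof.
move=> mv; apply: (wform_integrable hh1 hn1 hg1 grad_le (affine_measurable c c') (M := `|c| + `|c'|) _ mv mv).
move=> s /andP[s0 s1]; apply: (le_trans (ler_normD _ _)); rewrite lerD2l normrM.
by rewrite ler_piMr// gtr0_norm// ltW.
Qed.

Let weight_bounds (K s : R) : 0 < s < 1 ->
  K * (1 + 0 * s) <= K + dl + - dl * s <= (K + dl) * (1 + 0 * s).
Proof.
move=> /andP[s0 s1]; have h1 : 0 <= dl * s by apply: mulr_ge0; exact: ltW.
have h2 : 0 <= dl * (1 - s) by apply: mulr_ge0; [exact: ltW|rewrite subr_ge0 ltW].
by apply/andP; split; lra.
Qed.

Lemma wform_weight_bounds (K : R) (v : BochnerL2 H1) : nmem (BochnerL2 H1) v ->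
  K * wform (E := H1) grad (fun=> 1) v v <= wform (E := H1) grad (fun s => (K + dl) + - dl * s) v v
    <= (K + dl) * wform (E := H1) grad (fun=> 1) v v.
Proof.
move=> mv; have [pv _ _] := mv; have mI := @I01_measurable R.
have i1 := wform_int 1 0 mv; have i2 := wform_int (K + dl) (- dl) mv.
rewrite one_affine /wform -!RintegralZl//; apply/andP; split; apply: le_Rintegral => //.
- exact: (integrableZl mI K i1).
- move=> s /I01P s01; have g0 := si_ge0 hg1 (pv _ s01).
  by rewrite mulrA ler_wpM2r//; have /andP[] := weight_bounds K s01.
- exact: (integrableZl mI (K + dl) i1).
- move=> s /I01P s01; have g0 := si_ge0 hg1 (pv _ s01).
  by rewrite mulrA ler_wpM2r//; have /andP[] := weight_bounds K s01.
Qed.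

Lemma edot_le_lyap : exists2 m : R, 0 < m & forall V : H, nmem H V -> m * edot V V <= lyap V V.
Proof.
(* The ratios of the least history weights $\tau K_3$ and $\tau K_4$ to the energy coefficients
   $\tau d_1/2$ and $\tau d_2/2$. *)
pose m3 := 2 * K3 / d1; pose m4 := 2 * K4 / d2.
have m30 : 0 < m3 by rewrite divr_gt0// mulr_gt0.
have m40 : 0 < m4 by rewrite divr_gt0// mulr_gt0.
pose m := Num.min (N - sigma) (Num.min m3 m4).
have m0 : 0 < m by rewrite !lt_min subr_gt0 hN m30.
exists m => // -[[[v1 v2] v3] v4] [[m12 mv3] mv4].
rewrite /edot /lyap /pform /= !mulrDr.
have [m1 m2] := m12.
have h0 : m <= N - sigma by rewrite ge_min lexx.
have h3 : m <= m3 by rewrite !ge_min lexx orbT.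
have h4 : m <= m4 by rewrite !ge_min lexx !orbT.
have key K d (v : BochnerL2 H1) : nmem (BochnerL2 H1) v -> 0 < d -> m <= 2 * K / d ->
   m * (tau * d / 2 * wform (E := H1) grad (fun=> 1) v v) <=
   tau * wform (E := H1) grad (fun s => (K + dl) + - dl * s) v v.
  move=> mv d0 mK; have /andP[h _] := wform_weight_bounds K mv.
  have W0 := si_ge0 wgrad1 mv.
  apply: (@le_trans _ _ (tau * (K * wform (E := H1) grad (fun=> 1) v v))); last by rewrite ler_pM2l.
  rewrite (_ : m * _ = tau * (m * d / 2 * wform (E := H1) grad (fun=> 1) v v)); last by ring.
  rewrite ler_pM2l// ler_wpM2r//.
  by move: mK; rewrite ler_pdivlMr//; lra.
apply: (lerD _ (key K4 d2 v4 mv4 hd2 h4)).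
apply: (lerD _ (key K3 d1 v3 mv3 hd1 h3)).
rewrite -mulrDr; apply: le_trans (mixed_form_ge m12); apply: ler_wpM2r => //.
exact: half_energy_ge0 m12.
Qed.

Lemma lyap_le_edot : exists2 M : R, 0 < M & forall V : H, nmem H V -> lyap V V <= M * edot V V.
Proof.
have N0 : 0 < N by exact: le_lt_trans hN.
pose m3 := 2 * (K3 + dl) / d1; pose m4 := 2 * (K4 + dl) / d2.
have m30 : 0 < m3 by rewrite divr_gt0// mulr_gt0// addr_gt0.
have m40 : 0 < m4 by rewrite divr_gt0// mulr_gt0// addr_gt0.
pose m := (N + sigma) + (m3 + m4).
have m0 : 0 < m by apply: addr_gt0; [exact: ltr_wpDr|exact: addr_gt0].
exists m => // -[[[v1 v2] v3] v4] [[m12 mv3] mv4].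
rewrite /edot /lyap /pform /= !mulrDr.
have [m1 m2] := m12.
have Ns : 0 < N + sigma by exact: ltr_wpDr.
have h0 : N + sigma <= m by rewrite lerDl; apply: addr_ge0; exact: ltW.
have h3 : m3 <= m by rewrite /m; move: (N + sigma) Ns m30 m40 => x; lra.
have h4 : m4 <= m by rewrite /m; move: (N + sigma) Ns m30 m40 => x; lra.
have key K d (v : BochnerL2 H1) : nmem (BochnerL2 H1) v -> 0 < d -> 2 * (K + dl) / d <= m ->
   tau * wform (E := H1) grad (fun s => (K + dl) + - dl * s) v v <=
   m * (tau * d / 2 * wform (E := H1) grad (fun=> 1) v v).
  move=> mv d0 mK; have /andP[_ h] := wform_weight_bounds K mv.
  have W0 := si_ge0 wgrad1 mv.
  apply: (@le_trans _ _ (tau * ((K + dl) * wform (E := H1) grad (fun=> 1) v v))); first by rewrite ler_pM2l.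
  rewrite (_ : m * _ = tau * (m * d / 2 * wform (E := H1) grad (fun=> 1) v v)); last by ring.
  rewrite ler_pM2l// ler_wpM2r//.
  by move: mK; rewrite ler_pdivrMr//; lra.
apply: (lerD _ (key K4 d2 v4 mv4 hd2 h4)).
apply: (lerD _ (key K3 d1 v3 mv3 hd1 h3)).
rewrite -mulrDr; have := cross_bound m1 m2; rewrite ler_norml => /andP[_ h].
apply: (@le_trans _ _ ((N + sigma) * (c1 / 2 * grad v1 v1 + 1 / 2 * l2 v2 v2))).
  by rewrite /mixed_form /cross_form /=; lra.
apply: ler_wpM2r => //; exact: half_energy_ge0 m12.
Qed.

Lemma wform_grad_le (v : BochnerL2 H1) : nmem (BochnerL2 H1) v ->
  wform (E := H1) grad (fun=> 1) v v <= wform (E := H1) (h1dot Omega) (fun=> 1) v v.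
Proof.
move=> mv; have [pv _ _] := mv.
have m1' : measurable_fun I01 ((fun=> 1) : measurableTypeR R -> R) by exact: measurable_cst.
have b1 (s : R) : 0 < s < 1 -> `|1 : R| <= 1 by rewrite normr1.
apply: le_Rintegral => //.
- exact: (wform_integrable hh1 hn1 hg1 grad_le m1' b1 mv mv).
- have hle (u : H1) : nmem H1 u -> h1dot Omega u u <= h1dot Omega u u by [].
  exact: (wform_integrable hh1 hn1 hh1 hle m1' b1 mv mv).
- by move=> s /I01P s01; rewrite !mul1r; exact/grad_le/pv.
Qed.

(** Continuity of the energy for the norm of the state space: it makes the energy a function of
    classes and lets the decay pass from the domain to its closure. *)
Lemma edot_le_Hdot : exists2 K : R, 0 < K & forall V : H, nmem H V -> edot V V <= K * Hdot V V.
Proof.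
pose K := c1 + 1 + tau * d1 + tau * d2.
have td1 : 0 < tau * d1 by exact: mulr_gt0.
have td2 : 0 < tau * d2 by exact: mulr_gt0.
have K0 : 0 < K by rewrite !addr_gt0.
exists K => // -[[[v1 v2] v3] v4] [[[/= m1 m2] mv3] mv4].
rewrite /edot /Hdot /pform /= !mulrDr.
have key d (v : BochnerL2 H1) : nmem (BochnerL2 H1) v -> 0 <= d -> d / 2 <= K ->
   d / 2 * wform (E := H1) grad (fun=> 1) v v <= K * wform (E := H1) (h1dot Omega) (fun=> 1) v v.
  move=> mv d0 dK; have [pv _ _] := mv; have W0 := si_ge0 wgrad1 mv.
  apply: ler_pM => //; first by rewrite divr_ge0.
  exact: wform_grad_le.
have [kc k1 k3 k4] := half_le_sum4 hc1 ltr01 td1 td2.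
apply: (lerD _ (key (tau * d2) v4 mv4 (ltW td2) k4)).
apply: (lerD _ (key (tau * d1) v3 mv3 (ltW td1) k3)).
have G0 := si_ge0 hg1 m1; have P0 := si_ge0 hl m2; have G1 := grad_le m1.
have q1 : c1 / 2 * grad v1 v1 <= K * grad v1 v1 by exact: ler_wpM2r.
have q2 : 1 / 2 * l2 v2 v2 <= K * l2 v2 v2 by exact: ler_wpM2r.
have q3 : K * grad v1 v1 <= K * l2 v1 v1 + K * grad v1 v1.
  by rewrite lerDr; apply: mulr_ge0; [exact: ltW|exact: (si_ge0 hl (H1_L2 m1))].
exact: (lerD (le_trans q1 q3) q2).
Qed.

Lemma edot_null (U V : H) : nmem H U -> nmem H V -> nnorm H (U - V) = 0 -> edot U U = edot V V.
Proof.
move=> mU mV e; have hE := edot_semi_inner; have hH := Hdot_semi_inner.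
have [K _ hK] := edot_le_Hdot.
rewrite Hdot_norm in e; last exact: (si_memB hH).
rewrite (null_form hE hH hK mU mV mU e) (si_sym hE mV mU).
exact: (null_form hE hH hK mU mV mV e).
Qed.

(** Since $w=-\tau^{-1}\partial_sv$, the factor $\tau$ of the functional cancels and the weighted
    chain rule applies to a weight equal to $K+\delta$ at $s=0$ and to $K$ at $s=1$. Its slope
    $-\delta$ produces the damping of the history itself. *)
Lemma history_derivative (K : R) (x z : H1) (v g w : BochnerL2 H1) : 0 < K ->
  is_sderiv v g -> nmem (BochnerL2 H1) w -> nnorm (BochnerL2 H1) (w - (- tau^-1) *: g) = 0 ->
  has_strace v 0 x -> has_strace v 1 z ->
  2 * (tau * wform (E := H1) grad (fun s => (K + dl) + - dl * s) v w) =
    - K * grad z z + (K + dl) * grad x x - dl * wform (E := H1) grad (fun=> 1) v v.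
Proof.
move=> K0 sd mw e t0 t1; have [mv mg _] := sd.
have hr : semi_inner (nmem (BochnerL2 H1)) (wform (E := H1) grad (fun s => (K + dl) + - dl * s)).
  by apply: wgrad_semi_inner; [exact/ltW/addr_gt0|rewrite addrK ltW].
have mz := si_memZ hBo (- tau^-1) mg.
rewrite (BochnerL2_norm hh1 hn1) in e; last exact: (si_memB hBo).
have le (y : BochnerL2 H1) : nmem (BochnerL2 H1) y ->
   wform (E := H1) grad (fun s => (K + dl) + - dl * s) y y <= (K + dl) * wform (E := H1) (h1dot Omega) (fun=> 1) y y.
  move=> my; have /andP[_ h] := wform_weight_bounds K my; apply: (le_trans h).
  by apply: ler_wpM2l; [exact/ltW/addr_gt0|exact: wform_grad_le].
rewrite (si_sym hr mv mw) (null_form hr hBo le mw mz mv e) (si_Zl hr _ mg mv) (si_sym hr mg mv).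
have := sderiv_strace_weighted_sqr hh1 hn1 hg1 grad_le (K + dl) (- dl) sd t0 t1.
rewrite addrK => h.
have -> : 2 * (tau * (- tau^-1 * wform (E := H1) grad (fun s => (K + dl) + - dl * s) v g)) =
   - (2 * wform (E := H1) grad (fun s => (K + dl) + - dl * s) v g) by field; rewrite gt_eqF.
rewrite h; move: (grad z z) (grad x x) (wform _ (fun=> 1) v v) => X Y Z; ring.
Qed.

Lemma lyap_dissipation (p : R) : 0 < p -> K3 = (N + 1) * c2 * p -> K4 = (N + 1) * d2 * p ->
  dl <= c1 - (4 * p)^-1 * (c2 + d1 + d2) - K3 - dl ->
  dl <= N * d1 - N * (4 * p)^-1 * (c2 + d2) - d1 * p - cp - K4 - dl ->
  forall (v1 : H1) (v2 : L2 Omega) (v3 v4 : BochnerL2 H1) (W : H),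
  opA tau c1 c2 d1 d2 ((v1, v2, v3, v4) : H) W ->
  2 * lyap (v1, v2, v3, v4) W <= - dl * (grad v1 v1 + grad v2 v2 +
    wform (E := H1) grad (fun=> 1) v3 v3 + wform (E := H1) grad (fun=> 1) v4 v4).
Proof.
move=> p0 eK3 eK4 y1 y2 v1 v2 v3 v4 [[[w1 w2] w3] w4].
move=> [mV mW [mv2 ew1] [[g3 [sd3 e3]] [g4 [sd4 e4]]] [t30 t40 [z3 [z4 [t31 t41 _ weak]]]]].
have [[[mv1 _] mv3] mv4] := mV; have [[[mw1 mw2] mw3] mw4] := mW.
have mz3 : nmem H1 z3 by case: t31.
have mz4 : nmem H1 z4 by case: t41.
have [mv1' mv2' mw1'] := And3 (H1_L2 mv1) (H1_L2 mv2) (H1_L2 mw1).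
have N0 : 0 <= N by apply: le_trans sigma0 _; exact: ltW.
have h3 := history_derivative hK3 sd3 mw3 e3 t30 t31.
have h4 := history_derivative hK4 sd4 mw4 e4 t40 t41.
rewrite (hn1 (si_memB hh1 mw1 mv2)) in ew1.
have gle (y : H1) : nmem H1 y -> grad y y <= 1 * h1dot Omega y y.
  by move=> my; rewrite mul1r; exact: grad_le.
(* The first equation gives $w_1=v_2$ up to a null function of $H^1$. This prepares the cancellation
   of the elastic term and turns $(w_1,v_2)$ into $\|v_2\|^2$. *)
have e12 : grad v1 w1 = grad v2 v1.
  by rewrite (si_sym hg1 mv1 mw1); exact: (null_form hg1 hh1 gle mw1 mv2 mv1 ew1).
have e22 : l2 w1 v2 = l2 v2 v2.
  have m := si_memB hh1 mw1 mv2; have m' := H1_L2 m.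
  apply/eqP; rewrite -subr_eq0 -(si_Bl hl mw1' mv2' mv2'); apply/eqP; apply: (si_norm0_l hl m' mv2').
  have h0 : h1dot Omega (w1 - v2) (w1 - v2) = 0 by rewrite -(si_norm_sqr hh1 m) ew1 expr0n.
  apply/eqP; rewrite /si_norm sqrtr_eq0 -h0 /h1dot lerDl; exact: (si_ge0 hg1 m).
have k1 := weak _ mv1; have k2 := weak _ mv2.
have r1 : l2 v1 w2 = l2 w2 v1 := si_sym hl mv1' mw2.
have r2 : l2 v2 w2 = l2 w2 v2 := si_sym hl mv2' mw2.
have r3 : grad v1 v2 = grad v2 v1 := si_sym hg1 mv1 mv2.
rewrite r3 in k2.
have Y1 := si_ge0 hg1 mv1; have Y2 := si_ge0 hg1 mv2.
have W3 := si_ge0 wgrad1 mv3; have W4 := si_ge0 wgrad1 mv4.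
have LE : lyap (v1, v2, v3, v4) (w1, w2, w3, w4) = N * c1 / 2 * grad v1 w1 + N / 2 * l2 v2 w2
   + (1 / 2 * l2 v1 w2 + 1 / 2 * l2 w1 v2)
   + tau * wform (E := H1) grad (fun s => (K3 + dl) + - dl * s) v3 w3
   + tau * wform (E := H1) grad (fun s => (K4 + dl) + - dl * s) v4 w4 by [].
rewrite LE e12 e22 r1 r2.
exact: (lyapunov_inequality N0 (ltW hc2) (ltW hd1) (ltW hd2) Y1 Y2 W3 W4 (lexx dl) eK3 eK4 y1 y2
  k1 k2 h3 h4 (poincare mv2) (young hg1 p0 mz3 mv2) (young hg1 p0 mz4 mv2) (young hg1 p0 mz3 mv1)
  (young hg1 p0 mz4 mv1) (young hg1 p0 mv2 mv1)).
Qed.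

(** In the domain the velocity lies in $H^1_{\Gamma_0}(\Omega)$, so Poincaré's inequality bounds the
    kinetic energy by the dissipated $\|\nabla v_2\|^2$, and the whole functional is controlled by
    the dissipation. *)
Lemma lyap_decay_rate (p : R) : 0 < p -> K3 = (N + 1) * c2 * p -> K4 = (N + 1) * d2 * p ->
  dl <= c1 - (4 * p)^-1 * (c2 + d1 + d2) - K3 - dl ->
  dl <= N * d1 - N * (4 * p)^-1 * (c2 + d2) - d1 * p - cp - K4 - dl ->
  exists2 alpha : R, 0 < alpha & forall V W : H, opA tau c1 c2 d1 d2 V W ->
    lyap V W <= - alpha * lyap V V.
Proof.
move=> p0 eK3 eK4 y1 y2; have [M M0 hM] := lyap_le_edot.
pose k := cp + c1 + tau * d1 + tau * d2.
have td1 : 0 < tau * d1 by exact: mulr_gt0.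
have td2 : 0 < tau * d2 by exact: mulr_gt0.
have k0 : 0 < k by rewrite !addr_gt0.
have [kp kc k3 k4] := half_le_sum4 hcp hc1 td1 td2.
(* With [S] the sum of the dissipated squares, $2L(V,W)\le-\delta S$ while $L(V,V)\le MkS$. *)
exists (dl / (2 * (M * k))); first by rewrite divr_gt0// !mulr_gt0.
move=> [[[v1 v2] v3] v4] W VW.
have [mV [mv2 _]] : nmem H ((v1, v2, v3, v4) : H) /\ nmem H1 v2 /\ True.
  by case: W VW => [[[w1 w2] w3] w4] [mV _ [mv2 _] _ _].
have [[[mv1 _] mv3] mv4] := mV.
have D := lyap_dissipation p0 eK3 eK4 y1 y2 VW.
set S := grad v1 v1 + _ + _ + _ in D.
have eS : edot (v1, v2, v3, v4) (v1, v2, v3, v4) <= k * S.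
  have Y1 := si_ge0 hg1 mv1; have Y2 := si_ge0 hg1 mv2.
  have W3 := si_ge0 wgrad1 mv3; have W4 := si_ge0 wgrad1 mv4.
  rewrite /edot /pform /= /S !mulrDr.
  have q1 := ler_wpM2r Y1 kc; have q3 := ler_wpM2r W3 k3; have q4 := ler_wpM2r W4 k4.
  have q2 : 1 / 2 * l2 v2 v2 <= k * grad v2 v2.
    apply: (le_trans _ (ler_wpM2r Y2 kp)).
    have -> : cp / 2 * grad v2 v2 = 1 / 2 * (cp * grad v2 v2) by field.
    by apply: ler_wpM2l; [exact: divr_ge0|exact: poincare].
  exact: (lerD (lerD (lerD q1 q2) q3) q4).
have LS : lyap (v1, v2, v3, v4) (v1, v2, v3, v4) <= M * k * S.
  by apply: (le_trans (hM _ mV)); rewrite -mulrA ler_pM2l.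
have Mk : 0 < M * k by exact: mulr_gt0.
have : dl / (2 * (M * k)) * lyap (v1, v2, v3, v4) (v1, v2, v3, v4) <= dl / (2 * (M * k)) * (M * k * S).
  by rewrite ler_pM2l// divr_gt0// mulr_gt0.
have -> : dl / (2 * (M * k)) * (M * k * S) = dl * S / 2.
  by move: (M * k) Mk => z z0; field; rewrite gt_eqF.
set y := lyap _ (v1, v2, v3, v4); set x := lyap _ W in D * => h.
by rewrite mulNr; rewrite mulNr in D; move: (_ * y) (dl * S) h D => z t; lra.
Qed.

Lemma opA_mem (V W : H) : opA tau c1 c2 d1 d2 V W -> nmem H V /\ nmem H W.
Proof. by move: V W => [[[v1 v2] v3] v4] [[[w1 w2] w3] w4] []. Qed.

Lemma laplacian_inL2 (phi : 'rV[R]_n.+1 -> R) : test_fun Omega phi ->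
  inL2 Omega (fun x => \sum_i partial i (partial i phi) x).
Proof.
move=> [sphi _ _]; apply: (continuous_inL2 oO bO); apply: smooth_continuous.
by apply: smooth_sum => i; do 2!apply: smooth_partial.
Qed.

(** The displacement [u1] is kept and [u2] is replaced by a test function. Everything else is done
    by the histories, whose end values at $s=0$ and $s=1$ can be prescribed at arbitrarily small
    cost in the norm. *)
Lemma opA_dense (U : H) (e : R) : nmem H U -> 0 < e ->
  exists V W : H, opA tau c1 c2 d1 d2 V W /\ si_norm Hdot (U - V) < e.
Proof.
move: U => [[[u1 u2] u3] u4] [[[/= m1 m2] m3] m4] e0.
have e20 : 0 < e / 2 by rewrite divr_gt0.
have e40 : 0 < (e / 2) ^+ 2 by rewrite exprn_gt0.
have [v2 tv2 hv2] := test_dense oO bO m2 e40.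
have mv2 : nmem H1 v2 := test_H1z oO bO SO tv2.
have mv2' := H1_L2 mv2.
(* With the end values v3(1) = z3 and v4(1) = 0 the total stress vanishes, so that
   the second component of A V is 0. *)
pose z3 : H1 := (- c2^-1) *: (c1 *: (u1 : H1) + d1 *: (v2 : H1)).
have mz3 : nmem H1 z3.
  apply: (si_memZ hg1 (- c2^-1)); exact: (si_memD hg1 (si_memZ hg1 c1 m1) (si_memZ hg1 d1 mv2)).
have m0 : nmem H1 0 := si_mem0 hg1.
have [l3 [wl3 l30 l31 h3]] := BochnerL2_C1_dense hh1 hn1 m3 m1 mz3 e20.
have [l4 [wl4 l40 l41 h4]] := BochnerL2_C1_dense hh1 hn1 m4 mv2 m0 e20.
pose g l : BochnerL2 H1 := (- tau^-1) *: (lsum (lderive l) : BochnerL2 H1).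
have mg l : lwf (@C1 R) l -> nmem (BochnerL2 H1) (g l).
  by move=> wl; apply: (si_memZ hBo); apply: (lsum_BochnerL2 hh1 hn1); exact: lderive_wf.
have ml l : lwf (@C1 R) l -> nmem (BochnerL2 H1) (lsum l).
  by move=> wl; apply: (lsum_BochnerL2 hh1 hn1); exact: lwf_C1_continuous.
have i0 : 0 <= (0 : R) <= 1 by rewrite lexx ler01.
have i1 : 0 <= (1 : R) <= 1 by rewrite lexx ler01.
have tr l s x : lwf (@C1 R) l -> 0 <= s <= 1 -> lsum l s = x -> has_strace (lsum l : R -> H1) s x.
  by move=> wl s01 <-; exact: (lsum_strace hh1 hn1).
have c20 : c2 != 0 by rewrite gt_eqF.
exists (u1, v2, lsum l3, lsum l4), (v2, 0, g l3, g l4); split.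
  split.
  - exact: (conj (conj (conj m1 mv2') (ml _ wl3)) (ml _ wl4)).
  - exact: (conj (conj (conj mv2 (si_mem0 hl)) (mg _ wl3)) (mg _ wl4)).
  - split; first exact: mv2.
    by rewrite subrr (hn1 m0); exact: (si_norm0 hh1).
  - split; [exists (lsum (lderive l3))|exists (lsum (lderive l4))].
      split; first exact: (lsum_sderiv hh1 hn1).
      by rewrite subrr (BochnerL2_norm hh1 hn1 (si_mem0 hBo)); exact: (si_norm0 hBo).
    split; first exact: (lsum_sderiv hh1 hn1).
    by rewrite subrr (BochnerL2_norm hh1 hn1 (si_mem0 hBo)); exact: (si_norm0 hBo).
  split; [exact: (tr _ _ _ wl3 i0 l30)|exact: (tr _ _ _ wl4 i0 l40)|exists z3, 0].
  split; [exact: (tr _ _ _ wl3 i1 l31)|exact: (tr _ _ _ wl4 i1 l41)| |].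
  - move=> phi tphi; have mL := laplacian_inL2 tphi.
    rewrite (si_0l hl (test_inL2 oO bO tphi)) /dlap; symmetry.
    exact: (stress_free c1 d1 d2 hl c20 (H1_L2 m1) mv2' mL).
  - move=> psi mpsi; rewrite (si_0l hl (H1_L2 mpsi)); apply/eqP; rewrite eq_sym oppr_eq0; apply/eqP.
    exact: (stress_free c1 d1 d2 hg1 c20 m1 mv2 mpsi).
apply: sqrt_lt => //.
change (h1dot Omega (u1 - u1) (u1 - u1) + l2 (u2 - v2) (u2 - v2)
  + wform (E := H1) (h1dot Omega) (fun=> 1) (u3 - lsum l3) (u3 - lsum l3)
  + wform (E := H1) (h1dot Omega) (fun=> 1) (u4 - lsum l4) (u4 - lsum l4) < e ^+ 2).
have sq (u : BochnerL2 H1) l : nmem (BochnerL2 H1) u -> lwf (@C1 R) l ->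
    nnorm (BochnerL2 H1) (u - (lsum l : BochnerL2 H1)) < e / 2 ->
    wform (E := H1) (h1dot Omega) (fun=> 1) (u - (lsum l : BochnerL2 H1)) (u - (lsum l : BochnerL2 H1)) < (e / 2) ^+ 2.
  move=> mu wl; have m := si_memB hBo mu (ml _ wl).
  rewrite (BochnerL2_norm hh1 hn1 m) -(si_norm_sqr hBo m) => h.
  by rewrite ltr_pXn2r ?nnegrE ?si_norm_ge0// ltW.
have s3 := sq _ _ m3 wl3 h3; have s4 := sq _ _ m4 wl4 h4.
have h00 : h1dot Omega (u1 - u1) (u1 - u1) = 0 by rewrite subrr (si_0l hh1 m0).
rewrite h00 add0r.
exact: lt_trans (ltrD (ltrD hv2 s3) s4) (three_halves_lt e0).
Qed.

End delay_energy.

(** * Exponential decay of the energy along mild solutions *)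

Theorem theorem3p4 (R : realType) (n : nat)
    (Omega Gamma0 Gamma1 : set 'rV[R]_n.+1)
    (hOmega : bounded_lipschitz_domain Omega)
    (hGamma0 : relatively_open (frontier Omega) Gamma0)
    (hGamma1 : relatively_open (frontier Omega) Gamma1)
    (hGamma : frontier Omega = closure Gamma0 `|` closure Gamma1)
    (hdisj : closure Gamma0 `&` closure Gamma1 = set0)
    (hne : Gamma0 !=set0)
    (cp : R) (hcp : 0 < cp)
    (hpoincare : forall u, nmem (H1z Omega Gamma0) u ->
      l2norm Omega u ^+ 2 <= cp * gradnorm Omega u ^+ 2)
    (tau c1 c2 d1 d2 : R)
    (htau : 0 < tau) (hc1 : 0 < c1) (hc2 : 0 < c2) (hd1 : 0 < d1) (hd2 : 0 < d2)
    (hd : d1 ^+ 2 >= d2 * (c2 + d2))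
    (hc : c1 ^+ 2 >= c2 * (c2 + d1 + d2))
    (hden : d1 ^+ 2 - d2 * (c2 + d2) != 0)
    (hcond : (2 * d1 * cp + (d1 + d2) * (c2 + d2)) / (d1 ^+ 2 - d2 * (c2 + d2))
      < 2 * c1 * d1 / (c2 * (c2 + d2)) - 1
        - d1 ^+ 2 * (c2 + d1 + d2) / (c2 * (c2 + d2) ^+ 2))
    (hsqrt : Num.sqrt (cp / c1)
      < d1 / (c2 * (c2 + d2))
        * (2 * c1 - (c2 * d1 + d1 ^+ 2 + d1 * d2) / (c2 + d2)
           - c2 * (c2 + d2) / d1))
    (T : R -> Hspace Omega Gamma0 -> Hspace Omega Gamma0)
    (hT : C0_semigroup T)
    (hA : is_generator (@opA R n Omega Gamma0 tau c1 c2 d1 d2) T)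
    (V0 : Hspace Omega Gamma0) (hV0 : nmem (Hspace Omega Gamma0) V0)
    (V : R -> Hspace Omega Gamma0) (hV : is_mild_solution T V0 V) :
  exists alpha C : R, [/\ 0 < alpha, 0 < C &
    forall t : R, 0 <= t ->
      energy tau c1 d1 d2 (V t)
        <= C * expR (- 2 * alpha * t) * energy tau c1 d1 d2 (V 0)].
Proof.
have [oO _ bO _] := hOmega.
have mS := @frontier_part_measurable R n n Omega Gamma0 hGamma0.
have SO := frontier_part_disjoint oO hGamma0.
have [N [p [dl [hN p0 hdl y1 y2]]]] := lyapunov_parameters hcp hc1 hc2 hd1 hd2 hd hden hcond hsqrt.
pose K3 := (N + 1) * c2 * p; pose K4 := (N + 1) * d2 * p.
have N1 : 0 < N + 1 by rewrite ltr_wpDl// (le_trans (sqrtr_ge0 _) (ltW hN)).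
have hK3 : 0 < K3 by apply: mulr_gt0 => //; exact: mulr_gt0.
have hK4 : 0 < K4 by apply: mulr_gt0 => //; exact: mulr_gt0.
have hH := Hdot_semi_inner oO bO mS SO; have hnH := Hdot_norm oO bO mS SO.
pose E := edot (Gamma0 := Gamma0) (Omega := Omega) tau c1 d1 d2.
pose L := lyap (Gamma0 := Gamma0) (Omega := Omega) tau c1 N K3 K4 dl.
have hE : semi_inner (nmem (Hspace Omega Gamma0)) E := edot_semi_inner oO bO mS SO htau hc1 hd1 hd2.
have hL : semi_inner (nmem (Hspace Omega Gamma0)) L.
  exact: (lyap_semi_inner oO bO mS SO hcp hpoincare htau hc1 hN hK3 hK4 hdl).
have [m m0 hm] : exists2 m : R, 0 < m & forall U, nmem (Hspace Omega Gamma0) U -> m * E U U <= L U U.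
  exact: (edot_le_lyap oO bO mS SO hcp hpoincare htau hc1 hd1 hd2 hN hK3 hK4 hdl).
have [M M0 hM] : exists2 M : R, 0 < M & forall U, nmem (Hspace Omega Gamma0) U -> L U U <= M * E U U.
  exact: (lyap_le_edot oO bO mS SO hcp hpoincare htau hc1 hd1 hd2 hN hK3 hK4 hdl).
have [K K0 hK] : exists2 K : R, 0 < K & forall U, nmem (Hspace Omega Gamma0) U -> E U U <= K * Hdot U U.
  exact: (edot_le_Hdot oO bO mS SO htau hc1 hd1 hd2).
have [alpha a0 dissip] : exists2 alpha : R, 0 < alpha & forall U W : Hspace Omega Gamma0,
    opA tau c1 c2 d1 d2 U W -> L U W <= - alpha * L U U.
  exact: (lyap_decay_rate oO bO mS SO hcp hpoincare htau hc1 hc2 hd1 hd2 hN hK3 hK4 hdl p0 erefl erefl y1 y2).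
have LN U : nmem (Hspace Omega Gamma0) U -> si_norm L U <= Num.sqrt (M * K) * si_norm (@Hdot _ _ Omega Gamma0) U.
  move=> mU; rewrite /si_norm -sqrtrM; last by apply: mulr_ge0; exact: ltW.
  apply: ler_wsqrtr; apply: (le_trans (hM _ mU)); rewrite -mulrA ler_pM2l//; exact: hK.
have dense := opA_dense oO bO mS SO tau c1 d1 d2 hc2.
(* The factor $M/m$ is the price of passing from the energy to the functional at time $0$ and back
   at time [t]. *)
exists alpha, (M / m); split; [exact: a0|exact: divr_gt0|move=> t t0].
have [mVt eVt] := hV _ t0; have [mV0 eV0] := hV _ (lexx 0).
have mT0 := semigroup_mem hT (lexx 0) hV0; have mTt := semigroup_mem hT t0 hV0.
have Enull := edot_null oO bO mS SO htau hc1 hd1 hd2.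
have decay := semigroup_decay hH hnH hT hA (@opA_mem _ _ _ _ _ _ _ _ _) hL (sqrtr_ge0 _) LN a0 dissip dense hV0 t0.
(* [V] consists of representatives of the orbit only, so both energies are moved to the orbit of
   [V0] through null differences. *)
have e0 : energy tau c1 d1 d2 (V 0) = E V0 V0.
  apply: (etrans (energyE oO bO mS SO tau c1 d1 d2 mV0)).
  exact: (etrans (Enull _ _ mV0 mT0 eV0) (Enull _ _ mT0 hV0 (semigroup_id hT hV0))).
have et : energy tau c1 d1 d2 (V t) = E (T t V0) (T t V0).
  exact: (etrans (energyE oO bO mS SO tau c1 d1 d2 mVt) (Enull _ _ mVt mTt eVt)).
rewrite e0 et -(ler_pM2l m0); apply: (le_trans (hm _ mTt)); apply: (le_trans decay).
have -> : m * (M / m * expR (- 2 * alpha * t) * E V0 V0) = expR (- 2 * alpha * t) * (M * E V0 V0).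
  by move: (expR _) (E _ _) => x y; field; rewrite gt_eqF.
by rewrite ler_pM2l ?expR_gt0//; exact: hM.
Qed.
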